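(* Let $\Omega$ be a bounded convex domain in $\mathbb{R}^n$, $n\geq 3$, let $\beta>0$ and let $N\geq 2$. Let $H,\tilde H\in C^{1,\beta}(\bar\Omega,\mathbb{C}^{N\times N})$ be pointwise hermitean. Suppose the sets $\mathscr{I},\mathscr{F}\subset\mathbb{C}^N$ give ideal data. Then the following are equivalent: (a) $H$ and $\tilde H$ give the same data, i.e. $|\Phi^*U_H^\gamma\Psi|=|\Phi^*U_{\tilde H}^\gamma\Psi|$ for every $\Psi\in\mathscr{I}$, every $\Phi\in\mathscr{F}$ and every unit speed line segment $\gamma\colon[0,T]\to\bar\Omega$ with endpoints on $\partial\Omega$; (b) $\tilde H=H+\varphi I$ in $\Omega$ for some scalar function $\varphi\colon\Omega\to\mathbb{R}$, where $I$ is the identity matrix.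
   Context: Line segments $\gamma(t)=x_0+tv$ have $|v|=1$. For a continuous hermitean matrix valued function $H$ on $\bar\Omega$ and a line segment $\gamma\colon[0,T]\to\bar\Omega$, the time evolution operator $U_H^\gamma(t_2,t_1)\in U(N)$ is the solution operator of $i\Psi'(t)=H(\gamma(t))\Psi(t)$, $\Psi(t)\in\mathbb{C}^N$, so that $\Psi(t_2)=U_H^\gamma(t_2,t_1)\Psi(t_1)$ for every solution; and $U_H^\gamma:=U_H^\gamma(T,0)$. A pair of subsets $\mathscr{I},\mathscr{F}\subset\mathbb{C}^N$ gives ideal data if for any two unitary $N\times N$ matrices $U$ and $V$, the condition $|a^*Ub|=|a^*Vb|$ for all $a\in\mathscr{F}$ and $b\in\mathscr{I}$ implies $U=e^{i\phi}V$ for some $\phi\in\mathbb{R}$. *)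

(* Defs.v *)
From HB Require Import structures.
From mathcomp Require Import all_boot all_order all_algebra.
From mathcomp Require Import all_classical all_reals all_analysis.
From mathcomp Require Import complex.

Set Implicit Arguments.
Unset Strict Implicit.
Unset Printing Implicit Defensive.

Import Order.TTheory GRing.Theory Num.Theory.
Import numFieldNormedType.Exports.

Local Open Scope classical_set_scope.
Local Open Scope ring_scope.
Local Open Scope complex_scope.
Local Open Scope sesquilinear_scope.

(* The library norm on 'rV[R]_n is the sup norm; lengths here are Euclidean. *)
Definition enorm (R : realType) (n : nat) (v : 'rV[R]_n) : R :=
  Num.sqrt (\sum_(i < n) v ord0 i ^+ 2).

Definition boundary (T : topologicalType) (A : set T) : set T :=
  closure A `\` interior A.

Definition bounded_convex_domain (R : realType) (n : nat)
    (Omega : set 'rV[R]_n) : Prop :=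
  [/\ Omega !=set0, open Omega, bounded_set Omega
    & convex_set (Omega : set (convex_lmodType 'rV[R]_n))].

Definition holder_on (R : realType) (n : nat) (beta : R) (A : set 'rV[R]_n)
    (f : 'rV[R]_n -> R) : Prop :=
  exists C : R, forall x y : 'rV[R]_n, A x -> A y ->
    `|f x - f y| <= C * enorm (x - y) `^ beta.

(* f is in C^{1,beta}(closure Omega): f is continuous on the closure, and each
   first partial derivative exists in Omega and is there the restriction of a
   function g that is beta-Hoelder on the closure. *)
Definition C1holder (R : realType) (n : nat) (beta : R) (Omega : set 'rV[R]_n)
    (f : 'rV[R]_n -> R) : Prop :=
  {within closure Omega, continuous f} /\
  forall i : 'I_n, exists g : 'rV[R]_n -> R,
    (forall x, Omega x -> is_derive x (delta_mx ord0 i) f (g x)) /\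
    holder_on beta (closure Omega) g.

Definition C1holder_mx (R : realType) (n N : nat) (beta : R)
    (Omega : set 'rV[R]_n) (H : 'rV[R]_n -> 'M[R[i]]_N) : Prop :=
  forall j k : 'I_N,
    C1holder beta Omega (fun x => complex.Re (H x j k)) /\
    C1holder beta Omega (fun x => complex.Im (H x j k)).

(* Psi solves i Psi'(t) = H(gamma(t)) Psi(t) on [0, T].  Psi is continuous on
   [0, T] and differentiable inside; as H \o gamma is continuous on [0, T], the
   one-sided derivatives at 0 and T then exist and satisfy the equation too.
   Continuity and derivatives of C-valued functions are taken on real and
   imaginary parts. *)
Definition schrodinger_solution (R : realType) (n N : nat)
    (H : 'rV[R]_n -> 'M[R[i]]_N) (gamma : R -> 'rV[R]_n) (T : R)
    (Psi : R -> 'cV[R[i]]_N) : Prop :=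
  (forall j : 'I_N,
     {within `[0, T], continuous (fun t => complex.Re (Psi t j ord0))} /\
     {within `[0, T], continuous (fun t => complex.Im (Psi t j ord0))}) /\
  exists dPsi : R -> 'cV[R[i]]_N, forall t : R, t \in `]0, T[ ->
    (forall j : 'I_N,
       is_derive t 1 (fun s => complex.Re (Psi s j ord0))
         (complex.Re (dPsi t j ord0)) /\
       is_derive t 1 (fun s => complex.Im (Psi s j ord0))
         (complex.Im (dPsi t j ord0))) /\
    (0 +i* 1) *: dPsi t = H (gamma t) *m Psi t.

(* U_H^gamma(t2, t1); for H continuous along gamma and t1, t2 in [0, T] there is
   exactly one such matrix, the value 0 being a default outside this case. *)
Definition evolution (R : realType) (n N : nat) (H : 'rV[R]_n -> 'M[R[i]]_N)
    (gamma : R -> 'rV[R]_n) (T t2 t1 : R) : 'M[R[i]]_N :=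
  xget 0 [set U : 'M[R[i]]_N | U \is unitarymx /\
    forall Psi : R -> 'cV[R[i]]_N,
      schrodinger_solution H gamma T Psi -> Psi t2 = U *m Psi t1].

Definition amplitude (R : realType) (N : nat) (a : 'cV[R[i]]_N)
    (U : 'M[R[i]]_N) (b : 'cV[R[i]]_N) : R[i] :=
  (a ^t* *m U *m b) ord0 ord0.

Definition ideal_data (R : realType) (N : nat) (I F : set 'cV[R[i]]_N) : Prop :=
  forall U V : 'M[R[i]]_N, U \is unitarymx -> V \is unitarymx ->
    (forall a b : 'cV[R[i]]_N, F a -> I b ->
       `|amplitude a U b| = `|amplitude a V b|) ->
    exists phi : R, U = (cos phi +i* sin phi) *: V.

Definition segment_path (R : realType) (n : nat) (x v : 'rV[R]_n) (t : R) :
    'rV[R]_n :=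
  x + t *: v.

Definition boundary_segment (R : realType) (n : nat) (Omega : set 'rV[R]_n)
    (x v : 'rV[R]_n) (T : R) : Prop :=
  [/\ 0 < T, enorm v = 1,
      forall t : R, t \in `[0, T] -> closure Omega (segment_path x v t),
      boundary Omega (segment_path x v 0)
    & boundary Omega (segment_path x v T)].

Definition same_data (R : realType) (n N : nat) (Omega : set 'rV[R]_n)
    (I F : set 'cV[R[i]]_N) (H H' : 'rV[R]_n -> 'M[R[i]]_N) : Prop :=
  forall (Psi Phi : 'cV[R[i]]_N) (x v : 'rV[R]_n) (T : R),
    I Psi -> F Phi -> boundary_segment Omega x v T ->
    `|amplitude Phi (evolution H (segment_path x v) T T 0) Psi| =
    `|amplitude Phi (evolution H' (segment_path x v) T T 0) Psi|.

(* Main.v *)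
(* Equality of the transition amplitudes on a chord gives, by ideality of the
   data, U = e^{i phi} U' there.  The tensor square of K = U U'^* with its
   conjugate forgets the phase; minus its initial value it solves along the chord
   a linear system u' = A u + f with u = 0 at both ends, where A is built from H
   and H', and f(x) = 0 exactly when (H' - H)(x) is a real scalar matrix.  Short
   chords give f = 0 on the boundary, so f extends by zero to a Lipschitz
   function.

   Assume f <> 0 somewhere and let F(x) be the squared length of the first three
   coordinates of x.  Near a point of the support of f where F is almost maximal,
   the support meets the plane through this point orthogonal to these three
   coordinates of the point in an arbitrarily small disc.  In such a plane there
   is for each direction a compactly supported solution of the transport
   equation, and a Pestov energy identity forces f = 0 at the point: the
   commutator of the directional derivatives controls the angular derivative of
   u, the Poincare inequality on the small disc absorbs A, and the source terms
   cancel after integration by parts.  As H and H' are only C^{1,beta}, hence f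
   only Lipschitz up to the boundary, the identity is proved for finite
   differences of block averages on a fine lattice, over finitely many
   equidistributed directions, with all errors tending to zero.

   Conversely, if H' - H is a real scalar matrix then U^* U' is a scalar of
   modulus one. *)

(* The coefficient [a] and the source [f] of the planar system do not depend on the direction. Hence
   [f] drops out of the difference of the equations for two neighbouring directions, and what is
   left is [a] times the angular difference [W] of the solution. In the Pestov identity the square
   of the directional derivative of [u] has the favourable sign, so that this derivative, then [u],
   then [f] become small in mean square. The admissible radius of the disc depends only on a bound
   for [a]; it is fixed before the point, so no maximum has to be attained. The identity is finally
   divided by the square of the angular step [h], so all errors must be o(h^2). This forces the
   order s << sg << h << e << 1 for the lattice step, the step of differentiation, the angular step
   and the side of the averaging blocks. It also requires a better estimate of [W] minus its average
   than size and Lipschitz bounds give. That estimate rests on second differences of [a] and [f],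
   which are small except near the boundary of the slice of the domain; convexity of the slice makes
   the lattice points there a small proportion. *)
Require Import Defs.
From mathcomp Require Import all_boot all_order all_algebra.
From mathcomp Require Import all_classical all_reals all_analysis.
From mathcomp Require Import complex.
From mathcomp Require Import ring lra.

Set Implicit Arguments.
Unset Strict Implicit.
Unset Printing Implicit Defensive.

Import Order.TTheory GRing.Theory Num.Theory.
Import numFieldNormedType.Exports.

Local Open Scope classical_set_scope.
Local Open Scope ring_scope.

(** * Differential inequalities *)

Section Calculus.
Variable R : realType.

Lemma is_derive_cont (f : R -> R) (x df : R) :
  is_derive x 1 f df -> {for x, continuous f}.
Proof. by move=> fx; apply/differentiable_continuous/derivable1_diffP; case: fx. Qed.

Lemma is_derive_within (f df : R -> R) (a b : R) :
  (forall x, x \in `[a, b] -> is_derive x 1 f (df x)) ->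
  {within `[a, b], continuous f}.
Proof.
by move=> H; apply: derivable_within_continuous => x /H [].
Qed.

Lemma derive_le0_le (f df : R -> R) (a b : R) : a <= b ->
  (forall x, x \in `]a, b[ -> is_derive x 1 f (df x)) ->
  {within `[a, b], continuous f} ->
  (forall x, x \in `]a, b[ -> df x <= 0) -> f b <= f a.
Proof.
move=> ab fd fc df0; have [<-//|neq] := eqVneq a b.
have altb : a < b by rewrite lt_neqAle neq.
have [c /df0 c0] := MVT altb fd fc.
rewrite -subr_le0 => ->; rewrite mulr_le0_ge0// subr_ge0//.
Qed.

Lemma is_deriveMr (f g : R -> R) (x df dg : R) :
  is_derive x 1 f df -> is_derive x 1 g dg ->
  is_derive x 1 (fun t => f t * g t) (df * g x + f x * dg).
Proof.
move=> fx gx; have := is_deriveM fx gx.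
move=> H; apply: is_derive_eq.
by rewrite /GRing.scale/=; ring.
Qed.

Lemma is_derive_affine (k a x : R) : is_derive x 1 (fun t => k * t + a) k.
Proof.
have := is_deriveD (is_deriveMr (is_derive_cst k x 1) (is_derive_id x 1))
  (is_derive_cst a x 1).
by move=> H; apply: is_derive_eq; rewrite mul0r add0r addr0 mulr1.
Qed.

Lemma is_derive_bigsum (I : finType) (f : I -> R -> R) (df : I -> R) (x : R) :
  (forall i, is_derive x 1 (f i) (df i)) ->
  is_derive x 1 (fun t => \sum_i f i t) (\sum_i df i).
Proof.
move=> H.
rewrite (_ : (fun t => _) = \sum_(k < #|I|) f (enum_val k)); last first.
  by apply/funext => t; rewrite fct_sumE (big_enum_val (A := predT)).
rewrite (_ : \sum_i df i = \sum_(k < #|I|) df (enum_val k)); last first.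
  by rewrite (big_enum_val (A := predT))/=.
by apply: is_derive_sum.
Qed.

(** The function [E t * expR (- c * (t - a)) - rho * (t - a)] is nonincreasing: the integrating
    factor is at most 1 on the interval and may be dropped in front of [rho]. *)
Lemma gronwall (E dE : R -> R) (a b c rho : R) : a <= b -> 0 <= c -> 0 <= rho ->
  (forall x, x \in `]a, b[ -> is_derive x 1 E (dE x)) ->
  {within `[a, b], continuous E} ->
  (forall x, x \in `]a, b[ -> dE x <= c * E x + rho) ->
  E b <= expR (c * (b - a)) * (E a + rho * (b - a)).
Proof.
move=> ab c0 rho0 Ed Ec dEle.
pose g t := expR (- c * (t - a)).
have gd (t : R) : is_derive t 1 g (- c * g t).
  have h : is_derive t 1 (fun t => - c * (t - a)) (- c).
    under eq_fun do rewrite mulrBr; exact: is_derive_affine.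
  have := is_derive1_comp (is_derive_expR _) h.
  by rewrite [X in is_derive _ _ _ X]mulrC.
pose F t := E t * g t - rho * (t - a).
pose dF t := dE t * g t + E t * (- c * g t) - rho.
have Fd (x : R) : x \in `]a, b[ -> is_derive x 1 F (dF x).
  move=> xab; have := Ed x xab => Edx.
  have -> : F = (fun t => E t * g t) - (fun t => rho * (t - a)) by [].
  apply: is_deriveB; first exact: is_deriveMr.
  by under eq_fun do rewrite mulrBr; exact: is_derive_affine.
have Fc : {within `[a, b], continuous F}.
  have -> : F = (fun t => E t * g t) - (fun t => rho * (t - a)) by [].
  move=> x; apply: continuousB.
    apply: continuousM; first exact: Ec.
    apply: continuous_subspaceT => y.
    exact: (is_derive_cont (gd y)).
  apply: continuous_subspaceT => y; apply: (@is_derive_cont _ _ rho).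
  by under eq_fun do rewrite mulrBr; exact: is_derive_affine.
have dF0 x : x \in `]a, b[ -> dF x <= 0.
  move=> xab; have /dEle H := xab.
  have g0 : 0 < g x by exact: expR_gt0.
  have g1 : g x <= 1.
    rewrite -expR0 ler_expR mulNr oppr_le0 mulr_ge0// subr_ge0 ltW//.
    by rewrite (itvP xab).
  rewrite /dF; have : g x * (dE x - c * E x) <= rho * 1.
    have H' : dE x - c * E x <= rho by lra.
    have := ler_wpM2l (ltW g0) H'; have := ler_wpM2l rho0 g1; lra.
  by lra.
have := derive_le0_le ab Fd Fc dF0.
rewrite /F subrr mulr0 subr0 {2}/g subrr mulr0 expR0 mulr1 => H.
have -> : E b = expR (c * (b - a)) * (E b * g b).
  by rewrite mulrCA /g mulNr expRN mulfV ?mulr1// gt_eqF// expR_gt0.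
by rewrite ler_wpM2l ?expR_ge0//; lra.
Qed.

End Calculus.

(** * Square norms of finite vectors and Gronwall for linear systems *)

Section VectorNorm.
Variables (R : realType) (I : finType).
Implicit Types (y z : I -> R) (m : I -> I -> R).

Definition nsq y : R := \sum_i y i ^+ 2.
Definition mv m y : I -> R := fun i => \sum_j m i j * y j.

Lemma nsq_ge0 y : 0 <= nsq y.
Proof. by apply: sumr_ge0 => i _; exact: sqr_ge0. Qed.

Lemma nsq_cst0 : nsq (fun=> 0) = 0.
Proof. by rewrite /nsq big1// => i _; rewrite expr0n. Qed.

Lemma nsq_eq0 y : nsq y = 0 -> forall i, y i = 0.
Proof.
move=> /eqP; rewrite psumr_eq0 => [/allP H i|i _]; last exact: sqr_ge0.
by apply/eqP; have := H i (mem_index_enum i); rewrite sqrf_eq0.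
Qed.

Lemma sqr_le_nsq y i : y i ^+ 2 <= nsq y.
Proof.
by rewrite /nsq (bigD1 i)//= lerDl; apply: sumr_ge0 => j _; exact: sqr_ge0.
Qed.

Lemma nsqD y z : nsq (fun i => y i + z i) <= 2 * nsq y + 2 * nsq z.
Proof.
rewrite /nsq !mulr_sumr -big_split/=; apply: ler_sum => i _.
by have := sqr_ge0 (y i - z i); nra.
Qed.

Lemma nsqB y z : nsq (fun i => y i - z i) <= 2 * nsq y + 2 * nsq z.
Proof.
rewrite /nsq !mulr_sumr -big_split/=; apply: ler_sum => i _.
by have := sqr_ge0 (y i + z i); nra.
Qed.

Lemma le_nsq (C : R) y : (forall i, `|y i| <= C) -> nsq y <= #|I|%:R * C ^+ 2.
Proof.
move=> yC; rewrite (le_trans (ler_sum _ (G := fun=> C ^+ 2) _))//.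
  move=> i _; rewrite -(real_normK (num_real (y i))) ler_pXn2r// ?nnegrE//.
  exact: le_trans (yC i).
by rewrite sumr_const mulr_natl.
Qed.

Lemma sqr_sum_le (J : finType) (z : J -> R) :
  (\sum_i z i) ^+ 2 <= #|J|%:R * \sum_i z i ^+ 2.
Proof.
have -> : (\sum_i z i) ^+ 2 = \sum_i \sum_j z i * z j.
  by rewrite expr2 mulr_suml; apply: eq_bigr => i _; rewrite mulr_sumr.
have -> : #|J|%:R * \sum_i z i ^+ 2 = \sum_i \sum_j (z i ^+ 2 + z j ^+ 2) / 2.
  under [RHS]eq_bigr do rewrite -mulr_suml big_split/= sumr_const.
  rewrite -mulr_suml big_split/= sumr_const -sumrMnl.
  by rewrite -mulr_natl sumrMnl -mulr_natl; field.
apply: ler_sum => i _; apply: ler_sum => j _.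
by have := sqr_ge0 (z i - z j); nra.
Qed.

Lemma nsq_mv (A0 : R) m y : (forall i j, `|m i j| <= A0) ->
  nsq (mv m y) <= (#|I|%:R * A0) ^+ 2 * nsq y.
Proof.
move=> mA; have H i : mv m y i ^+ 2 <= A0 ^+ 2 * (#|I|%:R * nsq y).
  apply: (@le_trans _ _ ((\sum_j A0 * `|y j|) ^+ 2)).
    rewrite -(real_normK (num_real (mv _ _ _))) ler_pXn2r// ?nnegrE//.
      rewrite (le_trans (ler_norm_sum _ _ _))//; apply: ler_sum => j _.
      by rewrite normrM ler_wpM2r.
    by apply: sumr_ge0 => j _; rewrite mulr_ge0// (le_trans _ (mA i i)).
  rewrite -mulr_sumr exprMn ler_wpM2l ?sqr_ge0// (le_trans (sqr_sum_le _))//.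
  by under eq_bigr do rewrite real_normK ?num_real//.
rewrite (le_trans (ler_sum _ (fun i _ => H i)))// sumr_const -mulr_natl.
by rewrite exprMn le_eqVlt; apply/orP; left; apply/eqP; ring.
Qed.

Lemma mvB m y z i : mv m (fun j => y j - z j) i = mv m y i - mv m z i.
Proof. by rewrite /mv -sumrB; apply: eq_bigr => j _; rewrite mulrBr. Qed.

Lemma mvDl m m' y i : mv (fun k j => m k j + m' k j) y i = mv m y i + mv m' y i.
Proof. by rewrite /mv -big_split; apply: eq_bigr => j _; rewrite mulrDl. Qed.

Lemma mvBl m m' y i : mv (fun k j => m k j - m' k j) y i = mv m y i - mv m' y i.
Proof. by rewrite /mv -sumrB; apply: eq_bigr => j _; rewrite mulrBl. Qed.

(** The derivative of the square norm of [e] is 2 e.(m e + r), at most |m e|^2 + 2 |e|^2 + |r|^2;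
    with [nsq_mv] this gives the rate in the exponential. *)
Lemma gronwall_vec (A0 rho a b : R) (e r : R -> I -> R) (m : R -> I -> I -> R) :
  a <= b -> 0 <= rho -> (forall t i j, `|m t i j| <= A0) ->
  (forall (t : R) i, t \in `]a, b[ -> is_derive t 1 (e^~ i) (mv (m t) (e t) i + r t i)) ->
  (forall i, {within `[a, b], continuous (e^~ i)}) ->
  (forall t, t \in `]a, b[ -> nsq (r t) <= rho) ->
  nsq (e b) <= expR (((#|I|%:R * A0) ^+ 2 + 2) * (b - a)) *
               (nsq (e a) + rho * (b - a)).
Proof.
move=> ab rho0 mA ed ec rr.
pose dE t := \sum_i ((mv (m t) (e t) i + r t i) * e t i +
                    e t i * (mv (m t) (e t) i + r t i)).
apply: (@gronwall _ (fun t => nsq (e t)) dE) => //.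
- by rewrite addr_ge0// sqr_ge0.
- move=> x xab; apply: is_derive_bigsum => i; have := ed x i xab => exi.
  by under eq_fun do rewrite expr2; exact: is_deriveMr.
- have -> : (fun t => nsq (e t)) = \sum_i (fun t => e t i * e t i).
    by apply/funext => t; rewrite fct_sumE.
  move=> x; apply: (@big_ind _ (fun f : R -> R => {for x, continuous (f : subspace `[a, b] -> R)})).
  + exact: cst_continuous.
  + by move=> f g fc gc; apply: continuousD.
  + by move=> i _; apply: continuousM; exact: ec.
- move=> t tab; rewrite (@le_trans _ _ (\sum_i (mv (m t) (e t) i ^+ 2 +
      2 * e t i ^+ 2 + r t i ^+ 2)))//.
    apply: ler_sum => i _.
    move: (mv _ _ _) (e t i) (r t i) => x y z.
    by have := sqr_ge0 (x - y); have := sqr_ge0 (y - z); nra.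
  rewrite !big_split/= -mulr_sumr -![\sum_i _ ^+ 2]/(nsq _).
  by have := nsq_mv (e t) (mA t); have := rr t tab; lra.
Qed.

End VectorNorm.

(** * Lattice sums in the plane *)

Section PlaneNorm.
Variable R : realType.
Implicit Types (x y : R * R).

Definition pnorm x : R := Num.max `|x.1| `|x.2|.

Lemma pnorm_ge0 x : 0 <= pnorm x.
Proof. by rewrite le_max normr_ge0. Qed.

Lemma pnorm_le x (r : R) : (pnorm x <= r) = (`|x.1| <= r) && (`|x.2| <= r).
Proof. by rewrite ge_max. Qed.

Lemma pnormD x y : pnorm (x + y) <= pnorm x + pnorm y.
Proof.
rewrite pnorm_le/=; apply/andP; split; rewrite (le_trans (ler_normD _ _))//;
  by rewrite lerD// le_max lexx ?orbT.
Qed.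

Lemma pnorm0 : pnorm 0 = 0.
Proof. by rewrite /pnorm/= normr0 max_l. Qed.

Lemma pnormN x : pnorm (- x) = pnorm x.
Proof. by rewrite /pnorm/= !normrN. Qed.

Lemma pdistC x y : pnorm (x - y) = pnorm (y - x).
Proof. by rewrite -pnormN opprB. Qed.

Lemma pnorm_shift_ge x y : pnorm x - pnorm y <= pnorm (x + y).
Proof. by have := pnormD (x + y) (- y); rewrite addrK pnormN; lra. Qed.

Lemma pnormZ (k : R) x : pnorm (k *: x) = `|k| * pnorm x.
Proof. by rewrite /pnorm/= !normrM -maxr_pMr. Qed.

Lemma pnorm_e1 (s : R) : 0 <= s -> pnorm (s, 0) = s.
Proof. by move=> s0; rewrite /pnorm/= normr0 ger0_norm// max_l. Qed.

Lemma pnorm_e2 (s : R) : 0 <= s -> pnorm (0, s) = s.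
Proof. by move=> s0; rewrite /pnorm/= normr0 ger0_norm// max_r. Qed.

End PlaneNorm.

Section LatticeSum.
Variable R : realType.
Implicit Types (F G : R * R -> R) (s : R).

(** The indices below [B.*2] run over the multiples -B, ..., B - 1 of [s], so that a change of [s]
    dilates the grid about the origin, as the counting of collar points requires. *)
Definition lattice_pt s (B i j : nat) : R * R :=
  (s * (i%:R - B%:R), s * (j%:R - B%:R)).

Definition lsum s (B : nat) F : R :=
  \sum_(i < B.*2) \sum_(j < B.*2) F (lattice_pt s B i j).

Lemma eq_lsum s B F G : F =1 G -> lsum s B F = lsum s B G.
Proof. by move=> FG; apply: eq_bigr => i _; apply: eq_bigr => j _. Qed.

Lemma lsumD s B F G : lsum s B (fun x => F x + G x) = lsum s B F + lsum s B G.
Proof.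
rewrite /lsum -big_split; apply: eq_bigr => i _.
by rewrite -big_split.
Qed.

Lemma lsumZ s B (k : R) F : lsum s B (fun x => k * F x) = k * lsum s B F.
Proof.
by rewrite /lsum mulr_sumr; apply: eq_bigr => i _; rewrite mulr_sumr.
Qed.

Lemma lsumB s B F G : lsum s B (fun x => F x - G x) = lsum s B F - lsum s B G.
Proof.
rewrite -[- lsum _ _ _]mulN1r -lsumZ -lsumD.
by apply: eq_lsum => x; rewrite mulN1r.
Qed.

Lemma lsum_sum s B (I : Type) (r : seq I) (P : pred I) (F : I -> R * R -> R) :
  lsum s B (fun x => \sum_(k <- r | P k) F k x) =
  \sum_(k <- r | P k) lsum s B (F k).
Proof.
rewrite /lsum [RHS]exchange_big; apply: eq_bigr => i _ /=.
by rewrite [RHS]exchange_big.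
Qed.

Lemma le_lsum s B F G :
  (forall i j, (i < B.*2)%N -> (j < B.*2)%N ->
     F (lattice_pt s B i j) <= G (lattice_pt s B i j)) ->
  lsum s B F <= lsum s B G.
Proof. by move=> FG; apply: ler_sum => i _; apply: ler_sum => j _; apply: FG. Qed.

Lemma ler_lsum s B F G : (forall x, F x <= G x) -> lsum s B F <= lsum s B G.
Proof. by move=> FG; apply: le_lsum => *; apply: FG. Qed.

Lemma lsum_ge0 s B F : (forall x, 0 <= F x) -> 0 <= lsum s B F.
Proof. by move=> F0; apply: sumr_ge0 => i _; apply: sumr_ge0 => j _. Qed.

Lemma lsum_cst s B (k : R) : lsum s B (fun=> k) = (B.*2 ^ 2)%:R * k.
Proof.
rewrite /lsum !sumr_const !card_ord mulr_natl -mulrnA; congr (_ *+ _).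
Qed.

Lemma sum_ord_shift (n : nat) (f : nat -> R) : f 0%N = f n ->
  \sum_(i < n) f i.+1 = \sum_(i < n) f i.
Proof.
move=> f0n; have := erefl (\sum_(i < n.+1) f i).
rewrite {1}big_ord_recl big_ord_recr /= [in RHS]addrC f0n => H.
exact: (addrI _ H).
Qed.

Lemma lattice_ptS1 s B i j :
  lattice_pt s B i.+1 j = lattice_pt s B i j + (s, 0).
Proof. by apply/pair_equal_spec; split; rewrite /= ?addr0// -natr1; ring. Qed.

Lemma lattice_ptS2 s B i j :
  lattice_pt s B i j.+1 = lattice_pt s B i j + (0, s).
Proof. by apply/pair_equal_spec; split; rewrite /= ?addr0// -natr1; ring. Qed.

(* The box contains the support with room for one lattice step. *)
Definition lattice_supp s (B : nat) F :=
  forall x : R * R, s * B%:R <= pnorm x -> F x = 0.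

Lemma lsum_shift1 s B F : 0 < s -> lattice_supp s B F ->
  lsum s B (fun x => F (x + (s, 0))) = lsum s B F.
Proof.
move=> s0 F0; rewrite /lsum exchange_big [RHS]exchange_big /=.
apply: eq_bigr => j _.
under eq_bigr do rewrite -lattice_ptS1.
(* The end indices 0 and 2B are the coordinates -sB and sB, where [F] vanishes. *)
apply: (@sum_ord_shift _ (fun i => F (lattice_pt s B i j))).
have dblE : (B.*2)%:R - B%:R = B%:R :> R by rewrite -addnn natrD addrK.
rewrite !F0// le_max !normrM (gtr0_norm s0) !ler_pM2l//.
  by rewrite dblE (ger0_norm (ler0n _ B)) lexx ?orbT.
by rewrite sub0r normrN (ger0_norm (ler0n _ B)) lexx ?orbT.
Qed.

Lemma lsum_shift2 s B F : 0 < s -> lattice_supp s B F ->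
  lsum s B (fun x => F (x + (0, s))) = lsum s B F.
Proof.
move=> s0 F0; rewrite /lsum; apply: eq_bigr => i _.
under eq_bigr do rewrite -lattice_ptS2.
apply: (@sum_ord_shift _ (fun j => F (lattice_pt s B i j))).
have dblE : (B.*2)%:R - B%:R = B%:R :> R by rewrite -addnn natrD addrK.
rewrite !F0// le_max !normrM (gtr0_norm s0) !ler_pM2l//.
  by rewrite dblE (ger0_norm (ler0n _ B)) lexx ?orbT.
by rewrite sub0r normrN (ger0_norm (ler0n _ B)) lexx ?orbT.
Qed.

Definition fdiff1 s F x := (F (x + (s, 0)) - F x) / s.
Definition fdiff2 s F x := (F (x + (0, s)) - F x) / s.

(* Summation by parts turns the difference into a sum of
   [s * fdiff1 (fdiff2 F) * (fdiff1 G - fdiff2 G)]. *)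
Lemma lsum_fdiff_sym s B F G : 0 < s ->
  lattice_supp s B (fun x => F (x + (s, 0)) * G x) ->
  lattice_supp s B (fun x => F (x + (0, s)) * G x) ->
  lattice_supp s B (fun x => F x * G x) ->
  lsum s B (fun x => fdiff1 s F x * fdiff2 s G x - fdiff2 s F x * fdiff1 s G x)
  = s * lsum s B (fun x => fdiff1 s (fdiff2 s F) x * (fdiff1 s G x - fdiff2 s G x)).
Proof.
move=> s0 H1 H2 H3; have sn0 : s != 0 by rewrite gt_eqF.
have E1 : lsum s B (fun x => F (x + (0, s) + (s, 0)) * G (x + (0, s))) =
          lsum s B (fun x => F (x + (s, 0)) * G x).
  rewrite -(lsum_shift2 s0 H1); apply: eq_lsum => x.
  by rewrite addrAC.
have E2 : lsum s B (fun x => F (x + (s, 0) + (0, s)) * G (x + (s, 0))) =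
          lsum s B (fun x => F (x + (0, s)) * G x).
  rewrite -(lsum_shift1 s0 H2); apply: eq_lsum => x.
  by rewrite addrAC.
have E3 := lsum_shift1 s0 H3; have E4 := lsum_shift2 s0 H3.
apply: (mulfI (x := s ^+ 2)); first by rewrite expf_neq0.
rewrite [RHS]mulrA -!lsumZ -[RHS]subr0.
(* Zero is written as a sum of vanishing shift terms; with them the identity holds pointwise. *)
have -> : 0 = (lsum s B (fun x => F (x + (s, 0)) * G x) -
    lsum s B (fun x => F (x + (0, s) + (s, 0)) * G (x + (0, s)))) +
  (lsum s B (fun x => F (x + (s, 0) + (0, s)) * G (x + (s, 0))) -
    lsum s B (fun x => F (x + (0, s)) * G x)) +
  (lsum s B (fun x => F (x + (0, s)) * G (x + (0, s))) -
    lsum s B (fun x => F (x + (s, 0)) * G (x + (s, 0)))) :> R.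
  by rewrite E1 E2 E3 E4 !subrr !addr0.
have lc x : F (x + (s, 0) + (0, s)) = F (x + (0, s) + (s, 0)) by rewrite addrAC.
rewrite -!lsumB -!lsumD -lsumB; apply: eq_lsum => x.
rewrite /fdiff1 /fdiff2 !lc; field; exact: sn0.
Qed.

End LatticeSum.

(** * A discrete Pestov identity *)

Section Pestov.
Variable R : realType.

(** Here [C], [S] stand for the cosine and sine of h/2, [c], [d] for those of h, [cm], [sm] for
    those of the bisecting angle, and (p, q), (p', q') for two neighbouring directions. The last
    bracket is the part that telescopes around the circle. *)
Lemma pestov_step (p q p' q' c d C S cm sm a b a' b' : R) :
  p = cm * C + sm * S -> q = sm * C - cm * S ->
  p' = cm * C - sm * S -> q' = sm * C + cm * S ->
  p' = p * c - q * d -> q' = q * c + p * d ->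
  p = p' * c + q' * d -> q = q' * c - p' * d ->
  p * q' - q * p' = d -> 1 - c = 2 * S ^+ 2 ->
  let G := p * a + q * b in let G' := p' * a' + q' * b' in
  (G' - G) ^+ 2 =
  (C ^+ 2 * (cm * (a' - a) + sm * (b' - b)) ^+ 2
   - S ^+ 2 * (cm * (b' - b) - sm * (a' - a)) ^+ 2
   + 4 * S ^+ 2 * G ^+ 2 + d * (a' * b - b' * a))
  + ((G' ^+ 2 - G' * ((p' * c + q' * d) * a' + (q' * c - p' * d) * b'))
     - (G ^+ 2 - G * ((p * c + q * d) * a + (q * c - p * d) * b))).
Proof.
move=> e1 e2 e3 e4 e5 e6 e7 e8 e9 e10 G G'.
(* [A] and [B] are the mixed derivatives, of each function in the direction of the other. With X and
   Y the derivatives of the difference along and across the bisector, A - G = C X - S Y and G' - B =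
   C X + S Y. *)
set A := p * a' + q * b'; set B := p' * a + q' * b.
have E1 : C ^+ 2 * (cm * (a' - a) + sm * (b' - b)) ^+ 2
   - S ^+ 2 * (cm * (b' - b) - sm * (a' - a)) ^+ 2 = (A - G) * (G' - B).
  by rewrite /A /B /G /G' e1 e2 e3 e4; ring.
have E2 : A * B = G' * G + d * (a' * b - b' * a).
  by rewrite -e9 /A /B /G /G'; ring.
rewrite -e7 -e8 -/A E1.
have E4 : G * ((p * c + q * d) * a + (q * c - p * d) * b) =
   2 * c * G ^+ 2 - G * B.
  by rewrite /B e5 e6 /G; ring.
rewrite E4.
have -> : 4 * S ^+ 2 = 2 * (1 - c) by rewrite e10; ring.
have -> : d * (a' * b - b' * a) = A * B - G' * G by rewrite E2; ring.
ring.
Qed.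

(* A discrete Pestov identity on the circle of [M] equidistributed directions.
   Here [a k] and [b k] stand for the two partial derivatives at a point of the
   [k]-th function of a cyclic family, and [G k] for its derivative in the [k]-th
   direction. *)
Lemma pestov (M : nat) (h : R) (a b : nat -> R) :
  a M = a 0%N -> b M = b 0%N -> cos (M%:R * h) = 1 -> sin (M%:R * h) = 0 ->
  let G k := cos (k%:R * h) * a k + sin (k%:R * h) * b k in
  let m k := k%:R * h + h / 2 in
  \sum_(k < M) (G k.+1 - G k) ^+ 2 =
  \sum_(k < M) (cos (h / 2) ^+ 2 *
      (cos (m k) * (a k.+1 - a k) + sin (m k) * (b k.+1 - b k)) ^+ 2
    - sin (h / 2) ^+ 2 *
      (cos (m k) * (b k.+1 - b k) - sin (m k) * (a k.+1 - a k)) ^+ 2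
    + 4 * sin (h / 2) ^+ 2 * G k ^+ 2
    + sin h * (a k.+1 * b k - b k.+1 * a k)).
Proof.
move=> aM bM cM sM G m.
(* The factor of [G k] in the second term is the derivative of the [k]-th function in the direction
   of angle (k - 1) h; [T] is cyclic, so its increments sum to zero. *)
pose T k := G k ^+ 2 - G k * ((cos (k%:R * h) * cos h + sin (k%:R * h) * sin h) * a k +
   (sin (k%:R * h) * cos h - cos (k%:R * h) * sin h) * b k).
have T0 : T 0%N = T M by rewrite /T /G aM bM cM sM mul0r cos0 sin0.
have TT : \sum_(k < M) (T k.+1 - T k) = 0.
  by rewrite sumrB sum_ord_shift// subrr.
rewrite -[RHS]addr0 -[X in _ = _ + X]TT -big_split; apply: eq_bigr => k _ /=.
have hh : h = h / 2 + h / 2 by rewrite -splitr.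
have kS : (k.+1)%:R * h = k%:R * h + h by rewrite -natr1; ring.
have km : (k%:R * h : R) = m k - h / 2 by rewrite /m; ring.
have km' : ((k.+1)%:R * h : R) = m k + h / 2 by rewrite kS /m {2}hh; ring.
have kS' : (k%:R * h : R) = k.+1%:R * h - h by rewrite kS; ring.
have cs x : cos x ^+ 2 = 1 - sin x ^+ 2 :> R by rewrite -(cos2Dsin2 x); ring.
rewrite /T /G; apply: pestov_step.
- by rewrite km cosB.
- by rewrite km sinB.
- by rewrite km' cosD.
- by rewrite km' sinD.
- by rewrite kS cosD.
- by rewrite kS sinD.
- by rewrite {1}kS' cosB.
- by rewrite {1}kS' sinB.
- rewrite -[in RHS](addrK (k%:R * h) h) [h + _]addrC -kS sinB; ring.
- rewrite {1}hh cosD -!expr2 cs; ring.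
Qed.

(* Discrete integration by parts of the derivative of [w^2] against the linear
   function [c * x.1 + d * x.2]. *)
Lemma poincare (s R1 c d : R) (B : nat) (w : R * R -> R) :
  0 < s -> 0 <= R1 -> R1 <= s * B%:R -> c ^+ 2 + d ^+ 2 = 1 ->
  (forall x : R * R, R1 <= pnorm x -> w x = 0) ->
  lsum s B (fun x => w x ^+ 2) <=
    16 * R1 ^+ 2 * lsum s B (fun x => (c * fdiff1 s w x + d * fdiff2 s w x) ^+ 2)
    + 4 * s * (R1 + s) * lsum s B (fun x => fdiff1 s w x ^+ 2 + fdiff2 s w x ^+ 2).
Proof.
move=> s0 R10 R1B cd w0; have sn0 : s != 0 by rewrite gt_eqF.
pose l (x : R * R) := c * x.1 + d * x.2.
have supp (F : R * R -> R) : lattice_supp s B (fun x => F x * w x ^+ 2).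
  by move=> x Bx; rewrite w0 ?(le_trans R1B)// expr0n mulr0.
have supp1 : lattice_supp s B (fun x => w x ^+ 2).
  by move=> x Bx; rewrite w0 ?(le_trans R1B)// expr0n.
have I1 := lsum_shift1 s0 (supp l); have I2 := lsum_shift2 s0 (supp l).
have J1 := lsum_shift1 s0 supp1; have J2 := lsum_shift2 s0 supp1.
have [c1 d1] : `|c| <= 1 /\ `|d| <= 1.
  by split; rewrite -(@ler_pXn2r _ 2)// ?nnegrE// real_normK ?num_real// expr1n; nra.
have lb (x : R * R) (r : R) : pnorm x <= r -> `|l x| <= 2 * r.
  rewrite pnorm_le => /andP[x1 x2].
  rewrite /l (le_trans (ler_normD _ _))// !normrM mulrDl mul1r.
  have ? := normr_ge0 x.1; have ? := normr_ge0 x.2.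
  have ? := normr_ge0 c; have ? := normr_ge0 d; nra.
pose X x := c * fdiff1 s w x + d * fdiff2 s w x.
have main : lsum s B (fun x => w x ^+ 2) = lsum s B (fun x =>
    - (l x * (2 * w x * X x)) - s * (l x * (c * fdiff1 s w x ^+ 2))
    - s * (l x * (d * fdiff2 s w x ^+ 2))).
  apply: (mulfI sn0); apply/eqP; rewrite -subr_eq0; apply/eqP.
  (* Vanishing shift terms of [l x * w x ^+ 2]; those of [w x ^+ 2] alone replace the shifted
     square, which the increment of [l] produces, by the square at [x]. *)
  have -> : 0 = c * (lsum s B (fun x => l (x + (s, 0)) * w (x + (s, 0)) ^+ 2)
       - lsum s B (fun x => l x * w x ^+ 2))
     + d * (lsum s B (fun x => l (x + (0, s)) * w (x + (0, s)) ^+ 2)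
       - lsum s B (fun x => l x * w x ^+ 2))
     - c ^+ 2 * s * (lsum s B (fun x => w (x + (s, 0)) ^+ 2) -
         lsum s B (fun x => w x ^+ 2))
     - d ^+ 2 * s * (lsum s B (fun x => w (x + (0, s)) ^+ 2) -
         lsum s B (fun x => w x ^+ 2)).
    by rewrite I1 I2 J1 J2 !subrr !mulr0 !subr0 addr0.
  rewrite -!lsumB -!lsumZ -!lsumD -!lsumB; apply: eq_lsum => x.
  rewrite /X /fdiff1 /fdiff2 /l /=.
  have -> : s * w x ^+ 2 = (c ^+ 2 + d ^+ 2) * s * w x ^+ 2 by rewrite cd mul1r.
  by field.
have D1 x : - s * (l x * (c * fdiff1 s w x ^+ 2)) <=
    2 * s * (R1 + s) * fdiff1 s w x ^+ 2.
  have [xR|Rx] := leP (pnorm x) (R1 + s).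
    have := lb _ _ xR; have := sqr_ge0 (fdiff1 s w x).
    move: (l x) (fdiff1 s w x ^+ 2) => y z z0 yb.
    suff: - (y * c) <= 2 * (R1 + s).
      move=> H; have : s * z * (- (y * c)) <= s * z * (2 * (R1 + s)).
        by rewrite ler_wpM2l// mulr_ge0// ltW.
      by lra.
    rewrite (le_trans (ler_norm _))// normrN normrM.
    have ? := normr_ge0 y; have ? := normr_ge0 c; nra.
  have -> : fdiff1 s w x = 0; last by rewrite expr0n/= !mulr0.
  rewrite /fdiff1 !w0 ?subrr ?mul0r//; first by lra.
  by have := pnorm_shift_ge x (s, 0); rewrite pnorm_e1 ?(ltW s0)//; lra.
have D2 x : - s * (l x * (d * fdiff2 s w x ^+ 2)) <=
    2 * s * (R1 + s) * fdiff2 s w x ^+ 2.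
  have [xR|Rx] := leP (pnorm x) (R1 + s).
    have := lb _ _ xR; have := sqr_ge0 (fdiff2 s w x).
    move: (l x) (fdiff2 s w x ^+ 2) => y z z0 yb.
    suff: - (y * d) <= 2 * (R1 + s).
      move=> H; have : s * z * (- (y * d)) <= s * z * (2 * (R1 + s)).
        by rewrite ler_wpM2l// mulr_ge0// ltW.
      by lra.
    rewrite (le_trans (ler_norm _))// normrN normrM.
    have ? := normr_ge0 y; have ? := normr_ge0 d; nra.
  have -> : fdiff2 s w x = 0; last by rewrite expr0n/= !mulr0.
  rewrite /fdiff2 !w0 ?subrr ?mul0r//; first by lra.
  by have := pnorm_shift_ge x (0, s); rewrite pnorm_e2 ?(ltW s0)//; lra.
(* On the support of [w] the function [l] is at most 2 R1 in modulus, and Young's inequality leaves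
   half of the sum of [w x ^+ 2], to be absorbed on the left. *)
have D3 x : - (l x * (2 * w x * X x)) <= w x ^+ 2 / 2 + 8 * R1 ^+ 2 * X x ^+ 2.
  have [xR|Rx] := leP (pnorm x) R1; last first.
    rewrite w0 ?(ltW Rx)// expr0n/= !(mulr0, mul0r) oppr0 add0r.
    by have := sqr_ge0 R1; have := sqr_ge0 (X x); nra.
  have : l x ^+ 2 <= 4 * R1 ^+ 2.
    have := lb _ _ xR; rewrite -(@ler_pXn2r _ 2)// ?nnegrE ?mulr_ge0//.
    by rewrite real_normK ?num_real// exprMn; lra.
  move=> l2; have := sqr_ge0 (w x + 2 * (l x) * X x).
  have := sqr_ge0 (X x) => X2.
  have : l x ^+ 2 * X x ^+ 2 <= 4 * R1 ^+ 2 * X x ^+ 2 by rewrite ler_wpM2r.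
  by move: (l x) (X x) (w x) X2 => y z t; nra.
suff : lsum s B (fun x => w x ^+ 2) <= 2^-1 * lsum s B (fun x => w x ^+ 2) +
   (8 * R1 ^+ 2 * lsum s B (fun x => X x ^+ 2) +
    2 * s * (R1 + s) * lsum s B (fun x => fdiff1 s w x ^+ 2 + fdiff2 s w x ^+ 2)).
  by lra.
rewrite {1}main -!lsumZ -!lsumD; apply: ler_lsum => x.
have := D1 x; have := D2 x; have := D3 x; lra.
Qed.

End Pestov.

(** * Transport along lines of the plane *)

Section Collar.
Variable R : realType.
Local Notation P := (R * R)%type.

(** A neighbourhood of the boundary of [K]. Off it, four points close together lie all in [K], where
    second differences are small, or all outside, where [u] and [f] vanish. *)
Definition collar (K : P -> Prop) (eta : R) (x : P) : Prop :=
  (exists2 y, pnorm (y - x) <= eta & K y) /\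
  (exists2 y, pnorm (y - x) <= eta & ~ K y).

Lemma not_collar (K : P -> Prop) (eta : R) (x : P) : ~ collar K eta x ->
  (forall y, pnorm (y - x) <= eta -> K y) \/
  (forall y, pnorm (y - x) <= eta -> ~ K y).
Proof.
move=> nC; have [H|H] := pselect (forall y, pnorm (y - x) <= eta -> K y).
  by left.
right=> y yx Ky; apply: nC; split; first by exists y.
apply: contrapT => H'; apply: H => z zx; apply: contrapT => nKz.
by apply: H'; exists z.
Qed.

Definition collar_ind K eta x : R := (`[< collar K eta x >])%:R.

Lemma collar_ind_ge0 K eta x : 0 <= collar_ind K eta x.
Proof. exact: ler0n. Qed.

End Collar.

Section Steps.
Variables (R : realType) (I : finType).

(** A bound on the source that varies over [J] equal subintervals enters as a Riemann sum; later
    this sum counts how often a line meets the collar. *)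
Lemma gronwall_steps (A0 T : R) (J : nat) (rho : nat -> R) (e r : R -> I -> R)
    (m : R -> I -> I -> R) :
  0 <= T -> (0 < J)%N -> (forall j, 0 <= rho j) ->
  (forall t i j, `|m t i j| <= A0) ->
  (forall (t : R) i, is_derive t 1 (e^~ i) (mv (m t) (e t) i + r t i)) ->
  (forall j t, (j < J)%N -> t \in `](j%:R * (T / J%:R)), (j.+1%:R * (T / J%:R))[ ->
     nsq (r t) <= rho j) ->
  nsq (e T) <= expR (((#|I|%:R * A0) ^+ 2 + 2) * T) *
     (nsq (e 0) + T / J%:R * \sum_(j < J) rho j).
Proof.
move=> T0 J0 rho0 mA ed rr.
set c := (_ + 2); set d := T / J%:R.
have d0 : 0 <= d by rewrite divr_ge0.
have c0 : 0 <= c by rewrite addr_ge0// sqr_ge0.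
have H n : (n <= J)%N -> nsq (e (n%:R * d)) <=
    expR (c * (n%:R * d)) * (nsq (e 0) + d * \sum_(j < n) rho j).
  elim: n => [|n IH nJ].
    by rewrite mul0r mulr0 expR0 big_ord0 mulr0 addr0 mul1r.
  have le : n%:R * d <= n.+1%:R * d by rewrite ler_wpM2r// ler_nat.
  have := @gronwall_vec R I A0 (rho n) _ _ e r m le (rho0 n) mA.
  have -> : n.+1%:R * d - n%:R * d = d by rewrite -natr1; ring.
  move=> /(_ (fun t i _ => ed t i)) G.
  have {}G := G (fun i => continuous_subspaceT (fun t => is_derive_cont (ed t i))).
  apply: le_trans (G (fun t => rr n t nJ)) _.
  rewrite -/c big_ord_recr/=.
  have -> : n.+1%:R * d = d + n%:R * d by rewrite -natr1; ring.
  rewrite (mulrDr c) expRD -mulrA ler_wpM2l ?expR_ge0//.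
  have := IH (ltnW nJ); set X := expR _; set Y := \sum_(_ < _) _ => IH'.
  have X1 : 1 <= X by rewrite -expR0 ler_expR mulr_ge0// mulr_ge0 ?ler0n.
  have : d * rho n <= X * (d * rho n). have := mulr_ge0 d0 (rho0 n); nra.
  by lra.
have := H J (leqnn J); have -> // : J%:R * d = T.
by rewrite /d mulrCA mulfV ?mulr1// pnatr_eq0 -lt0n.
Qed.

Definition dir (th : R) : R * R := (cos th, sin th).

Lemma dir_le1 th : pnorm (dir th) <= 1.
Proof.
by rewrite pnorm_le/= !ler_norml cos_geN1 cos_le1 sin_geN1 sin_le1.
Qed.

Lemma dir_ge th : 2^-1 <= pnorm (dir th).
Proof.
rewrite le_max /=; apply/orP.
have [|c1] := leP 2^-1 `|cos th|; [by left | right].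
have := cos2Dsin2 th.
rewrite -(real_normK (num_real (cos th))) -(real_normK (num_real (sin th))).
have := normr_ge0 (cos th); have := normr_ge0 (sin th); nra.
Qed.

Lemma dir_lip th th' : pnorm (dir th' - dir th) <= `|th' - th|.
Proof.
wlog le : th th' / th <= th'.
  by move=> H; have [/H//|/ltW/H] := leP th th'; rewrite pdistC distrC.
have cosl : `|cos th' - cos th| <= `|th' - th|.
  have [c _ ->] := MVT_segment le (fun x _ => is_derive_cos x)
    (continuous_subspaceT (@continuous_cos R)).
  by rewrite normrM normrN ler_piMl// ler_norml sin_geN1 sin_le1.
have sinl : `|sin th' - sin th| <= `|th' - th|.
  have [c _ ->] := MVT_segment le (fun x _ => is_derive_sin x)
    (continuous_subspaceT (@continuous_sin R)).
  by rewrite normrM ler_piMl// ler_norml cos_geN1 cos_le1.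
by rewrite pnorm_le/= cosl.
Qed.

End Steps.

Section Transport.
Variables (R : realType) (I : finType).
Local Notation P := (R * R)%type.
Variables (a : P -> I -> I -> R) (f : P -> I -> R) (u : R -> P -> I -> R).
Variables (K : P -> Prop) (A0 L Cf rad : R).
Hypotheses (A00 : 0 <= A0) (L0 : 0 <= L) (Cf0 : 0 <= Cf) (rad1 : rad <= 1).
Hypothesis aA : forall x i j, `|a x i j| <= A0.
Hypothesis fC : forall x i, `|f x i| <= Cf.
Hypothesis aL : forall x y i j, `|a x i j - a y i j| <= L * pnorm (x - y).
Hypothesis fL : forall x y i, `|f x i - f y i| <= L * pnorm (x - y).
Hypothesis ud : forall (th : R) (x : P) (t : R) i,
  is_derive t 1 (fun s => u th (x + s *: dir th) i)
    (mv (a (x + t *: dir th)) (u th (x + t *: dir th)) i + f (x + t *: dir th) i).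
Hypothesis u0 : forall th (x : P) i, rad < pnorm x -> u th x i = 0.

Let N : R := #|I|%:R.
Let N0 : 0 <= N. Proof. exact: ler0n. Qed.
Let Eg := expR (((N * A0) ^+ 2 + 2) * 8).
Let Cu := Eg * (8 * (N * Cf ^+ 2)).

Lemma Eg_ge0 : 0 <= Eg. Proof. exact: expR_ge0. Qed.

Lemma Cu_ge0 : 0 <= Cu.
Proof. by rewrite !mulr_ge0 ?Eg_ge0 ?sqr_ge0 ?ler0n. Qed.

(** The path reaches [x] at time 8. As [dir th] has sup norm at least 1/2, for [x] of norm at most 2
    it starts at norm at least 2, where [u] vanishes. *)
Let path (th : R) (x : P) (t : R) : P := (x - 8 *: dir th) + t *: dir th.

Lemma path8 th (x : P) : path th x 8 = x.
Proof. by rewrite /path subrK. Qed.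

Lemma path_start th (x : P) i : pnorm x <= 2 -> u th (path th x 0) i = 0.
Proof.
move=> x2; apply: u0; rewrite /path scale0r addr0.
have := pnorm_shift_ge (- (8 *: dir th)) x; rewrite pnormN pnormZ ger0_norm// addrC.
by rewrite [- _ + x]addrC; have := dir_ge th; have := rad1; lra.
Qed.

Lemma u_bound th (x : P) : nsq (u th x) <= Cu.
Proof.
have [x1|x1] := leP (pnorm x) 1; last first.
  rewrite (_ : u th x = fun=> 0) ?nsq_cst0 ?Cu_ge0//.
  by apply/funext => i; apply: u0; apply: le_lt_trans x1.
have := @gronwall_steps R I A0 8 1 (fun=> N * Cf ^+ 2)
  (fun t => u th (path th x t)) (fun t => f (path th x t)) (fun t => a (path th x t)).
rewrite path8 divr1 big_ord1.
rewrite (_ : u th (path th x 0) = fun=> 0) ?nsq_cst0 ?add0r; last first.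
  by apply/funext => i; apply: path_start; lra.
apply => //.
- by move=> _; rewrite mulr_ge0 ?sqr_ge0 ?ler0n.
- by move=> j t _ _; apply: le_nsq.
Qed.

Let CL := Eg * (8 * (2 * (N * L) ^+ 2 * Cu + 2 * N * L ^+ 2)).

Lemma CL_ge0 : 0 <= CL.
Proof.
apply: mulr_ge0; first exact: Eg_ge0.
by have := mulr_ge0 (sqr_ge0 (N * L)) Cu_ge0; have := mulr_ge0 N0 (sqr_ge0 L); lra.
Qed.

Lemma path_dist th th' (x x' : P) (t : R) : t \in `]0, 8[ ->
  pnorm (path th' x' t - path th x t) <= 8 * pnorm (dir th' - dir th) + pnorm (x' - x).
Proof.
move=> t8; rewrite (_ : _ - _ = (t - 8) *: (dir th' - dir th) + (x' - x)); last first.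
  rewrite /path scalerBr !scalerBl.
  by rewrite /path; apply/pair_equal_spec; split; rewrite /=; ring.
rewrite (le_trans (pnormD _ _))// lerD2r pnormZ ler_wpM2r ?pnorm_ge0//.
by rewrite ltr0_norm ?(itvP t8)// ?subr_lt0 ?(itvP t8)//; move: t8; rewrite in_itv/=; lra.
Qed.

(** The difference of [u] along the two paths ending at [x] and [x'] vanishes at the start and
    solves a linear system whose source is of the size of the distance of the paths. *)
Lemma u_lip th th' (x x' : P) : pnorm x <= 2 -> pnorm x' <= 2 ->
  nsq (fun i => u th' x' i - u th x i) <=
  CL * (8 * pnorm (dir th' - dir th) + pnorm (x' - x)) ^+ 2.
Proof.
have arith (X Y Z n l k c : R) : X <= (n * (l * k)) ^+ 2 * c ->
  Y <= n * (l * k) ^+ 2 -> Z <= 2 * X + 2 * Y ->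
  Z <= (2 * (n * l) ^+ 2 * c + 2 * n * l ^+ 2) * k ^+ 2 by move=> *; lra.
move=> x2 x'2; set k := (8 * _ + _).
pose p := path th x; pose p' := path th' x'.
pose e t i := u th' (p' t) i - u th (p t) i.
have e8 : e 8 = fun i => u th' x' i - u th x i by rewrite /e /p /p' !path8.
have e0 : e 0 = fun=> 0 by apply/funext => i; rewrite /e /p /p' !path_start// subrr.
pose r t i := mv (fun i j => a (p' t) i j - a (p t) i j) (u th (p t)) i
     + (f (p' t) i - f (p t) i).
pose c := 2 * (N * L) ^+ 2 * Cu + 2 * N * L ^+ 2.
have k0 : 0 <= k by rewrite addr_ge0 ?pnorm_ge0// mulr_ge0 ?pnorm_ge0.
have c0 (j : nat) : 0 <= c * k ^+ 2.
  apply: mulr_ge0 (sqr_ge0 k).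
  by have := mulr_ge0 (sqr_ge0 (N * L)) Cu_ge0; have := mulr_ge0 N0 (sqr_ge0 L); rewrite /c; lra.
have ed (t : R) i : is_derive t 1 (e^~ i) (mv (a (p' t)) (e t) i + r t i).
  have H := is_deriveB (ud th' (x' - 8 *: dir th') t i) (ud th (x - 8 *: dir th) t i).
  apply: (is_derive_eq H).
  by rewrite -/(path th x t) -/(path th' x' t) /r mvB mvBl -/(p t) -/(p' t); ring.
have er (j : nat) (t : R) : (j < 1)%N ->
    t \in `](j%:R * (8 / 1%:R)), (j.+1%:R * (8 / 1%:R))[ -> nsq (r t) <= c * k ^+ 2.
  move=> jJ tt; have tk : pnorm (p' t - p t) <= k.
    by apply: path_dist; move: tt; rewrite (_ : j = 0%N) ?mul0r ?mul1r ?divr1//; case: j jJ.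
  have H3 : nsq (r t) <= _ := nsqD _ _.
  have H1 : nsq (mv (fun i j => a (p' t) i j - a (p t) i j) (u th (p t))) <=
      (N * (L * k)) ^+ 2 * Cu.
    rewrite (le_trans (nsq_mv (A0 := L * k) _ _))//.
      by move=> i1 i2; rewrite (le_trans (aL _ _ _ _))// ler_wpM2l.
    by rewrite ler_wpM2l ?sqr_ge0// u_bound.
  have H2 : nsq (fun i => f (p' t) i - f (p t) i) <= N * (L * k) ^+ 2.
    by apply: le_nsq => i1; rewrite (le_trans (fL _ _ _))// ler_wpM2l.
  exact: arith H1 H2 H3.
have := gronwall_steps _ _ c0 (fun t => aA (p' t)) ed er.
rewrite e8 e0 nsq_cst0 add0r divr1 big_ord1 => H.
by rewrite (le_trans (H _ _))// -/Eg /CL -/c !mulrA.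
Qed.

Let CL' := CL + 4 * Cu.

Lemma CL'_ge0 : 0 <= CL'.
Proof. by rewrite addr_ge0 ?CL_ge0// mulr_ge0 ?Cu_ge0. Qed.

(** Outside the unit box [u] vanishes. If one point is in it and the other has norm above 2, then k
    >= 1 and the bound on [u] itself suffices; this is the summand 4 [Cu]. *)
Lemma u_lipT th th' (x x' : P) (k : R) :
  8 * pnorm (dir th' - dir th) + pnorm (x' - x) <= k ->
  nsq (fun i => u th' x' i - u th x i) <= CL' * k ^+ 2.
Proof.
move=> kk.
have k0 : 0 <= k by apply: le_trans kk; rewrite addr_ge0 ?pnorm_ge0// mulr_ge0 ?pnorm_ge0.
have r1 := rad1.
have far (y : P) : 1 < pnorm y -> forall t, u t y = fun=> 0.
  by move=> y1 t; apply/funext => i; apply: u0; apply: le_lt_trans y1.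
have near (y y' : P) : pnorm y <= 1 -> 2 < pnorm y' -> 1 <= pnorm (y' - y).
  by move=> y1 y'2; have := pnorm_shift_ge y' (- y); rewrite pnormN; lra.
have big : 1 <= k -> nsq (fun i => u th' x' i - u th x i) <= CL' * k ^+ 2.
  move=> k1; have H := nsqB (u th' x') (u th x).
  have := u_bound th x; have := u_bound th' x'; have := CL_ge0; rewrite /CL'.
  have : (CL + 4 * Cu) * 1 <= (CL + 4 * Cu) * k ^+ 2.
    by rewrite ler_wpM2l ?CL'_ge0// exprn_ege1.
  by move: (Cu) (CL) => C1 C2; lra.
have dpos : 0 <= 8 * pnorm (dir th' - dir th) by rewrite mulr_ge0 ?pnorm_ge0.
have [x2|x2] := leP (pnorm x) 2; have [x'2|x'2] := leP (pnorm x') 2.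
- have H := u_lip th th' x2 x'2; apply: (le_trans H).
  have kk2 : (8 * pnorm (dir th' - dir th) + pnorm (x' - x)) ^+ 2 <= k ^+ 2.
    by rewrite ler_pXn2r// nnegrE// addr_ge0 ?pnorm_ge0.
  apply: (@le_trans _ _ (CL * k ^+ 2)); first by rewrite ler_wpM2l ?CL_ge0.
  by rewrite ler_wpM2r ?sqr_ge0// /CL' lerDl mulr_ge0 ?Cu_ge0.
- have [x1|x1] := leP (pnorm x) 1; first by apply: big; have := near x x' x1 x'2; lra.
  rewrite !far//; last by lra.
  under eq_fun do rewrite subrr.
  by rewrite nsq_cst0 mulr_ge0 ?CL'_ge0 ?sqr_ge0.
- have [x1|x1] := leP (pnorm x') 1.
    by apply: big; have := near x' x x1 x2; rewrite pdistC; lra.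
  rewrite !far//; last by lra.
  under eq_fun do rewrite subrr.
  by rewrite nsq_cst0 mulr_ge0 ?CL'_ge0 ?sqr_ge0.
- rewrite !far//; [|lra|lra].
  under eq_fun do rewrite subrr.
  by rewrite nsq_cst0 mulr_ge0 ?CL'_ge0 ?sqr_ge0.
Qed.

Let CW := Eg * 8 * (20 * (N * L) ^+ 2 * CL' + 4 * (N ^+ 2 * Cu + N) * (1 + 4 * L ^+ 2)).

Lemma CW_ge0 : 0 <= CW.
Proof.
have H1 := mulr_ge0 (sqr_ge0 (N * L)) CL'_ge0.
have H2 := mulr_ge0 (sqr_ge0 N) Cu_ge0.
apply: mulr_ge0; first by rewrite mulr_ge0 ?Eg_ge0.
apply: addr_ge0; first by lra.
apply: mulr_ge0; first by have := N0; lra.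
by have := sqr_ge0 L; lra.
Qed.

(** The double difference of [u], in direction and in position, solves a linear system along the
    path. Its source consists of products of two first differences and of second differences of [a]
    and [f]. The budget on [eta] keeps the four points involved within [eta] of the last node of the
    path, so the collar indicator at the node decides which bound on second differences applies. *)
Lemma w_diff th th' (x z : P) (J : nat) (eta e0 : R) :
  (0 < J)%N -> 0 <= e0 -> pnorm x <= 1 -> pnorm z <= 1 ->
  (forall th x, ~ K x -> forall i, u th x i = 0) ->
  (forall x, ~ K x -> forall i, f x i = 0) ->
  (forall p d i j, K p -> K (p + d) -> K (p + z) -> K (p + d + z) ->
     `|a (p + d + z) i j - a (p + z) i j - a (p + d) i j + a p i j| <= e0 * pnorm d) ->
  (forall p d i, K p -> K (p + d) -> K (p + z) -> K (p + d + z) ->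
     `|f (p + d + z) i - f (p + z) i - f (p + d) i + f p i| <= e0 * pnorm d) ->
  8 / J%:R + 8 * pnorm (dir th' - dir th) + pnorm z <= eta ->
  nsq (fun i => (u th' (x + z) i - u th (x + z) i) - (u th' x i - u th x i)) <=
  CW * (8 * pnorm (dir th' - dir th)) ^+ 2 *
    ((e0 + pnorm z) ^+ 2 + 8 / J%:R *
       \sum_(j < J) collar_ind K eta (path th x (j%:R * (8 / J%:R)))).
Proof.
have arith (X1 X2 X3 X4 Z n l c c' k e b : R) :
  X1 <= (n * (l * b)) ^+ 2 * (c' * (2 * k) ^+ 2) ->
  X2 <= (n * (l * k)) ^+ 2 * (c' * b ^+ 2) ->
  X3 <= (n * (e * k)) ^+ 2 * c ->
  X4 <= n * (e * k) ^+ 2 ->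
  Z <= 4 * X1 + 4 * X2 + 4 * X3 + 4 * X4 ->
  Z <= (20 * (n * l) ^+ 2 * c' * b ^+ 2 + 4 * (n ^+ 2 * c + n) * e ^+ 2) * k ^+ 2 by move=> *; lra.
have arith2 (n l c' c b e q : R) : 0 <= (n * l) ^+ 2 * c' -> 0 <= n ^+ 2 * c + n -> 0 <= e -> 0 <= b -> 0 <= q ->
  (20 * (n * l) ^+ 2 * c' * b ^+ 2 + 4 * (n ^+ 2 * c + n) * (e ^+ 2 + 4 * l ^+ 2 * q)) <=
  (20 * (n * l) ^+ 2 * c' + 4 * (n ^+ 2 * c + n) * (1 + 4 * l ^+ 2)) * ((e + b) ^+ 2 + q).
  move=> H1 H2 He Hb Hq.
  have Hebb : b ^+ 2 <= (e + b) ^+ 2 + q by nra.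
  have Heb : e ^+ 2 + 4 * l ^+ 2 * q <= (1 + 4 * l ^+ 2) * ((e + b) ^+ 2 + q).
    have := mulr_ge0 (sqr_ge0 l) (sqr_ge0 (e + b)); nra.
  have := ler_wpM2l H1 Hebb; have := ler_wpM2l H2 Heb; lra.
move=> J0 e00 x1 z1 uK fK dda ddf etaJ.
set k := 8 * pnorm (dir th' - dir th); set d := 8 / J%:R; set b := pnorm z.
have {}etaJ : d + k + b <= eta by [].
have b0 : 0 <= b by exact: pnorm_ge0.
have k0 : 0 <= k by rewrite mulr_ge0 ?pnorm_ge0.
have d0 : 0 <= d by rewrite divr_ge0.
pose p := path th x; pose p' := path th' x.
have pz t : p t + z = path th (x + z) t by rewrite /p /path addrAC [x + z - _]addrAC.
have p'z t : p' t + z = path th' (x + z) t by rewrite /p' /path addrAC [x + z - _]addrAC.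
pose e t i := (u th' (p' t + z) i - u th (p t + z) i) - (u th' (p' t) i - u th (p t) i).
have e8 : e 8 = fun i => (u th' (x + z) i - u th (x + z) i) - (u th' x i - u th x i).
  by rewrite /e pz p'z /p /p' !path8.
have e00' : e 0 = fun=> 0.
  apply/funext => i; rewrite /e pz p'z /p /p' !path_start ?subrr//; try lra.
    by apply: le_trans (pnormD _ _) _; lra.
  by apply: le_trans (pnormD _ _) _; lra.
(* [r1] and [r2] are products of first differences, of size k |z|; [r3] and [r4] contain the second
   differences of [a] and of [f]. *)
pose r1 t := mv (fun i j => a (p' t + z) i j - a (p' t) i j) (fun i => u th' (p' t) i - u th (p t) i).
pose r2 t := mv (fun i j => a (p' t + z) i j - a (p t + z) i j) (fun i => u th (p t + z) i - u th (p t) i).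
pose r3 t := mv (fun i j => a (p' t + z) i j - a (p t + z) i j - a (p' t) i j + a (p t) i j) (u th (p t)).
pose r4 t i := f (p' t + z) i - f (p t + z) i - f (p' t) i + f (p t) i.
pose r t i := (r1 t i + r2 t i) + (r3 t i + r4 t i).
have ed (t : R) i : is_derive t 1 (e^~ i) (mv (a (p' t + z)) (e t) i + r t i).
  rewrite (_ : e^~ i = fun t => (u th' (path th' (x + z) t) i - u th (path th (x + z) t) i) -
      (u th' (p' t) i - u th (p t) i)); last by apply/funext => s; rewrite /e pz p'z.
  have H := is_deriveB (is_deriveB (ud th' (x + z - 8 *: dir th') t i) (ud th (x + z - 8 *: dir th) t i))
     (is_deriveB (ud th' (x - 8 *: dir th') t i) (ud th (x - 8 *: dir th) t i)).
  apply: (is_derive_eq H).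
  rewrite -/(path th (x + z) t) -/(path th' (x + z) t) -pz -p'z -/(path th x t) -/(path th' x t).
  rewrite -/(p t) -/(p' t) /r /r1 /r2 /r3 /r4 /e.
  rewrite !mvBl mvDl !mvBl !mvB; ring.
pose q (j : nat) := collar_ind K eta (p (j%:R * d)).
have q0 j : 0 <= q j by exact: collar_ind_ge0.
pose B := 20 * (N * L) ^+ 2 * CL' + 4 * (N ^+ 2 * Cu + N) * (1 + 4 * L ^+ 2).
have hN1 : 0 <= (N * L) ^+ 2 * CL' by rewrite mulr_ge0 ?sqr_ge0 ?CL'_ge0.
have hN2 : 0 <= N ^+ 2 * Cu + N.
  by rewrite addr_ge0// mulr_ge0 ?sqr_ge0 ?Cu_ge0.
have B0 : 0 <= B.
  apply: addr_ge0; first by rewrite -mulrA mulr_ge0.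
  by rewrite mulr_ge0// ?mulr_ge0// addr_ge0// mulr_ge0 ?sqr_ge0.
pose rho j := B * ((e0 + b) ^+ 2 + q j) * k ^+ 2.
have rho0 j : 0 <= rho j.
  by rewrite /rho mulr_ge0 ?sqr_ge0// mulr_ge0// addr_ge0 ?sqr_ge0.
have er (j : nat) (t : R) : (j < J)%N ->
    t \in `](j%:R * (8 / J%:R)), (j.+1%:R * (8 / J%:R))[ -> nsq (r t) <= rho j.
  move=> jJ; rewrite -/d in_itv/= => /andP[jt tj].
  have t8 : t \in `]0, 8[.
    have dJ' : d * J%:R = 8 by rewrite /d divfK// pnatr_eq0 -lt0n.
    rewrite in_itv/=; apply/andP; split.
      by apply: le_lt_trans jt; rewrite mulr_ge0 ?ler0n.
    by apply: (lt_le_trans tj); rewrite -dJ' mulrC ler_wpM2l// ler_nat.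
  have pk : pnorm (p' t - p t) <= k.
    by have := @path_dist th th' x x t t8; rewrite subrr pnorm0 addr0.
  have pzk : pnorm (p' t + z - (p t + z)) <= k by rewrite opprD addrACA subrr addr0.
  have ptj : pnorm (p t - p (j%:R * d)) <= d.
    rewrite /p /path opprD addrACA subrr add0r -scalerBl pnormZ.
    rewrite (_ : `|_| = t - j%:R * d) ?ger0_norm ?subr_ge0 ?(ltW jt)//.
    rewrite -[leRHS]mulr1 ler_pM ?pnorm_ge0 ?dir_le1 ?subr_ge0 ?(ltW jt)//.
    by rewrite lerBlDr (le_trans (ltW tj))// -natr1 mulrDl mul1r addrC.
  (* The coefficient of a second difference: [e0] off the collar, only what the Lipschitz bound
     gives on it. *)
  pose ee := if `[< collar K eta (p (j%:R * d)) >] then 2 * L else e0.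
  have ee0 : 0 <= ee by rewrite /ee; case: ifP => _ //; rewrite mulr_ge0.
  have ee2 : ee ^+ 2 <= e0 ^+ 2 + 4 * L ^+ 2 * q j.
    rewrite /ee /q /collar_ind; case: ifP => _.
      by rewrite mulr1 exprMn -[leLHS]add0r lerD ?sqr_ge0//; lra.
    by rewrite mulr0 addr0.
  have near1 : pnorm (p t - p (j%:R * d)) <= eta by lra.
  have near2 : pnorm (p' t - p (j%:R * d)) <= eta.
    by rewrite -(subrK (p t) (p' t)) -addrA (le_trans (pnormD _ _))//; lra.
  have near3 : pnorm (p t + z - p (j%:R * d)) <= eta.
    by rewrite addrAC; have := pnormD (p t - p (j%:R * d)) z; rewrite -/b; lra.
  have near4 : pnorm (p' t + z - p (j%:R * d)) <= eta.
    rewrite addrAC; have := pnormD (p' t - p (j%:R * d)) z; rewrite -/b.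
    have := pnormD (p' t - p t) (p t - p (j%:R * d)); rewrite addrA subrK; lra.
  have p'E : p' t = p t + (p' t - p t) by rewrite addrCA subrr addr0.
  have ddL (g : P -> R) : (forall x y, `|g x - g y| <= L * pnorm (x - y)) ->
      `|g (p' t + z) - g (p t + z) - g (p' t) + g (p t)| <= 2 * L * k.
    move=> gL; rewrite (_ : _ - _ + _ = (g (p' t + z) - g (p t + z)) - (g (p' t) - g (p t))); last by ring.
    have := ler_normB (g (p' t + z) - g (p t + z)) (g (p' t) - g (p t)).
    have := gL (p' t + z) (p t + z); have := gL (p' t) (p t).
    have := ler_wpM2l L0 pk; have := ler_wpM2l L0 pzk; lra.
  have eek : ~ collar K eta (p (j%:R * d)) -> e0 * pnorm (p' t - p t) <= ee * k.
    by move=> nC; rewrite /ee asboolF// ler_wpM2l.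
  have H3 : nsq (r3 t) <= (N * (ee * k)) ^+ 2 * Cu.
    have [C|nC] := pselect (collar K eta (p (j%:R * d))); last case: (not_collar nC) => [iK|oK].
    - rewrite (le_trans (nsq_mv (A0 := ee * k) _ _))//.
        move=> i1 i2; rewrite /ee asboolT//; exact: (ddL (fun x => a x i1 i2)).
      by rewrite ler_wpM2l ?sqr_ge0 ?u_bound.
    - rewrite (le_trans (nsq_mv (A0 := ee * k) _ _))//.
        move=> i1 i2; apply: le_trans (eek nC).
        have := dda (p t) (p' t - p t) i1 i2 (iK _ near1); rewrite -p'E.
        by move=> /(_ (iK _ near2) (iK _ near3) (iK _ near4)).
      by rewrite ler_wpM2l ?sqr_ge0 ?u_bound.
    - rewrite (_ : r3 t = fun=> 0).
        by rewrite nsq_cst0; apply: mulr_ge0; [exact: sqr_ge0 | exact: Cu_ge0].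
      by apply/funext => i; rewrite /r3 /mv big1// => i2 _; rewrite uK ?mulr0//; exact: oK.
  have H4 : nsq (r4 t) <= N * (ee * k) ^+ 2.
    have [C|nC] := pselect (collar K eta (p (j%:R * d))); last case: (not_collar nC) => [iK|oK].
    - by apply: le_nsq => i; rewrite /ee asboolT//; exact: (ddL (fun x => f x i)).
    - apply: le_nsq => i; apply: le_trans (eek nC).
      have := ddf (p t) (p' t - p t) i (iK _ near1); rewrite -p'E.
      by move=> /(_ (iK _ near2) (iK _ near3) (iK _ near4)).
    - rewrite (_ : r4 t = fun=> 0).
        by rewrite nsq_cst0; apply: mulr_ge0; [exact: N0 | exact: sqr_ge0].
      by apply/funext => i; rewrite /r4 !fK ?subrr ?addr0//; exact: oK.
  have H1 : nsq (r1 t) <= (N * (L * b)) ^+ 2 * (CL' * (2 * k) ^+ 2).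
    rewrite (le_trans (nsq_mv (A0 := L * b) _ _))//.
      by move=> i1 i2; rewrite (le_trans (aL _ _ _ _))// addrAC subrr add0r.
    by rewrite ler_wpM2l ?sqr_ge0// u_lipT// -/k mulr_natl mulr2n lerD2l.
  have H2 : nsq (r2 t) <= (N * (L * k)) ^+ 2 * (CL' * b ^+ 2).
    rewrite (le_trans (nsq_mv (A0 := L * k) _ _))//.
      by move=> i1 i2; rewrite (le_trans (aL _ _ _ _))// ler_wpM2l.
    rewrite ler_wpM2l ?sqr_ge0// u_lipT// subrr addrAC subrr add0r.
    by rewrite pnorm0 mulr0 add0r.
  have H5 : nsq (r t) <= 4 * nsq (r1 t) + 4 * nsq (r2 t) + 4 * nsq (r3 t) + 4 * nsq (r4 t).
    have h1 : nsq (r t) <= _ := nsqD (fun i => r1 t i + r2 t i) (fun i => r3 t i + r4 t i).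
    have := nsqD (r1 t) (r2 t); have := nsqD (r3 t) (r4 t).
    by move: h1; move: (nsq _) (nsq _) (nsq _) (nsq _) => *; lra.
  rewrite (le_trans (arith _ _ _ _ _ _ _ _ _ _ _ _ H1 H2 H3 H4 H5))//.
  rewrite /rho ler_wpM2r ?sqr_ge0//.
  have := arith2 N L CL' Cu b e0 (q j) hN1 hN2 e00 b0 (q0 j); rewrite -/B.
  have : 4 * (N ^+ 2 * Cu + N) * ee ^+ 2 <= 4 * (N ^+ 2 * Cu + N) * (e0 ^+ 2 + 4 * L ^+ 2 * q j).
    by rewrite ler_wpM2l// mulr_ge0.
  by move: (_ * ee ^+ 2) => X; lra.
have := gronwall_steps (ler0n _ 8) J0 rho0 (fun t => aA (p' t + z)) ed er.
rewrite e8 e00' nsq_cst0 add0r => H; apply: (le_trans H).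
have dJ : d * J%:R = 8 by rewrite /d divfK// pnatr_eq0 -lt0n.
have -> : \sum_(j < J) rho j = B * k ^+ 2 * (J%:R * (e0 + b) ^+ 2 + \sum_(j < J) q j).
  rewrite mulrDr mulr_sumr -[J in J%:R]card_ord mulr_natl -sumr_const mulr_sumr -big_split/=.
  by apply: eq_bigr => j _; rewrite /rho; ring.
rewrite -/Eg -/d /CW -/B -/k.
set S := \sum_(j < J) q j.
have S0 : 0 <= S by apply: sumr_ge0.
have -> : d * (B * k ^+ 2 * (J%:R * (e0 + b) ^+ 2 + S)) =
    B * k ^+ 2 * (8 * (e0 + b) ^+ 2 + d * S) by rewrite -dJ; ring.
have -> : Eg * 8 * B * k ^+ 2 * ((e0 + b) ^+ 2 + d * S) =
    Eg * (B * k ^+ 2 * (8 * ((e0 + b) ^+ 2 + d * S))) by ring.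
apply: ler_wpM2l; first exact: Eg_ge0.
apply: ler_wpM2l; first by rewrite mulr_ge0 ?sqr_ge0.
have dS := mulr_ge0 d0 S0; move: (d * S) dS => dS dS0.
by rewrite mulrDr lerD2l ler_peMl// ler1n.
Qed.

Lemma transport_estimates : (forall th x, ~ K x -> forall i, u th x i = 0) ->
  (forall x, ~ K x -> forall i, f x i = 0) ->
  exists2 C : R, 0 <= C & [/\ forall th x, nsq (u th x) <= C,
  forall th th' x x' k, 8 * pnorm (dir th' - dir th) + pnorm (x' - x) <= k ->
    nsq (fun i => u th' x' i - u th x i) <= C * k ^+ 2 &
  forall th th' (x z : P) (J : nat) (eta e0 : R),
  (0 < J)%N -> 0 <= e0 -> pnorm x <= 1 -> pnorm z <= 1 ->
  (forall p d i j, K p -> K (p + d) -> K (p + z) -> K (p + d + z) ->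
     `|a (p + d + z) i j - a (p + z) i j - a (p + d) i j + a p i j| <= e0 * pnorm d) ->
  (forall p d i, K p -> K (p + d) -> K (p + z) -> K (p + d + z) ->
     `|f (p + d + z) i - f (p + z) i - f (p + d) i + f p i| <= e0 * pnorm d) ->
  8 / J%:R + 8 * pnorm (dir th' - dir th) + pnorm z <= eta ->
  nsq (fun i => (u th' (x + z) i - u th (x + z) i) - (u th' x i - u th x i)) <=
  C * (8 * pnorm (dir th' - dir th)) ^+ 2 *
    ((e0 + pnorm z) ^+ 2 + 8 / J%:R * \sum_(j < J) collar_ind K eta
       (x + (j%:R * (8 / J%:R) - 8) *: dir th))].
Proof.
move=> uK fK.
have C1 := Cu_ge0; have C2 := CL'_ge0; have C3 := CW_ge0.
exists (Cu + CL' + CW); first by rewrite (addr_ge0 (addr_ge0 C1 C2)).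
split.
- move=> th x; apply: (le_trans (u_bound th x)).
  by move: (Cu) (CL') (CW) C1 C2 C3 => *; lra.
- move=> th th' x x' k H.
  apply: (le_trans (u_lipT H)); rewrite ler_wpM2r ?sqr_ge0//.
  by move: (Cu) (CL') (CW) C1 C2 C3 => *; lra.
- move=> th th' x z J eta e0 J0 e00 x1 z1 da df H.
  apply: (le_trans (w_diff J0 e00 x1 z1 uK fK da df H)).
  under [X in _ <= _ * (_ + _ * X)]eq_bigr => j _.
    rewrite (_ : _ + _ *: _ = path th x (j%:R * (8 / J%:R))); last first.
      by rewrite /path scalerBl addrA addrAC.
    over.
  have le : CW <= Cu + CL' + CW by move: (Cu) (CL') (CW) C1 C2 C3 => *; lra.
  apply: ler_wpM2r; last by apply: ler_wpM2r le; exact: sqr_ge0.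
  apply: addr_ge0; first exact: sqr_ge0.
  apply: mulr_ge0; first exact: divr_ge0.
  by apply: sumr_ge0 => j _; exact: collar_ind_ge0.
Qed.

End Transport.

(** * Block averages *)

Section Shifts.
Variable R : realType.
Local Notation P := (R * R)%type.
Implicit Types (F G : P -> R) (s : R).

Lemma lsum_shiftn1 s B F rho (n : nat) : 0 < s ->
  (forall x, rho <= pnorm x -> F x = 0) -> rho + s * n%:R <= s * B%:R ->
  lsum s B (fun x => F (x + (s * n%:R, 0))) = lsum s B F.
Proof.
move=> s0 F0; elim: n => [|n IH] H.
  by apply: eq_lsum => x; rewrite mulr0 (_ : (0, 0) = 0 :> P) ?addr0.
have H' : rho + s * n%:R <= s * B%:R.
  by move: H; rewrite -natr1 mulrDr mulr1; lra.
rewrite -IH// -[RHS](lsum_shift1 s0).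
  apply: eq_lsum => x; congr F; rewrite -addrA; congr (_ + _).
  by apply/pair_equal_spec; split; rewrite /= ?addr0// -natr1; ring.
move=> x Bx; apply: F0; have := pnorm_shift_ge x (s * n%:R, 0).
by rewrite pnorm_e1 ?mulr_ge0 ?(ltW s0)//; lra.
Qed.

Lemma lsum_shiftn2 s B F rho (n : nat) : 0 < s ->
  (forall x, rho <= pnorm x -> F x = 0) -> rho + s * n%:R <= s * B%:R ->
  lsum s B (fun x => F (x + (0, s * n%:R))) = lsum s B F.
Proof.
move=> s0 F0; elim: n => [|n IH] H.
  by apply: eq_lsum => x; rewrite mulr0 (_ : (0, 0) = 0 :> P) ?addr0.
have H' : rho + s * n%:R <= s * B%:R.
  by move: H; rewrite -natr1 mulrDr mulr1; lra.
rewrite -IH// -[RHS](lsum_shift2 s0).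
  apply: eq_lsum => x; congr F; rewrite -addrA; congr (_ + _).
  by apply/pair_equal_spec; split; rewrite /= ?addr0// -natr1; ring.
move=> x Bx; apply: F0; have := pnorm_shift_ge x (0, s * n%:R).
by rewrite pnorm_e2 ?mulr_ge0 ?(ltW s0)//; lra.
Qed.

(* Negative shifts reduce to positive ones applied to the shifted function. *)
Lemma lsum_shiftZ1 s B F rho (b : bool) (n : nat) : 0 < s ->
  (forall x, rho <= pnorm x -> F x = 0) -> rho + 2 * (s * n%:R) <= s * B%:R ->
  lsum s B (fun x => F (x + ((-1) ^+ b * (s * n%:R), 0))) = lsum s B F.
Proof.
move=> s0 F0 H; have sn0 : 0 <= s * n%:R by rewrite mulr_ge0 ?(ltW s0).
case: b; last first.
  by under eq_fun do rewrite mul1r; apply: lsum_shiftn1 F0 _ => //; lra.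
under eq_fun do rewrite mulN1r.
rewrite -[LHS](@lsum_shiftn1 s B _ (rho + s * n%:R) n s0).
- apply: eq_lsum => x; congr F; rewrite -addrA -[RHS]addr0; congr (_ + _).
  by apply/pair_equal_spec; split; rewrite /= ?addr0//; ring.
- move=> x cx; apply: F0; have := pnorm_shift_ge x (- (s * n%:R), 0).
  rewrite (_ : (- _, 0) = - (s * n%:R, 0)) ?pnormN ?pnorm_e1//; first by lra.
  by apply/pair_equal_spec; rewrite /= oppr0.
- by lra.
Qed.

Lemma lsum_shiftZ2 s B F rho (b : bool) (n : nat) : 0 < s ->
  (forall x, rho <= pnorm x -> F x = 0) -> rho + 2 * (s * n%:R) <= s * B%:R ->
  lsum s B (fun x => F (x + (0, (-1) ^+ b * (s * n%:R)))) = lsum s B F.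
Proof.
move=> s0 F0 H; have sn0 : 0 <= s * n%:R by rewrite mulr_ge0 ?(ltW s0).
case: b; last first.
  by under eq_fun do rewrite mul1r; apply: lsum_shiftn2 F0 _ => //; lra.
under eq_fun do rewrite mulN1r.
rewrite -[LHS](@lsum_shiftn2 s B _ (rho + s * n%:R) n s0).
- apply: eq_lsum => x; congr F; rewrite -addrA -[RHS]addr0; congr (_ + _).
  by apply/pair_equal_spec; split; rewrite /= ?addr0//; ring.
- move=> x cx; apply: F0; have := pnorm_shift_ge x (0, - (s * n%:R)).
  rewrite (_ : (0, - _) = - (0, s * n%:R)) ?pnormN ?pnorm_e2//; first by lra.
  by apply/pair_equal_spec; rewrite /= oppr0.
- by lra.
Qed.

Lemma lsum_shiftZ s B F rho (b1 b2 : bool) (n1 n2 : nat) : 0 < s ->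
  (forall x, rho <= pnorm x -> F x = 0) ->
  rho + 2 * (s * n1%:R) + 2 * (s * n2%:R) <= s * B%:R ->
  lsum s B (fun x => F (x + ((-1) ^+ b1 * (s * n1%:R), (-1) ^+ b2 * (s * n2%:R)))) =
  lsum s B F.
Proof.
move=> s0 F0 H.
have sn0 (n : nat) : 0 <= s * n%:R by rewrite mulr_ge0 ?(ltW s0).
rewrite -(@lsum_shiftZ2 s B F rho b2 n2)//; last by have := sn0 n1; lra.
rewrite -[RHS](@lsum_shiftZ1 s B _ (rho + s * n2%:R) b1 n1)//; last by have := sn0 n2; lra.
  apply: eq_lsum => x; congr F; rewrite -addrA; congr (_ + _).
  by apply/pair_equal_spec; split; rewrite /= ?addr0 ?add0r.
move=> x cx; apply: F0.
have := pnorm_shift_ge x (0, (-1) ^+ b2 * (s * n2%:R)).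
rewrite (_ : pnorm (0, _) = s * n2%:R); first by lra.
by case: b2; rewrite ?mulN1r ?mul1r /pnorm/= ?normrN normr0 ger0_norm// max_r.
Qed.

(* [z] is rounded to the lattice. *)
Lemma le_lsum_translate s B (z : P) F G rho : 0 < s ->
  (forall x y, pnorm (x - y) <= s -> F x <= G y) -> (forall x, 0 <= G x) ->
  rho + 5 * pnorm z + s <= s * B%:R ->
  lsum s B (fun x => if pnorm x <= rho then F (x + z) else 0) <= lsum s B G.
Proof.
move=> s0 FG G0 H.
pose n1 := Num.truncn (`|z.1| / s); pose n2 := Num.truncn (`|z.2| / s).
pose y := ((-1) ^+ (z.1 < 0)%R * (s * n1%:R), (-1) ^+ (z.2 < 0)%R * (s * n2%:R)) : P.
have rnd (t : R) : s * (Num.truncn (`|t| / s))%:R <= `|t| /\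
    `|t - (-1) ^+ (t < 0)%R * (s * (Num.truncn (`|t| / s))%:R)| <= s.
  have /andP[nt tn] := truncn_itv (divr_ge0 (normr_ge0 t) (ltW s0)).
  rewrite ler_pdivlMr// mulrC in nt; rewrite ltr_pdivrMr// -natr1 mulrDl mul1r mulrC in tn.
  split => //; have {1}-> : t = (-1) ^+ (t < 0)%R * `|t| by rewrite {1}(numEsign t).
  rewrite -mulrBr normrM normr_sign mul1r ger0_norm ?subr_ge0//; lra.
have [n1z y1] := rnd z.1; have [n2z y2] := rnd z.2.
rewrite -/n1 in n1z; rewrite -/n2 in n2z.
have z1 : `|z.1| <= pnorm z by rewrite le_max lexx.
have z2 : `|z.2| <= pnorm z by rewrite le_max lexx orbT.
have zy : pnorm (z - y) <= s by rewrite pnorm_le/= y1 y2.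
have yz : pnorm y <= pnorm z.
  rewrite pnorm_le/= !normrM !normr_sign !mul1r !normr_nat (gtr0_norm s0).
  by rewrite (le_trans n1z)// (le_trans n2z).
pose G' x := if pnorm x <= rho + pnorm z then G x else 0.
have E := @lsum_shiftZ s B G' (rho + pnorm z + s) (z.1 < 0)%R (z.2 < 0)%R n1 n2 s0 _ _.
apply: (@le_trans _ _ (lsum s B G')); last first.
  by apply: ler_lsum => x; rewrite /G'; case: ifP.
rewrite -E; first last.
- by lra.
- by move=> x xr; rewrite /G' ifF//; apply/negbTE; rewrite -ltNge; lra.
apply: ler_lsum => x; rewrite -/y /G'; case: ifP => xr.
  have -> : pnorm (x + y) <= rho + pnorm z by have := pnormD x y; lra.
  by apply: FG; rewrite opprD addrACA subrr add0r.
by case: ifP.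
Qed.

End Shifts.

Section BlockAverage.
Variables (R : realType) (s : R) (r : nat).
Hypotheses (s0 : 0 < s) (r0 : (0 < r)%N).
Local Notation P := (R * R)%type.
Implicit Types (F G : P -> R).

(** A mollifier on the lattice. Its difference quotients are Lipschitz with a constant of order 1 /
    (s r), which stands in for second derivatives of a function that is only Lipschitz. *)
Definition bavg F (x : P) : R :=
  (r ^ 2)%:R^-1 * \sum_(a < r) \sum_(b < r) F (x + (s * a%:R, s * b%:R)).

Let r2 : (0 : R) < (r ^ 2)%:R. Proof. by rewrite ltr0n expn_gt0 r0. Qed.

Lemma bavg_le F G x :
  (forall a b, (a < r)%N -> (b < r)%N ->
    F (x + (s * a%:R, s * b%:R)) <= G (x + (s * a%:R, s * b%:R))) ->
  bavg F x <= bavg G x.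
Proof.
move=> FG; rewrite /bavg ler_wpM2l ?invr_ge0 ?(ltW r2)//.
by apply: ler_sum => a _; apply: ler_sum => b _; exact: FG.
Qed.

Lemma bavg_cst (c : R) x : bavg (fun=> c) x = c.
Proof.
rewrite /bavg !sumr_const !card_ord -mulrnA mulnn -[c *+ _]mulr_natl mulrA.
by rewrite mulVf ?mul1r// gt_eqF.
Qed.

Lemma bavgD F G x : bavg (fun y => F y + G y) x = bavg F x + bavg G x.
Proof.
rewrite /bavg -mulrDr -big_split/=; congr (_ * _).
by apply: eq_bigr => a _; rewrite -big_split.
Qed.

Lemma bavgZ (c : R) F x : bavg (fun y => c * F y) x = c * bavg F x.
Proof.
rewrite /bavg [RHS]mulrCA; congr (_ * _); rewrite mulr_sumr.
by apply: eq_bigr => a _; rewrite mulr_sumr.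
Qed.

Lemma bavgB F G x : bavg (fun y => F y - G y) x = bavg F x - bavg G x.
Proof.
by rewrite -mulN1r -bavgZ -bavgD; congr bavg; apply/funext => y; rewrite mulN1r.
Qed.

Lemma bavg_sum (I : finType) (F : I -> P -> R) x :
  bavg (fun y => \sum_i F i y) x = \sum_i bavg (F i) x.
Proof.
rewrite /bavg -mulr_sumr; congr (_ * _); rewrite [RHS]exchange_big/=.
by apply: eq_bigr => a _; rewrite [RHS]exchange_big.
Qed.

Lemma bavg_shift F x y : bavg F (x + y) = bavg (fun z => F (z + y)) x.
Proof.
by rewrite /bavg; congr (_ * _); do 2!apply: eq_bigr => ? _; rewrite addrAC.
Qed.

Lemma pnorm_block (a b : nat) : (a < r)%N -> (b < r)%N ->
  pnorm (s * a%:R, s * b%:R) <= s * r%:R.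
Proof.
move=> ar br; rewrite pnorm_le/= !normrM !normr_nat gtr0_norm//.
by rewrite !ler_pM2l// !ler_nat (ltnW ar) (ltnW br).
Qed.

Lemma bavg_dist F x c C :
  (forall y, pnorm (y - x) <= s * r%:R -> `|F y - c| <= C) ->
  `|bavg F x - c| <= C.
Proof.
move=> FC; rewrite ler_distl; apply/andP; split.
  rewrite -(bavg_cst (c - C) x); apply: bavg_le => a b ar br.
  have := FC (x + (s * a%:R, s * b%:R)).
  by rewrite addrAC subrr add0r => /(_ (pnorm_block ar br)); rewrite ler_distl => /andP[].
rewrite -(bavg_cst (c + C) x); apply: bavg_le => a b ar br.
have := FC (x + (s * a%:R, s * b%:R)).
by rewrite addrAC subrr add0r => /(_ (pnorm_block ar br)); rewrite ler_distl => /andP[].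
Qed.

Lemma bavg_eq0 F x :
  (forall y, pnorm (y - x) <= s * r%:R -> F y = 0) -> bavg F x = 0.
Proof.
move=> F0; apply/eqP; rewrite -normr_le0 -[X in `|X|]subr0.
by apply: bavg_dist => y yx; rewrite F0// subrr normr0.
Qed.

Lemma sqr_bavg F x : bavg F x ^+ 2 <= bavg (fun y => F y ^+ 2) x.
Proof.
rewrite /bavg !pair_bigA/= exprMn expr2 -mulrA ler_pM2l ?invr_gt0//.
rewrite ler_pdivrMl// (le_trans (sqr_sum_le _))//.
by rewrite card_prod card_ord mulnn.
Qed.

Lemma lsum_bavg B F rho : (forall x, rho <= pnorm x -> F x = 0) ->
  rho + 4 * (s * r%:R) <= s * B%:R -> lsum s B (bavg F) = lsum s B F.
Proof.
move=> F0 H.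
rewrite [LHS]lsumZ (lsum_sum _ _ _ _ (fun a x => \sum_b _)).
under eq_bigr => a _.
  rewrite (lsum_sum _ _ _ _ (fun b x => _)).
  under eq_bigr => b _.
    rewrite (_ : lsum _ _ _ = lsum s B F); last first.
      have := @lsum_shiftZ R s B F rho false false a b s0 F0.
      rewrite !mul1r; apply.
      have : s * a%:R <= s * r%:R by rewrite ler_pM2l// ler_nat ltnW.
      have : s * b%:R <= s * r%:R by rewrite ler_pM2l// ler_nat ltnW.
      lra.
    over.
  over.
rewrite !sumr_const !card_ord -mulrnA mulnn -[lsum s B F *+ _]mulr_natl mulKf//.
by rewrite gt_eqF.
Qed.

Let e := s * r%:R.
Let e0 : 0 < e. Proof. by rewrite mulr_gt0// ltr0n. Qed.

(* The differences telescope over the block, which gains a factor [s / e]. *)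
Lemma fdiff1_bavg_bound F x C : (forall y, `|F (y + (e, 0)) - F y| <= C) ->
  `|fdiff1 s (bavg F) x| <= C / e.
Proof.
move=> FC; rewrite /fdiff1 /bavg exchange_big /= [X in _ - _ * X]exchange_big /=.
rewrite -mulrBr -sumrB.
under eq_bigr => b _.
  rewrite -sumrB (_ : \sum_(a < r) _ = F (x + (e, s * b%:R)) - F (x + (0, s * b%:R))); last first.
    pose g (a : nat) := F (x + (s * a%:R, s * b%:R)).
    rewrite -[in X in _ - X](mulr0 s) -/(g 0%N) -/(g r) -telescope_sumr// big_mkord.
    apply: eq_bigr => a _; congr (F _ - _); rewrite -addrA; congr (_ + _).
    by apply/pair_equal_spec; split; rewrite /= ?add0r// -natr1; ring.
  over.
rewrite normrM normfV (gtr0_norm s0) ler_pdivrMr// normrM.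
rewrite (gtr0_norm (x := _^-1)) ?invr_gt0// ler_pdivrMl//.
apply: (@le_trans _ _ (\sum_(b < r) C)).
  rewrite (le_trans (ler_norm_sum _ _ _))//; apply: ler_sum => b _.
  have := FC (x + (0, s * b%:R)); rewrite -addrA (_ : (0, _) + _ = (e, s * b%:R))//.
  by apply/pair_equal_spec; rewrite /= add0r addr0.
rewrite sumr_const card_ord -mulr_natl le_eqVlt; apply/orP; left; apply/eqP.
rewrite /e natrX; field; rewrite !gt_eqF// ltr0n//.
Qed.

Lemma fdiff2_bavg_bound F x C : (forall y, `|F (y + (0, e)) - F y| <= C) ->
  `|fdiff2 s (bavg F) x| <= C / e.
Proof.
move=> FC; rewrite /fdiff2 /bavg -mulrBr -sumrB.
under eq_bigr => a _.
  rewrite -sumrB (_ : \sum_(b < r) _ = F (x + (s * a%:R, e)) - F (x + (s * a%:R, 0))); last first.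
    pose g (b : nat) := F (x + (s * a%:R, s * b%:R)).
    rewrite -[in X in _ - X](mulr0 s) -/(g 0%N) -/(g r) -telescope_sumr// big_mkord.
    apply: eq_bigr => b _; congr (F _ - _); rewrite -addrA; congr (_ + _).
    by apply/pair_equal_spec; split; rewrite /= ?add0r// -natr1; ring.
  over.
rewrite normrM normfV (gtr0_norm s0) ler_pdivrMr// normrM.
rewrite (gtr0_norm (x := _^-1)) ?invr_gt0// ler_pdivrMl//.
apply: (@le_trans _ _ (\sum_(b < r) C)).
  rewrite (le_trans (ler_norm_sum _ _ _))//; apply: ler_sum => a _.
  have := FC (x + (s * a%:R, 0)); rewrite -addrA (_ : (_, 0) + _ = (s * a%:R, e))//.
  by apply/pair_equal_spec; rewrite /= add0r addr0.
rewrite sumr_const card_ord -mulr_natl le_eqVlt; apply/orP; left; apply/eqP.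
rewrite /e natrX; field; rewrite !gt_eqF// ltr0n//.
Qed.

Lemma fdiff_bavg_le F x C : (forall y, `|F y| <= C) ->
  `|fdiff1 s (bavg F) x| <= 2 * C / e /\ `|fdiff2 s (bavg F) x| <= 2 * C / e.
Proof.
move=> FC; split; [apply: fdiff1_bavg_bound|apply: fdiff2_bavg_bound] => y;
  rewrite (le_trans (ler_normB _ _))//; have := FC y; have := FC (y + (e, 0));
  have := FC (y + (0, e)); lra.
Qed.

Section Lipschitz.
Variables (F : P -> R) (Lf : R).
Hypothesis FL : forall x y, `|F x - F y| <= Lf * pnorm (x - y).
Let Ld := 2 * Lf / e.

Lemma bavg_lip x y : `|bavg F x - bavg F y| <= Lf * pnorm (x - y).
Proof.
have -> : bavg F x = bavg (fun z => F (z + (x - y))) y.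
  by rewrite -bavg_shift addrC subrK.
rewrite -bavgB -[X in `|X|]subr0.
apply: bavg_dist => z _; rewrite subr0 (le_trans (FL _ _))//.
by rewrite addrAC subrr add0r.
Qed.

(** The difference of the quotients at [x] and [y] is one quotient of the averaged increment
    [F (z + (x - y)) - F z], which is at most [Lf * pnorm (x - y)]; the gain of averaging applies to
    it. *)
Lemma fdiff1_bavg_lip x y :
  `|fdiff1 s (bavg F) x - fdiff1 s (bavg F) y| <= Ld * pnorm (x - y).
Proof.
have -> : fdiff1 s (bavg F) x - fdiff1 s (bavg F) y =
    fdiff1 s (bavg (fun z => F (z + (x - y)) - F z)) y.
  rewrite /fdiff1 !bavgB -!bavg_shift.
  have -> : y + (x - y) = x by rewrite addrC subrK.
  have -> : y + (s, 0) + (x - y) = x + (s, 0) by rewrite addrAC [y + _]addrC subrK.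
  by ring.
have H z : `|F (z + (x - y)) - F z| <= Lf * pnorm (x - y).
  by rewrite (le_trans (FL _ _))// addrAC subrr add0r.
by have [] := fdiff_bavg_le y H; rewrite /Ld; lra.
Qed.

Lemma fdiff2_bavg_lip x y :
  `|fdiff2 s (bavg F) x - fdiff2 s (bavg F) y| <= Ld * pnorm (x - y).
Proof.
have -> : fdiff2 s (bavg F) x - fdiff2 s (bavg F) y =
    fdiff2 s (bavg (fun z => F (z + (x - y)) - F z)) y.
  rewrite /fdiff2 !bavgB -!bavg_shift.
  have -> : y + (x - y) = x by rewrite addrC subrK.
  have -> : y + (0, s) + (x - y) = x + (0, s) by rewrite addrAC [y + _]addrC subrK.
  by ring.
have H z : `|F (z + (x - y)) - F z| <= Lf * pnorm (x - y).
  by rewrite (le_trans (FL _ _))// addrAC subrr add0r.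
by have [] := fdiff_bavg_le y H; rewrite /Ld; lra.
Qed.

End Lipschitz.

End BlockAverage.

(** * Discrete Taylor expansion and directional derivatives of block averages *)

Section LatticeTaylor.
Variables (R : realType) (s : R).
Hypothesis s0 : 0 < s.

(** Telescoping over the whole lattice steps below [t] gives the quadratic error; the remaining
    fraction of a step costs 2 Lf s by the Lipschitz bounds. *)
Lemma lattice_taylor1 (phi : R -> R) (Lf Ld : R) : 0 <= Ld ->
  (forall t t', `|phi t - phi t'| <= Lf * `|t - t'|) ->
  (forall t t', `|(phi (t + s) - phi t) / s - (phi (t' + s) - phi t') / s| <= Ld * `|t - t'|) ->
  forall t, `|phi t - phi 0 - t * ((phi (0 + s) - phi 0) / s)| <=
    2 * Ld * t ^+ 2 + 2 * Lf * s.
Proof.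
move=> Ld0 pL dL.
pose d t := (phi (t + s) - phi t) / s.
have dLf t : `|d t| <= Lf.
  rewrite /d normrM normfV (gtr0_norm s0) ler_pdivrMr// (le_trans (pL _ _))//.
  by rewrite addrAC subrr add0r gtr0_norm.
have pos t0 t : 0 <= t ->
    `|phi (t0 + t) - phi t0 - t * d t0| <= Ld * t ^+ 2 + 2 * Lf * s.
  move=> tge0; pose n := Num.truncn (t / s).
  have /andP[nt tn] : (n%:R * s <= t) && (t < n.+1%:R * s).
    rewrite -ler_pdivlMr// -ltr_pdivrMr//; apply: truncn_itv.
    by rewrite divr_ge0// ltW.
  have A : `|phi (t0 + n%:R * s) - phi t0 - n%:R * s * d t0| <= n%:R * s * (Ld * t).
    have -> : phi (t0 + n%:R * s) - phi t0 - n%:R * s * d t0 =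
        \sum_(k < n) s * (d (t0 + k%:R * s) - d t0).
      rewrite -mulr_sumr sumrB sumr_const card_ord mulrBr.
      rewrite -[d t0 *+ n]mulr_natl [s * (_ * _)]mulrCA mulrA; congr (_ - _).
      rewrite mulr_sumr -(big_mkord xpredT (fun k => s * d (t0 + k%:R * s))).
      rewrite (@telescope_sumr_eq _ 0%N n (fun k => phi (t0 + k%:R * s)))//.
        by rewrite mul0r addr0.
      move=> k _; rewrite /d mulrC divfK ?gt_eqF//; congr (phi _ - _).
      by rewrite -natr1; ring.
    rewrite (le_trans (ler_norm_sum _ _ _))//.
    rewrite (le_trans (ler_sum _ (G := fun=> s * (Ld * t)) _))//.
      move=> k _; rewrite normrM (gtr0_norm s0) ler_pM2l//.
      rewrite (le_trans (dL _ _))// addrAC subrr add0r ler_wpM2l//.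
      rewrite ger0_norm ?mulr_ge0 ?(ltW s0)// (le_trans _ nt)//.
      by rewrite ler_pM2r// ler_nat ltnW.
    by rewrite sumr_const card_ord -[_ *+ n]mulr_natl -!mulrA.
  have B : `|phi (t0 + t) - phi (t0 + n%:R * s)| <= Lf * s.
    rewrite (le_trans (pL _ _))//.
    have Lf0 : 0 <= Lf by exact: le_trans (dLf 0).
    rewrite ler_wpM2l// (_ : _ - _ = t - n%:R * s); last by ring.
    by rewrite ger0_norm ?subr_ge0// lerBlDr; move: tn; rewrite -natr1 mulrDl mul1r; lra.
  have C : `|(t - n%:R * s) * d t0| <= s * Lf.
    rewrite normrM ler_pM// ger0_norm ?subr_ge0//.
    by rewrite lerBlDr; move: tn; rewrite -natr1 mulrDl mul1r; lra.
  have D : n%:R * s * (Ld * t) <= Ld * t ^+ 2.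
    have := ler_wpM2r (mulr_ge0 Ld0 tge0) nt; nra.
  move: A B C; rewrite !ler_norml.
  by move=> /andP[A1 A2] /andP[B1 B2] /andP[C1 C2]; apply/andP; split; lra.
move=> t; rewrite -/(d 0); have [t0|t0] := leP 0 t.
  have := pos 0 t t0; rewrite add0r.
  have := mulr_ge0 Ld0 (sqr_ge0 t); lra.
(* For negative [t] the expansion runs from [t] forward to 0, and the slope at [t] is exchanged for
   that at 0. *)
have := pos t (- t) _; rewrite subrr => /(_ _).
have A : `|d 0 - d t| <= Ld * - t.
  by have := dL 0 t; rewrite sub0r normrN (ltr0_norm t0).
have B : `|- t * (d 0 - d t)| <= - t * (Ld * - t).
  by rewrite normrM normrN (ltr0_norm t0) ler_wpM2l// oppr_ge0 ltW.
move=> /(_ ltac:(lra)); rewrite sqrrN; move: B; rewrite !ler_norml.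
move=> /andP[B1 B2] /andP[C1 C2]; apply/andP; split; lra.
Qed.

End LatticeTaylor.

Section DirectionalAverage.
Variables (R : realType) (s : R) (r : nat).
Hypotheses (s0 : 0 < s) (r0 : (0 < r)%N).
Local Notation P := (R * R)%type.
Let e := s * r%:R.
Let e0 : 0 < e. Proof. by rewrite mulr_gt0// ltr0n. Qed.

Lemma bavg_taylor (F : P -> R) (Lf : R) : 0 <= Lf ->
  (forall x y, `|F x - F y| <= Lf * pnorm (x - y)) ->
  forall x z, `|bavg s r F (x + z) - bavg s r F x -
    (z.1 * fdiff1 s (bavg s r F) x + z.2 * fdiff2 s (bavg s r F) x)| <=
    5 * (2 * Lf / e) * pnorm z ^+ 2 + 4 * Lf * s.
Proof.
move=> Lf0 FL x z; set M := bavg s r F; set Ld := 2 * Lf / e.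
have Ld0 : 0 <= Ld.
  apply: mulr_ge0; [exact: mulr_ge0|by rewrite invr_ge0 ltW].
have ML := bavg_lip s0 r0 FL; rewrite -/M in ML.
have D1L := fdiff1_bavg_lip s0 r0 FL; rewrite -/M -/e -/Ld in D1L.
have D2L := fdiff2_bavg_lip s0 r0 FL; rewrite -/M -/e -/Ld in D2L.
have n1 (a : R) : pnorm (a, 0 : R) = `|a| by rewrite /pnorm/= normr0 max_l.
have n2 (a : R) : pnorm (0 : R, a) = `|a| by rewrite /pnorm/= normr0 max_r.
have d1 (y : P) t t' : (y + (t, 0)) - (y + (t', 0)) = (t - t', 0) :> P.
  by apply/pair_equal_spec; split; rewrite /=; ring.
have d2 (y : P) t t' : (y + (0, t)) - (y + (0, t')) = (0, t - t') :> P.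
  by apply/pair_equal_spec; split; rewrite /=; ring.
have s1 (y : P) (t : R) : y + (t + s, 0) = y + (t, 0) + (s, 0).
  by apply/pair_equal_spec; split; rewrite /=; ring.
have s2 (y : P) (t : R) : y + (0, t + s) = y + (0, t) + (0, s).
  by apply/pair_equal_spec; split; rewrite /=; ring.
have z00 (y : P) : y + (0, 0) = y by rewrite (_ : (0, 0) = 0) ?addr0.
have T1 := @lattice_taylor1 R s s0 (fun t => M (x + (t, 0))) Lf Ld Ld0 _ _ z.1.
have T2 := @lattice_taylor1 R s s0 (fun t => M (x + (z.1, 0) + (0, t))) Lf Ld Ld0 _ _ z.2.
have {}T1 := T1 _ _; have {}T2 := T2 _ _.
rewrite /= !s1 !z00 -/(fdiff1 s M x) in T1.
rewrite /= !s2 !z00 -/(fdiff2 s M (x + (z.1, 0))) in T2.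
have xz : x + (z.1, 0) + (0, z.2) = x + z.
  by apply/pair_equal_spec; split; rewrite /=; ring.
rewrite xz in T2.
have C : `|z.2 * (fdiff2 s M (x + (z.1, 0)) - fdiff2 s M x)| <= pnorm z * (Ld * pnorm z).
  rewrite normrM ler_pM//; first by rewrite le_max lexx orbT.
  rewrite (le_trans (D2L _ _))// ler_wpM2l// addrAC subrr add0r n1.
  by rewrite le_max lexx.
have sq (t : R) : `|t| <= pnorm z -> Ld * t ^+ 2 <= Ld * pnorm z ^+ 2.
  move=> tz; rewrite ler_wpM2l// -(real_normK (num_real t)) ler_pXn2r// ?nnegrE//.
  by exact: pnorm_ge0.
have q1 : Ld * z.1 ^+ 2 <= Ld * pnorm z ^+ 2 by apply: sq; rewrite le_max lexx.
have q2 : Ld * z.2 ^+ 2 <= Ld * pnorm z ^+ 2 by apply: sq; rewrite le_max lexx orbT.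
have {}T1 : `|M (x + (z.1, 0)) - M x - z.1 * fdiff1 s M x| <= 2 * Ld * z.1 ^+ 2 + 2 * Lf * s.
  apply: T1 => t t'; first by rewrite (le_trans (ML _ _))// d1 n1.
  by rewrite !s1; have := D1L (x + (t, 0)) (x + (t', 0)); rewrite d1 n1.
have {}T2 : `|M (x + z) - M (x + (z.1, 0)) - z.2 * fdiff2 s M (x + (z.1, 0))| <=
    2 * Ld * z.2 ^+ 2 + 2 * Lf * s.
  apply: T2 => t t'; first by rewrite (le_trans (ML _ _))// d2 n2.
  by rewrite !s2; have := D2L (x + (z.1, 0) + (0, t)) (x + (z.1, 0) + (0, t')); rewrite d2 n2.
move: T1 T2 C; rewrite !ler_norml => /andP[A1 A2] /andP[B1 B2] /andP[C1 C2].
by apply/andP; split; lra.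
Qed.

(** Both terms are compared with the increment of the average over [sg *: v]. After division by [sg]
    the Taylor error is of order sg / e + s / sg, whence the condition [s <= sg ^+ 2]. *)
Lemma bavg_directional (F G : P -> R) (Lf Lg sg : R) (v : P) : 0 <= Lf -> 0 <= Lg ->
  (forall x y, `|F x - F y| <= Lf * pnorm (x - y)) ->
  (forall x y, `|G x - G y| <= Lg * pnorm (x - y)) ->
  (forall (x : P) (t : R), is_derive t 1 (fun t => F (x + t *: v)) (G (x + t *: v))) ->
  pnorm v <= 1 -> 0 < sg -> s <= sg ^+ 2 ->
  forall x, `|v.1 * fdiff1 s (bavg s r F) x + v.2 * fdiff2 s (bavg s r F) x -
              bavg s r G x| <= (10 * Lf / e + Lg + 4 * Lf) * sg.
Proof.
move=> Lf0 Lg0 FL GL Fd v1 sg0 ssg x.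
have T := bavg_taylor Lf0 FL x (sg *: v).
have A : `|bavg s r F (x + sg *: v) - bavg s r F x - sg * bavg s r G x| <= Lg * sg ^+ 2.
  rewrite bavg_shift -bavgZ -!bavgB -[X in `|X|]subr0.
  apply: (bavg_dist s0 r0) => y _; rewrite subr0.
  have /= [c c01] := MVT_segment (ltW sg0) (fun t _ => Fd y t)
    (is_derive_within (fun t _ => Fd y t)).
  rewrite scale0r addr0 subr0 => ->; rewrite mulrC -mulrBr normrM (gtr0_norm sg0).
  rewrite expr2 mulrCA ler_pM2l// (le_trans (GL _ _))// ler_wpM2l//.
  rewrite addrAC subrr add0r pnormZ.
  have /andP[c0 c1] : 0 <= c <= sg by move: c01; rewrite in_itv.
  by rewrite ger0_norm// (le_trans _ c1)// ler_piMr.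
rewrite -(ler_pM2l sg0) -[X in X * `|_|](gtr0_norm sg0) -normrM.
have vn : pnorm (sg *: v) ^+ 2 <= sg ^+ 2.
  rewrite ler_pXn2r// ?nnegrE ?pnorm_ge0 ?(ltW sg0)// pnormZ gtr0_norm//.
  by rewrite ler_piMr// ltW.
have Ld0 : 0 <= 2 * Lf / e.
  by apply: mulr_ge0; [exact: mulr_ge0|rewrite invr_ge0 ltW].
have k1 := ler_wpM2l Ld0 vn; have k2 := ler_wpM2l Lf0 ssg.
have -> : 10 * Lf / e = 5 * (2 * Lf / e) by ring.
move: T A; rewrite /= /GRing.scale/= !ler_norml => /andP[T1 T2] /andP[A1 A2].
set D1 := fdiff1 _ _ _ in T1 T2 *; set D2 := fdiff2 _ _ _ in T1 T2 *.
by move: (2 * Lf / e) Ld0 k1 T1 T2 => Ld *; apply/andP; split; nra.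
Qed.

End DirectionalAverage.

(** * Energy estimates *)

Section NsqExtra.
Variables (R : realType) (I : finType).

Lemma nsq_close (y z : I -> R) (C : R) : 0 <= C -> (forall i, `|y i - z i| <= C) ->
  nsq y <= 2 * nsq z + 2 * #|I|%:R * C ^+ 2.
Proof.
move=> C0 yz.
have H := nsqD z (fun i => y i - z i); have H' := le_nsq yz.
have -> : nsq y = nsq (fun i => z i + (y i - z i)).
  by congr nsq; apply/funext => i; rewrite addrC subrK.
by move: H H'; move: (nsq _) (nsq _) (nsq _) => *; lra.
Qed.

Lemma norm_le_sqr (x C k : R) : 0 <= C -> 0 <= k -> x ^+ 2 <= C * k ^+ 2 ->
  `|x| <= (C + 1) * k.
Proof.
move=> C0 k0 H; rewrite -(@ler_pXn2r _ 2)// ?nnegrE ?mulr_ge0 ?addr_ge0//.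
rewrite real_normK ?num_real// (le_trans H)// exprMn ler_wpM2r ?sqr_ge0//.
by nra.
Qed.

End NsqExtra.

Section EnergyArithmetic.
Variable R : realType.
Implicit Types (al N Lu C Lg Lk t hh V k : R).

Lemma energy_arith1 al N Lu C Lk t hh V k (P1 P2 P4 P5 : R) :
  al * N * P1 <= al * N * (4096 * Lu ^+ 2 * t * hh * V) ->
  al * P2 <= al * (768 * C * t * hh * V) ->
  N * k * V <= N * (Lk ^+ 2 * t * hh) * V ->
  P4 <= 256 * N * Lu ^+ 2 * t * hh * V -> P5 <= 4 * N * Lu ^+ 2 * t * hh * V ->
  20 * (4 * al * N * P1 + 4 * al * P2 + 8 * N * k * V + P4 + P5) <=
  20 * (16384 * al * N * Lu ^+ 2 + 3072 * al * C + 8 * N * Lk ^+ 2 + 260 * N * Lu ^+ 2) * t * V * hh.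
Proof. by move=> *; lra. Qed.

Lemma energy_arith2 al N Lu Lg Lk t V (Q1 P1 Q2 : R) :
  N * Q1 * V <= N * ((Lg + Lk) ^+ 2 * t) * V ->
  al * N * P1 <= al * N * (16 * Lu ^+ 2 * t * V) ->
  al * N * Q2 * V <= al * N * (Lu ^+ 2 * t) * V ->
  4 * N * Q1 * V + 2 * al * (2 * N * P1 + 2 * N * Q2 * V) <=
  (4 * N * (Lg + Lk) ^+ 2 + 68 * al * N * Lu ^+ 2) * t * V.
Proof. by move=> *; lra. Qed.

End EnergyArithmetic.

Section Energy.
Variables (R : realType) (I : finType).
Local Notation P := (R * R)%type.
Variables (a : P -> I -> I -> R) (f : P -> I -> R) (u : R -> P -> I -> R).
Variables (A0 L C rad : R).
Hypotheses (A00 : 0 <= A0) (L0 : 0 <= L) (C0 : 0 <= C).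
Hypotheses (rad0 : 0 < rad) (rad1 : rad <= 4^-1).
Hypothesis aA : forall x i j, `|a x i j| <= A0.
Hypothesis aL : forall x y i j, `|a x i j - a y i j| <= L * pnorm (x - y).
Hypothesis fL : forall x y i, `|f x i - f y i| <= L * pnorm (x - y).
Hypothesis ud : forall (th : R) (x : P) (t : R) i,
  is_derive t 1 (fun s => u th (x + s *: dir th) i)
    (mv (a (x + t *: dir th)) (u th (x + t *: dir th)) i + f (x + t *: dir th) i).
Hypothesis u0 : forall th (x : P) i, rad < pnorm x -> u th x i = 0.
Hypothesis uC : forall th x, nsq (u th x) <= C.
Hypothesis uL : forall th th' x x' k,
  8 * pnorm (dir th' - dir th) + pnorm (x' - x) <= k ->
  nsq (fun i => u th' x' i - u th x i) <= C * k ^+ 2.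
Hypothesis uper : forall th, u (th + 2 * pi) = u th.
Hypothesis small : 512 * (#|I|%:R * A0) ^+ 2 * rad ^+ 2 <= 1.

Let N : R := #|I|%:R.
Let N0 : 0 <= N. Proof. exact: ler0n. Qed.
Let al := (N * A0) ^+ 2.
Let al0 : 0 <= al. Proof. exact: sqr_ge0. Qed.
Let Lu := C + 1.
Let Lu0 : 0 <= Lu. Proof. by rewrite addr_ge0. Qed.

Lemma u_lip1 th x x' i : `|u th x i - u th x' i| <= Lu * pnorm (x - x').
Proof.
apply: norm_le_sqr => //; first exact: pnorm_ge0.
have H := @uL th th x' x (pnorm (x - x')).
apply: le_trans (sqr_le_nsq _ i) (H _).
by rewrite subrr pnorm0 mulr0 add0r.
Qed.

Definition source th (x : P) i := mv (a x) (u th x) i + f x i.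

Let Lg := 2 * (N * L) ^+ 2 * C + 2 * al * C + 1 + L.
Let Lg0 : 0 <= Lg.
Proof.
have := mulr_ge0 (sqr_ge0 (N * L)) C0; have := mulr_ge0 al0 C0.
by have := L0; rewrite /Lg; lra.
Qed.

Lemma source_lip th x x' i : `|source th x i - source th x' i| <= Lg * pnorm (x - x').
Proof.
have Q0 : 0 <= 2 * (N * L) ^+ 2 * C + 2 * al * C.
  by have := mulr_ge0 (sqr_ge0 (N * L)) C0; have := mulr_ge0 al0 C0; lra.
have p0 := pnorm_ge0 (x - x').
have A : `|mv (a x) (u th x) i - mv (a x') (u th x') i| <=
    (2 * (N * L) ^+ 2 * C + 2 * al * C + 1) * pnorm (x - x').
  apply: norm_le_sqr => //.
  pose z j := mv (a x) (u th x) j - mv (a x') (u th x') j.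
  have H1 := nsqD (mv (fun i j => a x i j - a x' i j) (u th x))
     (mv (a x') (fun i => u th x i - u th x' i)).
  have H2 : nsq (mv (fun i j => a x i j - a x' i j) (u th x)) <=
      (N * (L * pnorm (x - x'))) ^+ 2 * C.
    rewrite (le_trans (nsq_mv _ (fun i j => aL x x' i j)))//.
    by rewrite ler_wpM2l ?sqr_ge0.
  have H3 : nsq (mv (a x') (fun i => u th x i - u th x' i)) <= al * (C * pnorm (x - x') ^+ 2).
    rewrite (le_trans (nsq_mv _ (aA x')))// ler_wpM2l ?sqr_ge0// uL//.
    by rewrite subrr pnorm0 mulr0 add0r.
  have zE : nsq z = nsq (fun i => mv (fun i j => a x i j - a x' i j) (u th x) i +
     mv (a x') (fun i => u th x i - u th x' i) i).
    by congr nsq; apply/funext => j; rewrite /z mvBl mvB; ring.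
  have := sqr_le_nsq z i; rewrite zE.
  move: H1 H2 H3; move: (nsq _) (nsq _) (nsq _) (pnorm _) => X1 X2 X3 p *.
  rewrite -/(z i); lra.
have B := fL x x' i; rewrite /source /Lg.
rewrite (_ : _ - _ = (mv (a x) (u th x) i - mv (a x') (u th x') i) + (f x i - f x' i)); last by ring.
have := ler_normD (mv (a x) (u th x) i - mv (a x') (u th x') i) (f x i - f x' i).
by move: A B; move: (pnorm _) => *; lra.
Qed.

Variables (s h sg e0 eps0 : R) (B r M J : nat).
Hypotheses (s0 : 0 < s) (r0 : (0 < r)%N) (M0 : (0 < M)%N).
Let e := s * r%:R.
Hypotheses (e_rad : e <= rad / 2) (sB : 50 <= s * B%:R).
Hypotheses (h0 : 0 < h) (h1 : h <= 1) (Mh : M%:R * h = 2 * pi).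
Hypotheses (sg0 : 0 < sg) (sg1 : sg <= 1) (ssg : s <= sg ^+ 2).
Hypothesis e00 : 0 <= e0.

Let U (k : nat) x i := u (k%:R * h) x i.
Let W (k : nat) x i := U k.+1 x i - U k x i.
Let MU k i := bavg s r (fun y => U k y i).
Let D1 k x i := fdiff1 s (MU k i) x.
Let D2 k x i := fdiff2 s (MU k i) x.
Let G k x i := cos (k%:R * h) * D1 k x i + sin (k%:R * h) * D2 k x i.
Let m (k : nat) := k%:R * h + h / 2.
(** [X] and [Y] are the discrete derivatives of the averaged angular difference [W], along and
    across the direction bisecting the [k]-th and the next one. *)
Let X k x i := cos (m k) * (D1 k.+1 x i - D1 k x i) + sin (m k) * (D2 k.+1 x i - D2 k x i).
Let Y k x i := cos (m k) * (D2 k.+1 x i - D2 k x i) - sin (m k) * (D1 k.+1 x i - D1 k x i).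
Let S := lsum s B.
Let Vol : R := S (fun=> 1).

Let ee0 : 0 < e. Proof. by rewrite mulr_gt0// ltr0n. Qed.

Lemma Vol_ge0 : 0 <= Vol. Proof. by apply: lsum_ge0. Qed.

Lemma lsum_le_cst F (c : R) : (forall x, F x <= c) -> S F <= c * Vol.
Proof.
move=> Fc; rewrite /Vol /S -lsumZ; apply: ler_lsum => x; by rewrite mulr1.
Qed.

Lemma pestov_lsum :
  \sum_(k < M) S (fun x => nsq (fun i => G k.+1 x i - G k x i)) =
  \sum_(k < M) (cos (h / 2) ^+ 2 * S (fun x => nsq (X k x))
    - sin (h / 2) ^+ 2 * S (fun x => nsq (Y k x))
    + 4 * sin (h / 2) ^+ 2 * S (fun x => nsq (G k x))
    + sin h * S (fun x => \sum_i (D1 k.+1 x i * D2 k x i - D2 k.+1 x i * D1 k x i))).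
Proof.
have UM : U M = U 0%N.
  apply/funext => x; apply/funext => i.
  by rewrite /U mul0r Mh -[2 * pi]add0r uper.
have cM : cos (M%:R * h) = 1 by rewrite Mh mulrC mulr_natr cos2pi.
have sM : sin (M%:R * h) = 0 by rewrite Mh mulrC mulr_natr sin2pi.
transitivity (S (fun x => \sum_i \sum_(k < M) (G k.+1 x i - G k x i) ^+ 2)).
  by rewrite /S -lsum_sum; apply: eq_lsum => x; rewrite /nsq exchange_big.
transitivity (S (fun x => \sum_(k < M) (cos (h / 2) ^+ 2 * nsq (X k x)
    - sin (h / 2) ^+ 2 * nsq (Y k x)
    + 4 * sin (h / 2) ^+ 2 * nsq (G k x)
    + sin h * \sum_i (D1 k.+1 x i * D2 k x i - D2 k.+1 x i * D1 k x i)))); last first.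
  by rewrite /S lsum_sum; apply: eq_bigr => k _; rewrite -!lsumZ -lsumB -!lsumD.
apply: eq_lsum => x.
have H i := @pestov R M h (fun k => D1 k x i) (fun k => D2 k x i) _ _ cM sM.
under eq_bigr => i _.
  rewrite H; [|by rewrite /D1 /MU UM|by rewrite /D2 /MU UM]; over.
rewrite exchange_big/=; apply: eq_bigr => k _.
by rewrite /nsq !mulr_sumr -sumrB -!big_split/=; apply: eq_bigr => i _.
Qed.

Let kap := (10 * Lu / e + Lg + 4 * Lu) * sg.
Lemma kap_ge0 : 0 <= kap.
Proof.
have H : 0 <= 10 * Lu / e by apply: divr_ge0 (ltW ee0); exact: mulr_ge0.
by apply: mulr_ge0 (ltW sg0); have := Lu0; have := Lg0; lra.
Qed.

Lemma G_close k x i : `|G k x i - bavg s r (fun y => source (k%:R * h) y i) x| <= kap.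
Proof.
exact: (@bavg_directional R s r s0 r0 (fun y => U k y i) _ Lu Lg sg (dir (k%:R * h))
  Lu0 Lg0 (fun y z => u_lip1 _ y z i) (fun y z => source_lip _ y z i)
  (fun y t => ud _ y t i) (dir_le1 _) sg0 ssg x).
Qed.

Let Wb := 8 * Lu * h.

Lemma dir_h k : pnorm (dir (k.+1%:R * h) - dir (k%:R * h)) <= h.
Proof.
rewrite (le_trans (dir_lip _ _))// -natr1 mulrDl mul1r addrAC subrr add0r.
by rewrite gtr0_norm.
Qed.

Lemma W_le k x i : `|W k x i| <= Wb.
Proof.
rewrite /Wb (_ : 8 * Lu * h = Lu * (8 * h)); last by ring.
apply: norm_le_sqr; rewrite ?mulr_ge0 ?(ltW h0)//.
apply: (le_trans (sqr_le_nsq (W k x) i)); apply: uL.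
by rewrite subrr pnorm0 addr0 ler_pM2l// dir_h.
Qed.

Lemma DW1 k x i : D1 k.+1 x i - D1 k x i = fdiff1 s (bavg s r (fun y => W k y i)) x.
Proof. by rewrite /D1 /MU /W /fdiff1 !bavgB; ring. Qed.

Lemma DW2 k x i : D2 k.+1 x i - D2 k x i = fdiff2 s (bavg s r (fun y => W k y i)) x.
Proof. by rewrite /D2 /MU /W /fdiff2 !bavgB; ring. Qed.

Lemma U0 k x i : rad < pnorm x -> U k x i = 0. Proof. exact: u0. Qed.

Lemma W0 k x i : rad < pnorm x -> W k x i = 0.
Proof. by move=> H; rewrite /W !U0// subrr. Qed.

Lemma bavg_supp (F : P -> R) : (forall y, rad < pnorm y -> F y = 0) ->
  forall x, 2 * rad <= pnorm x -> bavg s r F x = 0.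
Proof.
move=> F0 x xr; apply: bavg_eq0 => // y yx; apply: F0.
have := pnorm_shift_ge x (y - x); rewrite [x + _]addrC subrK.
by move: e_rad; rewrite /e; have := rad0; lra.
Qed.

(** The Poincare constant 16 (2 rad)^2: blocks of side at most rad / 2 enlarge the support to radius
    2 rad at most. *)
Let Psm := 64 * rad ^+ 2.
Let Perr (w : R) := 16 * s * w ^+ 2 * Vol.

Lemma poincare_bavg (F : P -> R) (c d w : R) : c ^+ 2 + d ^+ 2 = 1 ->
  (forall y, rad < pnorm y -> F y = 0) ->
  (forall x, `|fdiff1 s (bavg s r F) x| <= w /\ `|fdiff2 s (bavg s r F) x| <= w) ->
  S (fun x => bavg s r F x ^+ 2) <=
  Psm * S (fun x => (c * fdiff1 s (bavg s r F) x + d * fdiff2 s (bavg s r F) x) ^+ 2) + Perr w.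
Proof.
move=> cd F0 Fw.
have rr : 2 * rad <= s * B%:R by have := sB; have := rad1; lra.
have r2 : 0 <= 2 * rad by have := rad0; lra.
have := poincare s0 r2 rr cd (bavg_supp F0).
rewrite -/S; set Q := S (fun x => (_ + _) ^+ 2); set T := S (fun x => _ ^+ 2 + _ ^+ 2).
have TV : T <= 2 * w ^+ 2 * Vol.
  apply: lsum_le_cst => x; have [w1 w2] := Fw x.
  have w0 : 0 <= w by apply: le_trans w1.
  have sq (t : R) : `|t| <= w -> t ^+ 2 <= w ^+ 2.
    by move=> tw; rewrite -(real_normK (num_real t)) ler_pXn2r// nnegrE.
  by have := sq _ w1; have := sq _ w2; lra.
have s1 : s <= 1 by rewrite (le_trans ssg)// exprn_ile1// ltW.
have T0 : 0 <= T by apply: lsum_ge0 => x; rewrite addr_ge0 ?sqr_ge0.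
rewrite /Psm /Perr => H; apply: (le_trans H).
have -> : 16 * (2 * rad) ^+ 2 = 64 * rad ^+ 2 by ring.
rewrite lerD2l.
have b : 4 * s * (2 * rad + s) <= 8 * s by have := s0; have := rad1; nra.
have := ler_wpM2r T0 b; have : 8 * s * T <= 8 * s * (2 * w ^+ 2 * Vol).
  by rewrite ler_wpM2l// mulr_ge0// ltW.
lra.
Qed.

(** The bound [W_le] alone makes the left side of order h^2 Vol. This is not enough, because the
    energy is divided by h^2 in the end; [eps0] has to be small compared with [Vol]. *)
Hypothesis Wdiff : forall k, (k < M)%N ->
  S (fun x => nsq (fun i => W k x i - bavg s r (fun y => W k y i) x)) <=
  C * (8 * h) ^+ 2 * eps0.

(** As [f] is common to all directions, the angular difference of [source] is [mv (a y) (W k y)].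
    The bound passes from [G] to [W] by [G_close], from [W] to its average by [Wdiff], and from
    there to [X] by Poincare along the bisecting direction. *)
Lemma GG_le k : (k < M)%N ->
  S (fun x => nsq (fun i => G k.+1 x i - G k x i)) <=
  2 * al * (2 * Psm * S (fun x => nsq (X k x)) + 2 * N * Perr (2 * Wb / e)
     + 2 * (C * (8 * h) ^+ 2 * eps0)) + 8 * N * kap ^+ 2 * Vol.
Proof.
move=> kM; pose mW k y := mv (a y) (W k y).
have k0 := kap_ge0.
have close x i : `|(G k.+1 x i - G k x i) - bavg s r (fun y => mW k y i) x| <= 2 * kap.
  have := G_close k.+1 x i; have := G_close k x i.
  set b1 := bavg _ _ _ _; set b2 := bavg _ _ _ _ => H1 H2.
  have -> : bavg s r (fun y => mW k y i) x = b2 - b1.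
    rewrite /b2 /b1 -bavgB; congr bavg; apply/funext => y.
    by rewrite /mW /source /W mvB; ring.
  rewrite (_ : _ - _ - _ = (G k.+1 x i - b2) - (G k x i - b1)); last by ring.
  have := ler_normB (G k.+1 x i - b2) (G k x i - b1); lra.
have step1 : S (fun x => nsq (fun i => G k.+1 x i - G k x i)) <=
    2 * S (fun x => nsq (fun i => bavg s r (fun y => mW k y i) x)) + 8 * N * kap ^+ 2 * Vol.
  have -> : 8 * N * kap ^+ 2 * Vol = S (fun=> 8 * N * kap ^+ 2).
    by rewrite /Vol /S -lsumZ; apply: eq_lsum => x; rewrite mulr1.
  rewrite /S -lsumZ -lsumD; apply: ler_lsum => x.
  have k2 : 0 <= 2 * kap by lra.
  have := nsq_close k2 (close x); rewrite -/N.
  by rewrite exprMn => H; rewrite (le_trans H)// lerD2l; lra.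
(* Jensen for the block average; averaging then preserves the lattice sum. *)
have step2 : S (fun x => nsq (fun i => bavg s r (fun y => mW k y i) x)) <=
    al * S (fun x => nsq (W k x)).
  have nsqW x : 1 <= pnorm x -> nsq (W k x) = 0.
    move=> x1; rewrite (_ : W k x = fun=> 0) ?nsq_cst0//.
    by apply/funext => i; rewrite W0//; have := rad1; lra.
  rewrite -[X in al * X](@lsum_bavg R s r s0 r0 B _ 1 nsqW); last first.
    by move: e_rad sB rad1; rewrite /e => *; lra.
  rewrite /S -lsumZ; apply: ler_lsum => x; rewrite -bavgZ.
  rewrite /nsq.
  apply: (@le_trans _ _ (\sum_i bavg s r (fun y => mW k y i ^+ 2) x)).
    by apply: ler_sum => i _; exact: sqr_bavg.
  rewrite -bavg_sum; apply: bavg_le => // p q pr qr.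
  exact: nsq_mv.
have step3 : S (fun x => nsq (W k x)) <=
    2 * S (fun x => nsq (fun i => bavg s r (fun y => W k y i) x)) +
    2 * S (fun x => nsq (fun i => W k x i - bavg s r (fun y => W k y i) x)).
  rewrite /S -!lsumZ -lsumD; apply: ler_lsum => x.
  have H := nsqD (fun i => bavg s r (fun y => W k y i) x)
    (fun i => W k x i - bavg s r (fun y => W k y i) x).
  rewrite (le_trans _ H)// le_eqVlt; apply/orP; left; apply/eqP; congr nsq.
  by apply/funext => i; rewrite addrC subrK.
have step4 : S (fun x => nsq (fun i => bavg s r (fun y => W k y i) x)) <=
    Psm * S (fun x => nsq (X k x)) + N * Perr (2 * Wb / e).
  rewrite /S /nsq !lsum_sum mulr_sumr.
  have -> : N * Perr (2 * Wb / e) = \sum_(i : I) Perr (2 * Wb / e).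
    by rewrite sumr_const -[RHS]mulr_natl.
  rewrite -big_split/=; apply: ler_sum => i _.
  have H := @poincare_bavg (fun y => W k y i) (cos (m k)) (sin (m k)) (2 * Wb / e)
    (cos2Dsin2 _) (fun y => @W0 k y i) (fun x => fdiff_bavg_le s0 r0 x (fun y => W_le k y i)).
  apply: (le_trans H); rewrite lerD2r le_eqVlt; apply/orP; left; apply/eqP.
  by congr (_ * _); apply: eq_lsum => x; rewrite /X DW1 DW2.
have Wk := Wdiff kM.
have al2 : 0 <= 2 * al by rewrite mulr_ge0.
apply: (le_trans step1); rewrite lerD2r -mulrA.
rewrite ler_wpM2l//; apply: (le_trans step2); apply: ler_wpM2l => //.
by move: step3 step4 Wk; move: (S _) (S _) (S _) (S _) => *; lra.
Qed.

Let Err := 4 * al * N * Perr (2 * Wb / e) + 4 * al * (C * (8 * h) ^+ 2 * eps0)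
  + 8 * N * kap ^+ 2 * Vol + sin (h / 2) ^+ 2 * (N * (4 * Wb / e) ^+ 2 * Vol)
  + N * (4 * Lu ^+ 2 / e * s) * Vol.

Lemma D_le k x i : `|D1 k x i| <= Lu /\ `|D2 k x i| <= Lu.
Proof.
have H := bavg_lip s0 r0 (fun y z => u_lip1 (k%:R * h) y z i).
split; rewrite normrM normfV (gtr0_norm s0) ler_pdivrMr// (le_trans (H _ _))//.
  by rewrite addrAC subrr add0r pnorm_e1// ltW.
by rewrite addrAC subrr add0r pnorm_e2// ltW.
Qed.

(** In the continuum this Jacobian has integral zero. On the lattice the defect is [s] times a sum
    containing a mixed second difference, and averaging bounds the latter by 2 Lu / e. *)
Lemma sym_le k : `|S (fun x => \sum_i (D1 k.+1 x i * D2 k x i - D2 k.+1 x i * D1 k x i))|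
  <= N * (4 * Lu ^+ 2 / e * s) * Vol.
Proof.
rewrite /S lsum_sum (le_trans (ler_norm_sum _ _ _))//.
apply: (@le_trans _ _ (\sum_(i : I) 4 * Lu ^+ 2 / e * s * Vol)); last first.
  by rewrite sumr_const -[_ *+ _]mulr_natl -/N !mulrA.
apply: ler_sum => i _.
have supp k' y : s * B%:R <= pnorm y -> MU k' i y = 0.
  move=> H; apply: (bavg_supp (F := fun y => U k' y i)) => [z|]; first exact: U0.
  by have := sB; have := rad1; lra.
have E := @lsum_fdiff_sym R s B (MU k.+1 i) (MU k i) s0 _ _ _.
rewrite [X in `|X|]E; [|move=> y /(supp k) ->; rewrite mulr0//..].
rewrite normrM (gtr0_norm s0) mulrC.
have b x : `|fdiff1 s (fdiff2 s (MU k.+1 i)) x * (fdiff1 s (MU k i) x - fdiff2 s (MU k i) x)| <=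
   4 * Lu ^+ 2 / e.
  rewrite normrM; have [d1 d2] := D_le k x i.
  have d3 := ler_normB (fdiff1 s (MU k i) x) (fdiff2 s (MU k i) x).
  have d4 : `|fdiff1 s (fdiff2 s (MU k.+1 i)) x| <= 2 * Lu / e.
    rewrite normrM normfV (gtr0_norm s0) ler_pdivrMr//.
    have := fdiff2_bavg_lip s0 r0 (fun y z => u_lip1 (k.+1%:R * h) y z i) (x + (s, 0)) x.
    by rewrite addrAC subrr add0r pnorm_e1// ltW.
  have -> : 4 * Lu ^+ 2 / e = (2 * Lu / e) * (2 * Lu) by ring.
  by apply: ler_pM => //; apply: (le_trans d3); move: d1 d2; rewrite /D1 /D2; lra.
have H : `|S (fun x => fdiff1 s (fdiff2 s (MU k.+1 i)) x *
    (fdiff1 s (MU k i) x - fdiff2 s (MU k i) x))| <= 4 * Lu ^+ 2 / e * Vol.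
  rewrite ler_norml; apply/andP; split; last first.
    by apply: lsum_le_cst => x; have := b x; rewrite ler_norml => /andP[].
  rewrite lerNl -mulN1r /S -lsumZ; apply: lsum_le_cst => x.
  by have := b x; rewrite ler_norml => /andP[+ _]; rewrite mulN1r lerNl.
rewrite [leRHS](_ : _ = 4 * Lu ^+ 2 / e * Vol * s); last by ring.
by rewrite ler_wpM2r// ltW.
Qed.

(** By [GG_le] the left side of the Pestov identity contains 4 al Psm = 256 al rad^2 times the sum
    for [X]. This is at most 1/2 by [small], while cos(h/2)^2 >= 1/2, so the [X] terms are absorbed
    and the positive [G] term survives. *)
Lemma sum_energy :
  4 * sin (h / 2) ^+ 2 * \sum_(k < M) S (fun x => nsq (G k x)) <= M%:R * Err.
Proof.
have S2 : 0 <= sin (h / 2) ^+ 2 by exact: sqr_ge0.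
have h20 : 0 < h / 2 by rewrite divr_gt0.
have c2 : 2^-1 <= cos (h / 2) ^+ 2.
  have := cos2Dsin2 (h / 2); have sl : sin (h / 2) ^+ 2 <= 2^-1; last by lra.
  have := @dir_lip R 0 (h / 2); rewrite subr0 gtr0_norm// => dh.
  have : `|sin (h / 2)| <= h / 2.
    by rewrite (le_trans _ dh)// le_max /= sin0 subr0 lexx orbT.
  move=> sh; rewrite -(real_normK (num_real (sin (h / 2)))).
  have := normr_ge0 (sin (h / 2)); move: h1; nra.
have per (k : 'I_M) : S (fun x => nsq (fun i => G k.+1 x i - G k x i)) -
    (cos (h / 2) ^+ 2 * S (fun x => nsq (X k x))
    - sin (h / 2) ^+ 2 * S (fun x => nsq (Y k x))
    + sin h * S (fun x => \sum_i (D1 k.+1 x i * D2 k x i - D2 k.+1 x i * D1 k x i))) <= Err.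
  have x0 : 0 <= S (fun x => nsq (X k x)) by apply: lsum_ge0 => x; exact: nsq_ge0.
  have yV : S (fun x => nsq (Y k x)) <= N * (4 * Wb / e) ^+ 2 * Vol.
    apply: lsum_le_cst => x; apply: le_nsq => i.
    rewrite /Y DW1 DW2.
    have [w1 w2] := fdiff_bavg_le s0 r0 x (fun y => W_le k y i).
    have c1 : `|cos (m k)| <= 1 by rewrite ler_norml cos_geN1 cos_le1.
    have s1 : `|sin (m k)| <= 1 by rewrite ler_norml sin_geN1 sin_le1.
    have q1 := ler_pM (normr_ge0 _) (normr_ge0 _) c1 w2.
    have q2 := ler_pM (normr_ge0 _) (normr_ge0 _) s1 w1.
    have q3 := ler_normB (cos (m k) * fdiff2 s (bavg s r (fun y => W k y i)) x)
      (sin (m k) * fdiff1 s (bavg s r (fun y => W k y i)) x).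
    rewrite (normrM (cos _)) (normrM (sin _)) in q3; rewrite -/e in q1 q2; move: q1 q2 q3.
    have -> : 4 * Wb / e = 2 * (2 * Wb / e) by ring.
    lra.
  have t1 : - (sin h * S (fun x => \sum_i (D1 k.+1 x i * D2 k x i - D2 k.+1 x i * D1 k x i))) <=
      N * (4 * Lu ^+ 2 / e * s) * Vol.
    rewrite (le_trans (ler_norm _))// normrN normrM (le_trans _ (sym_le k))//.
    by rewrite ler_piMl// ler_norml sin_geN1 sin_le1.
  have := ler_wpM2l S2 yV.
  have xx : 4 * al * Psm * S (fun x => nsq (X k x)) <= cos (h / 2) ^+ 2 * S (fun x => nsq (X k x)).
    rewrite ler_wpM2r// (le_trans _ c2)// /Psm.
    by move: small; rewrite -/N -/al; lra.
  have := GG_le (ltn_ord k); rewrite /Err.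
  move: (S _) (S _) (S _) (S _) x0 yV t1 xx => *; lra.
have E := pestov_lsum.
have -> : 4 * sin (h / 2) ^+ 2 * \sum_(k < M) S (fun x => nsq (G k x)) =
    \sum_(k < M) (S (fun x => nsq (fun i => G k.+1 x i - G k x i)) -
    (cos (h / 2) ^+ 2 * S (fun x => nsq (X k x))
    - sin (h / 2) ^+ 2 * S (fun x => nsq (Y k x))
    + sin h * S (fun x => \sum_i (D1 k.+1 x i * D2 k x i - D2 k.+1 x i * D1 k x i)))).
  rewrite sumrB {}E -sumrB mulr_sumr; apply: eq_bigr => k _; ring.
rewrite (le_trans (ler_sum _ (fun k _ => per k)))// sumr_const card_ord.
by rewrite mulr_natl.
Qed.

Let Err2 := 4 * N * (Lg * e + kap) ^+ 2 * Vol + 2 * al * (2 * N * Perr Lu + 2 * N * (Lu * e) ^+ 2 * Vol).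

(** Since [f] is [source] minus [a u], it is controlled by [G] and by [u], and [u] in turn by [G]
    through Poincare along the [k]-th direction; 4 al Psm <= 1 makes up the factor 5. *)
Lemma source_le k : S (fun x => nsq (f x)) <= 5 * S (fun x => nsq (G k x)) + Err2.
Proof.
pose src (x : P) i := source (k%:R * h) x i.
have kk := kap_ge0.
have Le0 : 0 <= Lg * e + kap by rewrite addr_ge0 ?(mulr_ge0 Lg0) ?(ltW ee0).
have p1 x : nsq (f x) <= 2 * nsq (src x) + 2 * al * nsq (U k x).
  have H := nsqB (src x) (mv (a x) (U k x)).
  have -> : nsq (f x) = nsq (fun i => src x i - mv (a x) (U k x) i).
    by congr nsq; apply/funext => i; rewrite /src /source /U addrC addKr.
  have := nsq_mv (U k x) (aA x); rewrite -/N -/al.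
  by move: H; move: (nsq _) (nsq _) (nsq _) (nsq _) => *; lra.
have p2 x : nsq (src x) <= 2 * nsq (G k x) + 2 * N * (Lg * e + kap) ^+ 2.
  apply: nsq_close => // i; rewrite distrC.
  have H1 := G_close k x i.
  have H2 : `|bavg s r (fun y => source (k%:R * h) y i) x - src x i| <= Lg * e.
    apply: bavg_dist => // y yx; rewrite (le_trans (source_lip _ _ _ _))//.
    by rewrite ler_wpM2l.
  have := ler_normD (G k x i - bavg s r (fun y => source (k%:R * h) y i) x)
    (bavg s r (fun y => source (k%:R * h) y i) x - src x i).
  rewrite addrA subrK; lra.
have p3 x : nsq (U k x) <= 2 * nsq (fun i => MU k i x) + 2 * N * (Lu * e) ^+ 2.
  apply: nsq_close => [|i]; first by rewrite (mulr_ge0 Lu0) ?(ltW ee0).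
  rewrite distrC; apply: bavg_dist => // y yx; rewrite (le_trans (u_lip1 _ _ _ _))//.
  by rewrite ler_wpM2l.
have p4 : S (fun x => nsq (fun i => MU k i x)) <= Psm * S (fun x => nsq (G k x)) + N * Perr Lu.
  rewrite /S /nsq !lsum_sum mulr_sumr.
  have -> : N * Perr Lu = \sum_(i : I) Perr Lu.
    by rewrite sumr_const -[RHS]mulr_natl.
  rewrite -big_split/=; apply: ler_sum => i _.
  apply: poincare_bavg; first exact: cos2Dsin2.
    by move=> y; exact: U0.
  by move=> x; exact: D_le.
have g0 : 0 <= S (fun x => nsq (G k x)) by apply: lsum_ge0 => x; exact: nsq_ge0.
have p5 : S (fun x => nsq (f x)) <= 4 * S (fun x => nsq (G k x)) +
   4 * al * S (fun x => nsq (fun i => MU k i x)) +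
   (4 * N * (Lg * e + kap) ^+ 2 + 4 * al * N * (Lu * e) ^+ 2) * Vol.
  rewrite /Vol /S -!lsumZ -!lsumD; apply: ler_lsum => x; rewrite mulr1.
  have := ler_wpM2l al0 (p3 x); have := p1 x; have := p2 x.
  move: (nsq _) (nsq _) (nsq _) (nsq _) (nsq _) => *; lra.
have sm : 4 * al * Psm <= 1 by move: small; rewrite /Psm -/N -/al; have := mulr_ge0 al0 (sqr_ge0 rad); lra.
have := ler_wpM2r g0 sm; have := ler_wpM2l al0 p4.
move: p5; rewrite /Err2; move: (S _) (S _) (S _) g0 => *; lra.
Qed.

Lemma energy : S (fun x => nsq (f x)) <= 20 * Err / h ^+ 2 + Err2.
Proof.
(* By the mean value theorem sin(h/2) = cos(c) h/2 with c <= 1/2, and then cos(c) >= 1/2. *)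
have sg2 : h ^+ 2 / 4 <= 4 * sin (h / 2) ^+ 2.
  have h20 : 0 <= h / 2 by rewrite divr_ge0// ltW.
  have [c c0h] := MVT_segment h20 (fun x _ => is_derive_sin x)
    (continuous_subspaceT (@continuous_sin R)).
  have /andP[cge0 clt] : 0 <= c <= h / 2 by move: c0h; rewrite in_itv.
  rewrite sin0 !subr0 => ->.
  have hle := h1; have p2 := @pihalf_ge1 R.
  have cpos : 0 < cos c by apply: cos_gt0_pihalf; move: (pi / 2) p2 => q q1; apply/andP; split; lra.
  have sc : `|sin c| <= c.
    have := @dir_lip R 0 c; rewrite subr0 (ger0_norm cge0); apply: le_trans.
    by rewrite le_max /= sin0 subr0 lexx orbT.
  have := cos2Dsin2 c; rewrite -(real_normK (num_real (sin c))).
  have sc0 := normr_ge0 (sin c); have hp := h0.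
  move: (cos c) (`|sin c|) cpos sc sc0 => x y x0 yc y0 xy.
  have : 2^-1 <= x by nra.
  move=> x2; have x4 : 4^-1 <= x ^+ 2 by nra.
  by have := ler_wpM2r (sqr_ge0 h) x4; lra.
have A := sum_energy.
have B1 : M%:R * (S (fun x => nsq (f x)) - Err2) <= 5 * \sum_(k < M) S (fun x => nsq (G k x)).
  rewrite -[M in M%:R]card_ord mulr_natl -sumr_const mulr_sumr; apply: ler_sum => k _.
  by have := source_le k; lra.
have S2 := sqr_ge0 (sin (h / 2)).
have Mp : 0 < M%:R :> R by rewrite ltr0n.
have h2 : 0 < h ^+ 2 by rewrite exprn_gt0.
have C1 : 4 * sin (h / 2) ^+ 2 * (S (fun x => nsq (f x)) - Err2) <= 5 * Err.
  rewrite -(ler_pM2l Mp).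
  have := ler_wpM2l S2 B1; move: A; move: (S _) (\sum_(_ < _) _) => *; lra.
rewrite -lerBlDr; have [neg|pos] := leP (S (fun x => nsq (f x)) - Err2) 0.
  apply: (le_trans neg); apply: divr_ge0 (ltW h2).
  have : 0 <= M%:R * Err.
    apply: le_trans A; apply: mulr_ge0; [exact: mulr_ge0|apply: sumr_ge0 => k _].
    by apply: lsum_ge0 => x; exact: nsq_ge0.
  by rewrite pmulr_rge0//; lra.
rewrite ler_pdivlMr//.
have := ler_wpM2r (ltW pos) sg2; move: C1; move: (S _ - _) => *; lra.
Qed.

Variable t : R.
Hypotheses (t0 : 0 < t) (t1 : t <= 1) (et : e <= t) (het : h <= t * e) (sgt : sg <= t * e * h).
Hypothesis epst : eps0 <= 12 * t * Vol.

Let Lk := 14 * Lu + Lg.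

(** The hypotheses on the scales make every error O(t) even after division by h^2. The ratios that
    occur are s / e^2 in the Poincare errors, s / (e h^2) in the Jacobian term, (h / e)^2 in the [Y]
    term and kap / h in the directional derivatives. *)
Lemma energy_small : S (fun x => nsq (f x)) <=
  (20 * (16384 * al * N * Lu ^+ 2 + 3072 * al * C + 8 * N * Lk ^+ 2 + 260 * N * Lu ^+ 2)
   + 4 * N * (Lg + Lk) ^+ 2 + 68 * al * N * Lu ^+ 2) * t * Vol.
Proof.
have e1 : e <= 1 by have := e_rad; rewrite -/e; have := rad1; lra.
have ep := ee0; have hp := h0; have hl := h1; have sp := s0; have sgp := sg0.
have Lun := Lu0; have Lgn := Lg0; have V0 := Vol_ge0; have tp := t0; have tl := t1.
have Nn := N0; have aln := al0; have Cn := C0.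
have h2p : 0 < h ^+ 2 by rewrite exprn_gt0.
have e2p : 0 < e ^+ 2 by rewrite exprn_gt0.
have seh : s <= t ^+ 2 * (e ^+ 2 * h ^+ 2).
  have H : sg ^+ 2 <= (t * e * h) ^+ 2.
    by rewrite ler_pXn2r// nnegrE ?(ltW sg0)//; exact: le_trans (ltW sg0) sgt.
  by apply: (le_trans ssg); rewrite -exprMn -exprMn mulrA.
have hh2 : h ^+ 2 <= 1 by rewrite exprn_ile1// ltW.
have ee2 : e ^+ 2 <= e by rewrite expr2 ler_piMl// ltW.
have tt2 : t ^+ 2 <= t by rewrite expr2 ler_piMl// ltW.
have tt0 := sqr_ge0 t.
have s_e2 : s <= t * e ^+ 2.
  rewrite (le_trans seh)// ler_pM//; first by rewrite mulr_ge0 ?sqr_ge0.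
  by rewrite ler_piMr// ltW.
have s_eh : s <= t * (e * h ^+ 2).
  rewrite (le_trans seh)// ler_pM//; first by rewrite mulr_ge0 ?sqr_ge0.
  by rewrite ler_wpM2r// ltW.
have s_t : s <= t by rewrite (le_trans s_e2)// ler_piMr ?(ltW t0)// (le_trans ee2).
have kapt : kap <= Lk * t * h.
  have -> : kap = (10 * Lu + (Lg + 4 * Lu) * e) * (sg / e).
    by rewrite /kap; field; rewrite gt_eqF.
  have q : sg / e <= t * h by rewrite ler_pdivrMr// mulrAC.
  rewrite /Lk -mulrA; apply: ler_pM => //.
  - by have := mulr_ge0 (addr_ge0 Lgn (mulr_ge0 (ler0n _ 4) Lun)) (ltW ep); lra.
  - by rewrite divr_ge0 ?(ltW sg0) ?(ltW ee0).
  - have := ler_wpM2l (addr_ge0 Lgn (mulr_ge0 (ler0n _ 4) Lun)) e1; lra.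
have kap2 : kap ^+ 2 <= Lk ^+ 2 * t * h ^+ 2.
  have Lk0 : 0 <= Lk by rewrite /Lk; lra.
  apply: (@le_trans _ _ ((Lk * t * h) ^+ 2)).
    by rewrite ler_pXn2r// ?nnegrE ?kap_ge0// !mulr_ge0// ltW.
  rewrite !exprMn ler_wpM2r ?(ltW h2p)// ler_wpM2l ?sqr_ge0//.
have sin2 : sin (h / 2) ^+ 2 <= h ^+ 2 / 4.
  have := @dir_lip R 0 (h / 2); rewrite subr0 gtr0_norm ?divr_gt0// => dh.
  have sh : `|sin (h / 2)| <= h / 2.
    by rewrite (le_trans _ dh)// le_max /= sin0 subr0 lexx orbT.
  rewrite -(real_normK (num_real (sin (h / 2)))).
  have := normr_ge0 (sin (h / 2)); nra.
have T1 : Perr (2 * Wb / e) <= 4096 * Lu ^+ 2 * t * h ^+ 2 * Vol.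
  rewrite /Perr ler_wpM2r// /Wb.
  have -> : 16 * s * (2 * (8 * Lu * h) / e) ^+ 2 = 4096 * Lu ^+ 2 * h ^+ 2 * (s / e ^+ 2).
    by field; rewrite gt_eqF.
  have -> : 4096 * Lu ^+ 2 * t * h ^+ 2 = 4096 * Lu ^+ 2 * h ^+ 2 * t by ring.
  apply: ler_wpM2l; last by rewrite ler_pdivrMr.
  by exact: (mulr_ge0 (mulr_ge0 (ler0n R 4096) (sqr_ge0 Lu)) (ltW h2p)).
have T2 : C * (8 * h) ^+ 2 * eps0 <= 768 * C * t * h ^+ 2 * Vol.
  have -> : 768 * C * t * h ^+ 2 * Vol = C * (8 * h) ^+ 2 * (12 * t * Vol) by ring.
  by rewrite ler_wpM2l// mulr_ge0// sqr_ge0.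
have T4 : sin (h / 2) ^+ 2 * (N * (4 * Wb / e) ^+ 2 * Vol) <= 256 * N * Lu ^+ 2 * t * h ^+ 2 * Vol.
  have hte : (h / e) ^+ 2 <= t.
    rewrite (le_trans _ tt2)// ler_pXn2r// ?nnegrE ?divr_ge0 ?(ltW h0) ?(ltW t0) ?(ltW ee0)//.
    by rewrite ler_pdivrMr.
  have -> : N * (4 * Wb / e) ^+ 2 * Vol = 1024 * N * Lu ^+ 2 * Vol * (h / e) ^+ 2.
    by rewrite /Wb; field; rewrite gt_eqF.
  have c0 : 0 <= 1024 * N * Lu ^+ 2 * Vol.
    exact: (mulr_ge0 (mulr_ge0 (mulr_ge0 (ler0n R 1024) Nn) (sqr_ge0 Lu)) V0).
  apply: (@le_trans _ _ (h ^+ 2 / 4 * (1024 * N * Lu ^+ 2 * Vol * t))); last first.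
    by rewrite le_eqVlt; apply/orP; left; apply/eqP; field.
  apply: ler_pM; rewrite ?sqr_ge0 ?(mulr_ge0 c0) ?sqr_ge0//.
  by rewrite ler_wpM2l.
have T5 : N * (4 * Lu ^+ 2 / e * s) * Vol <= 4 * N * Lu ^+ 2 * t * h ^+ 2 * Vol.
  rewrite ler_wpM2r//.
  have -> : N * (4 * Lu ^+ 2 / e * s) = 4 * N * Lu ^+ 2 * (s / e) by field; rewrite gt_eqF.
  have -> : 4 * N * Lu ^+ 2 * t * h ^+ 2 = 4 * N * Lu ^+ 2 * (t * h ^+ 2) by ring.
  apply: ler_wpM2l; last first.
    by rewrite ler_pdivrMr// (le_trans s_eh)// le_eqVlt; apply/orP; left; apply/eqP; ring.
  by apply: mulr_ge0 (sqr_ge0 _); apply: mulr_ge0.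
have E1 : 20 * Err / h ^+ 2 <= 20 * (16384 * al * N * Lu ^+ 2 + 3072 * al * C + 8 * N * Lk ^+ 2 + 260 * N * Lu ^+ 2) * t * Vol.
  rewrite ler_pdivrMr//.
  have a1 := ler_wpM2l (mulr_ge0 aln Nn) T1; have a2 := ler_wpM2l aln T2.
  have a3 := ler_wpM2r V0 (ler_wpM2l Nn kap2).
  by have := energy_arith1 a1 a2 a3 T4 T5; rewrite /Err.
have E2 : Err2 <= (4 * N * (Lg + Lk) ^+ 2 + 68 * al * N * Lu ^+ 2) * t * Vol.
  have Lk0 : 0 <= Lk by apply: addr_ge0 => //; exact: mulr_ge0.
  have b1 : Lg * e + kap <= (Lg + Lk) * t.
    rewrite [leRHS]mulrDl; apply: lerD; first exact: ler_wpM2l.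
    rewrite -[leRHS]mulr1 (le_trans kapt)//; apply: ler_wpM2l => //.
    by rewrite mulr_ge0// ltW.
  have b2 : (Lg * e + kap) ^+ 2 <= (Lg + Lk) ^+ 2 * t.
    apply: (@le_trans _ _ (((Lg + Lk) * t) ^+ 2)).
      have LL0 := mulr_ge0 (addr_ge0 Lgn Lk0) (ltW tp).
      have ek0 := addr_ge0 (mulr_ge0 Lgn (ltW ep)) kap_ge0.
      by rewrite ler_pXn2r// nnegrE.
    by rewrite exprMn; apply: ler_wpM2l tt2; exact: sqr_ge0.
  have b3 : Perr Lu <= 16 * Lu ^+ 2 * t * Vol.
    rewrite /Perr ler_wpM2r//.
    have -> : 16 * s * Lu ^+ 2 = 16 * Lu ^+ 2 * s by ring.
    by apply: ler_wpM2l => //; apply: mulr_ge0 (sqr_ge0 _).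
  have b4 : (Lu * e) ^+ 2 <= Lu ^+ 2 * t.
    by rewrite exprMn ler_wpM2l ?sqr_ge0// (le_trans ee2).
  have c1 := ler_wpM2r V0 (ler_wpM2l Nn b2).
  have c2 := ler_wpM2l (mulr_ge0 aln Nn) b3.
  have c3 := ler_wpM2r V0 (ler_wpM2l (mulr_ge0 aln Nn) b4).
  by have := energy_arith2 c1 c2 c3; rewrite /Err2.
apply: (le_trans energy); apply: (le_trans (lerD E1 E2)).
by rewrite -!mulrDl !addrA.
Qed.

End Energy.

(** This places the constant before the scales: [Q], read off from [energy_small], depends only on
    [A0], [L], [C] and the number of components, so [t] can be chosen against it. *)
Lemma energy_bound_exists (R : realType) (I : finType) (a : R * R -> I -> I -> R)
    (f : R * R -> I -> R) (u : R -> R * R -> I -> R) (A0 L C rad : R) :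
  0 <= L -> 0 <= C -> 0 < rad -> rad <= 4^-1 ->
  (forall x i j, `|a x i j| <= A0) ->
  (forall x y i j, `|a x i j - a y i j| <= L * pnorm (x - y)) ->
  (forall x y i, `|f x i - f y i| <= L * pnorm (x - y)) ->
  (forall (th : R) (x : R * R) (t : R) i,
    is_derive t 1 (fun s => u th (x + s *: dir th) i)
    (mv (a (x + t *: dir th)) (u th (x + t *: dir th)) i + f (x + t *: dir th) i)) ->
  (forall th (x : R * R) i, rad < pnorm x -> u th x i = 0) ->
  (forall th x, nsq (u th x) <= C) ->
  (forall th th' x x' k, 8 * pnorm (dir th' - dir th) + pnorm (x' - x) <= k ->
    nsq (fun i => u th' x' i - u th x i) <= C * k ^+ 2) ->
  (forall th, u (th + 2 * pi) = u th) ->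
  512 * (#|I|%:R * A0) ^+ 2 * rad ^+ 2 <= 1 ->
  exists2 Q : R, 0 <= Q & forall (s h sg t : R) (B r M : nat),
  0 < s -> (0 < r)%N -> (0 < M)%N -> s * r%:R <= rad / 2 -> 50 <= s * B%:R ->
  0 < h -> h <= 1 -> M%:R * h = 2 * pi -> 0 < sg -> sg <= 1 -> s <= sg ^+ 2 ->
  0 < t -> t <= 1 -> s * r%:R <= t -> h <= t * (s * r%:R) -> sg <= t * (s * r%:R) * h ->
  (forall k, (k < M)%N -> lsum s B (fun x => nsq (fun i =>
     (u (k.+1%:R * h) x i - u (k%:R * h) x i) -
     bavg s r (fun y => u (k.+1%:R * h) y i - u (k%:R * h) y i) x)) <=
   C * (8 * h) ^+ 2 * (12 * t * lsum s B (fun=> 1))) ->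
  lsum s B (fun x => nsq (f x)) <= Q * t * lsum s B (fun=> 1).
Proof.
move=> L0 C0 rad0 rad1 aA aL fL ud u0 uC uL uper sm.
eexists; last first.
  move=> s h sg t B r M s0 r0 M0 er sB h0 h1 Mh sg0 sg1 ssg t0 t1 et het sgt Wd.
  exact: (energy_small L0 C0 rad0 rad1 aA aL fL ud u0 uC uL uper sm s0 r0 M0 er sB
    h0 h1 Mh sg0 sg1 ssg Wd t0 t1 et het sgt (lexx _)).
have n0 : 0 <= #|I|%:R :> R by exact: ler0n.
by repeat first [exact: sqr_ge0|exact: n0|exact: C0|exact: ler0n|apply: addr_ge0|apply: mulr_ge0].
Qed.

(** * Counting lattice points near the boundary of a convex set *)

Section CollarCount.
Variables (R : realType).
Local Notation P := (R * R)%type.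
Variables (K : P -> Prop) (r0 : R).
Hypothesis r00 : 0 < r0.
Hypothesis Kconv : forall x y (t : R), K x -> K y -> 0 <= t <= 1 -> K (x + t *: (y - x)).
Hypothesis Kball : forall x, pnorm x <= r0 -> K x.

Lemma star (x : P) (t t' : R) : 0 <= t' <= t -> K (t *: x) -> K (t' *: x).
Proof.
move=> /andP[t'0 t't] Kx; have [t0|tneq] := eqVneq t 0.
  by have -> : t' = t by lra.
have tp : 0 < t by rewrite lt_neqAle eq_sym tneq (le_trans t'0).
have K0 : K 0 by apply: Kball; rewrite pnorm0 ltW.
have -> : t' *: x = 0 + (t' / t) *: (t *: x - 0).
  by rewrite add0r subr0 scalerA divfK.
by apply: Kconv => //; rewrite divr_ge0 ?(ltW tp)//= ler_pdivrMr// mul1r.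
Qed.

Lemma outer_comb (x y : P) (q : R) : 0 < q ->
  (1 + q)^-1 *: x = y + (q / (1 + q)) *: (q^-1 *: (x - y) - y).
Proof.
case: x y => [x1 x2] [y1 y2] q0; apply/pair_equal_spec.
by split; rewrite /= /GRing.scale/=; field; rewrite !gt_eqF//; lra.
Qed.

Lemma inner_comb (x y : P) (q : R) : 0 < q -> q < 1 ->
  y = (1 - q)^-1 *: x + q *: (q^-1 *: (y - x) - (1 - q)^-1 *: x).
Proof.
case: x y => [x1 x2] [y1 y2] q0 q1; apply/pair_equal_spec.
by split; rewrite /= /GRing.scale/=; field; rewrite !gt_eqF//; lra.
Qed.

(** With q = eta / r0: if [y] in [K] is within eta of [x], then x / (1 + q) is a convex combination
    of [y] and the point (x - y) / q of the ball. If x / (1 - q) were in [K], every point within eta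
    of [x] would be such a combination of it and a ball point. *)
Lemma collar_dilate (eta : R) (x : P) : 0 < eta -> eta < r0 -> collar K eta x ->
  K ((1 + eta / r0)^-1 *: x) /\ ~ K ((1 - eta / r0)^-1 *: x).
Proof.
move=> eta0 etar [[y yx Ky] [y' y'x nKy']].
set q := eta / r0; have q0 : 0 < q by rewrite divr_gt0.
have q1 : q < 1 by rewrite /q ltr_pdivrMr// mul1r.
have small (z : P) : pnorm z <= eta -> K (q^-1 *: z).
  move=> ze; apply: Kball; rewrite pnormZ gtr0_norm ?invr_gt0//.
  by rewrite /q invf_div mulrC mulrA ler_pdivrMr// [_ * eta]mulrC ler_pM2r// mulrC ler_pM2l.
split.
  rewrite (outer_comb x y q0).
  apply: Kconv => //; first by apply: small; rewrite pdistC.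
  rewrite divr_ge0 ?(ltW q0)//=; last by lra.
  by rewrite ler_pdivrMr ?mul1r; lra.
move=> Kx; apply: nKy'.
rewrite (inner_comb x y' q0 q1).
by apply: Kconv => //; [exact: small | rewrite !ltW].
Qed.

Let v (B i j : nat) : P := (i%:R - B%:R, j%:R - B%:R).
Let cnt (B : nat) (t : R) : R :=
  \sum_(i < B.*2) \sum_(j < B.*2) (`[< K (t *: v B i j) >])%:R.

(* A pigeonhole over disjoint ranges of lattice steps. *)
Lemma collar_count (J B : nat) (s0 : R) : (0 < J)%N -> 0 < s0 ->
  exists2 s, s0 / 2 <= s <= s0 &
    lsum s B (collar_ind K (r0 / (8 * J%:R))) <= (B.*2 ^ 2)%:R / J%:R.
Proof.
move=> J0 s00; have Jp : 0 < J%:R :> R by rewrite ltr0n.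
(* The steps [tau l] cut [s0 / 2, s0] into [J] intervals of length 2 d. By [star] the number of
   lattice points in [K] decreases along them, so over one interval it drops by at most a share 1 /
   J of all points. For the lattice of its middle step each collar point is among those lost, since
   dilation by 1 +- 1 / (8 J) stays within the interval. *)
pose tau (l : nat) := s0 * (2^-1 + l%:R / (2 * J%:R)).
pose d := s0 / (4 * J%:R).
have dp : 0 < d by rewrite divr_gt0// mulr_gt0.
have tauS l : tau l.+1 = tau l + 2 * d.
  by rewrite /tau /d -natr1; field; rewrite gt_eqF.
have taup l : 0 < tau l.
  have h : 0 <= l%:R / (2 * J%:R) :> R by rewrite divr_ge0// mulr_ge0.
  by rewrite /tau mulr_gt0//; lra.
pose mid l := tau l + d.
have tel : \sum_(l < J) (cnt B (tau l) - cnt B (tau l.+1)) <= (B.*2 ^ 2)%:R.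
  rewrite -(big_mkord xpredT (fun l => cnt B (tau l) - cnt B (tau l.+1))).
  under eq_bigr do rewrite -opprB.
  rewrite sumrN telescope_sumr// opprB lerBlDr.
  apply: (@le_trans _ _ (B.*2 ^ 2)%:R); last first.
    by rewrite lerDl; apply: sumr_ge0 => i _; apply: sumr_ge0 => j _.
  apply: (@le_trans _ _ (\sum_(i < B.*2) \sum_(j < B.*2) 1)).
    by apply: ler_sum => i _; apply: ler_sum => j _; case: asboolP.
  by rewrite !sumr_const !card_ord -mulrnA mulnn.
have [l lJ] : exists2 l : 'I_J, True & cnt B (tau l) - cnt B (tau l.+1) <= (B.*2 ^ 2)%:R / J%:R.
  apply: contrapT => H.
  suff : (B.*2 ^ 2)%:R < \sum_(l < J) (cnt B (tau l) - cnt B (tau l.+1)) by rewrite ltNge tel.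
  have -> : (B.*2 ^ 2)%:R = \sum_(l < J) ((B.*2 ^ 2)%:R / J%:R) :> R.
    by rewrite sumr_const card_ord -[RHS]mulr_natr divfK// gt_eqF.
  apply: ltr_sum; first by apply/hasP; exists (Ordinal J0); rewrite ?mem_index_enum.
  by move=> l _; rewrite ltNge; apply/negP => Hl; apply: H; exists l.
move=> Hl; exists (mid l).
  have : tau l.+1 <= s0.
    rewrite /tau ger_pMr// -lerBrDl ler_pdivrMr ?mulr_gt0//.
    have : l.+1%:R <= J%:R :> R by rewrite ler_nat ltn_ord.
    lra.
  have : s0 / 2 <= tau l.
    by rewrite /tau ler_pM2l// lerDl divr_ge0 ?mulr_ge0.
  by rewrite /mid tauS => *; apply/andP; split; lra.
apply: le_trans Hl; rewrite /cnt -sumrB; apply: ler_sum => i _; rewrite -sumrB.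
apply: ler_sum => j _.
have J1 : 1 <= J%:R :> R by rewrite ler1n.
set eta := r0 / _.
have eta0 : 0 < eta by rewrite divr_gt0// mulr_gt0.
have q8 : eta / r0 = (8 * J%:R)^-1 by rewrite /eta; field; rewrite !gt_eqF.
have q8l : (8 * J%:R)^-1 <= 8^-1 :> R by rewrite lef_pV2 ?posrE ?mulr_gt0//; lra.
have q8p : 0 < (8 * J%:R)^-1 :> R by rewrite invr_gt0 mulr_gt0.
have etar : eta < r0 by rewrite /eta gtr_pMr//; lra.
have midp : 0 < mid l.
  by rewrite /mid addr_gt0.
have mids : mid l <= s0.
  have : tau l.+1 <= s0.
    rewrite /tau ger_pMr// -lerBrDl ler_pdivrMr ?mulr_gt0//.
    have : l.+1%:R <= J%:R :> R by rewrite ler_nat ltn_ord.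
    lra.
  by rewrite /mid tauS; lra.
have xE : lattice_pt (mid l) B i j = mid l *: v B i j by [].
have dE : s0 * (8 * J%:R)^-1 = d / 2 by rewrite /d; field; rewrite gt_eqF.
have mono t t' : 0 <= t' <= t -> (`[< K (t *: v B i j) >] -> `[< K (t' *: v B i j) >]).
  by move=> tt /asboolP H; apply/asboolP; exact: star H.
rewrite /collar_ind; case: asboolP => [C|_]; last first.
  rewrite subr_ge0 ler_nat.
  have := @mono (tau l.+1) (tau l); case: `[< _ >]; case: `[< _ >] => // H.
  suff : false by [].
  apply: H => //; rewrite tauS; apply/andP; split; last by lra.
  exact: ltW.
have [] := collar_dilate eta0 etar C; rewrite q8 xE !scalerA.
have mdl := ler_wpM2r (ltW q8p) mids; rewrite dE in mdl.
have q1p : 0 < 1 - (8 * J%:R)^-1 :> R by lra.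
move=> /star Kin nKin; rewrite asboolT ?asboolF ?subr0//.
  move=> /star H; apply: nKin; apply: H; apply/andP; split.
    by rewrite mulr_ge0 ?(ltW midp)// invr_ge0 ltW.
  rewrite mulrC ler_pdivrMr// tauS mulrDr mulr1.
  rewrite /mid in mdl *.
  have := taup l.
  move: ((8 * J%:R)^-1) mdl q8l q8p q1p => q *; nra.
apply: Kin; apply/andP; split.
  exact: ltW.
rewrite mulrC ler_pdivlMr; last by lra.
rewrite mulrDr mulr1 /mid in mdl *.
have := taup l.
move: ((8 * J%:R)^-1) mdl q8l q8p q1p => q *; nra.
Qed.

End CollarCount.

(** The indices from B to B + n - 1, with n the integer part of rho / s, already give n^2 points of
    the ball, and n >= rho / (2 s). *)
Lemma lsum_ball_ge (R : realType) (s rho : R) (B : nat) : 0 < s -> s <= rho / 2 ->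
  rho <= s * B%:R ->
  (rho / (2 * s)) ^+ 2 <= lsum s B (fun x => (pnorm x <= rho)%R%:R).
Proof.
move=> s0 srho rB; pose n := Num.truncn (rho / s).
have rho0 : 0 < rho by lra.
have /andP[nr rn] := truncn_itv (divr_ge0 (ltW rho0) (ltW s0)).
rewrite -/n in nr rn; rewrite ler_pdivlMr// in nr; rewrite ltr_pdivrMr// -natr1 in rn.
have nB : (n <= B)%N.
  by rewrite -(ler_nat R) -(ler_pM2r s0) (le_trans nr)// mulrC.
pose g (i : nat) : R := ((B <= i) && (i < B + n))%N%:R.
have sumg : \sum_(i < B.*2) g i >= n%:R.
  rewrite -(big_mkord xpredT g) (@big_cat_nat _ _ _ B)//=; last by rewrite -addnn leq_addr.
  rewrite (@big_cat_nat _ _ _ (B + n)%N B)//=; [|by rewrite leq_addr|by rewrite -addnn leq_add2l].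
  rewrite addrCA ler_wpDr//; first by rewrite addr_ge0//; apply: sumr_ge0 => i _; rewrite ler0n.
  rewrite (eq_big_nat _ _ (F2 := fun=> 1)) ?sumr_const_nat ?addKn//.
  by move=> i Bi; rewrite /g Bi.
apply: (@le_trans _ _ ((\sum_(i < B.*2) g i) * (\sum_(j < B.*2) g j))).
  have n0 : rho / (2 * s) <= n%:R.
    by rewrite ler_pdivrMr ?mulr_gt0//; lra.
  have r0 : 0 <= rho / (2 * s) by rewrite divr_ge0 ?mulr_ge0 ?ltW.
  by rewrite expr2 ler_pM// (le_trans n0).
rewrite /lsum mulr_suml; apply: ler_sum => i _; rewrite mulr_sumr.
apply: ler_sum => j _; rewrite /g -natrM mulnb ler_nat.
case: andP => //= -[/andP[Bi iB] /andP[Bj jB]].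
have bd (k : nat) : (B <= k)%N -> (k < B + n)%N -> `|s * (k%:R - B%:R)| <= rho.
  move=> Bk kB; rewrite normrM (gtr0_norm s0) -natrB// normr_nat.
  rewrite (le_trans _ nr)// mulrC ler_pM2r// ler_nat leq_subLR ltnW//.
by rewrite pnorm_le/= !bd.
Qed.

(** * Uniqueness in a small planar disc *)

Section Scales.
Variable R : realType.
Local Notation P := (R * R)%type.

Lemma collar_ind_near (K : P -> Prop) (eta s : R) (x y : P) :
  s <= eta / 2 -> pnorm (x - y) <= s ->
  collar_ind K (eta / 2) x <= collar_ind K eta y.
Proof.
move=> se xy; rewrite /collar_ind ler_nat; case: asboolP => // -[[p px Kp] [q qx Kq]].
have near (z : P) : pnorm (z - x) <= eta / 2 -> pnorm (z - y) <= eta.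
  by move=> zx; have := pnormD (z - x) (x - y); rewrite addrA subrK; lra.
rewrite asboolT//; split; [exists p => //; exact: near|exists q => //; exact: near].
Qed.

Lemma exists_nat_ge (x : R) : exists2 n : nat, (0 < n)%N & x <= n%:R.
Proof.
exists (Num.truncn x).+1 => //.
by have [x0|x0] := leP 0 x; [have /andP[_ /ltW] := truncn_itv x0|
  rewrite (le_trans (ltW x0))].
Qed.

(** The scales are fixed from coarse to fine: block side, angular step, differentiation step,
    lattice step. The angular step is an exact fraction of 2 pi, so that the directions close up.
    The conclusions hold on a whole range of [s], because the counting of collar points selects its
    own step there. *)
Lemma lattice_scales (rad t d eta rho : R) : 0 < rad -> rad <= 4^-1 -> 0 < t -> t <= 1 ->
  0 < d -> 0 < eta -> 0 < rho ->
  exists h sg so : R, exists J M r B : nat,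
  [/\ (0 < J)%N, (0 < M)%N, (0 < r)%N & 0 < so] /\
  [/\ 0 < h, h <= 1, M%:R * h = 2 * pi, 0 < sg & sg <= 1] /\
  forall s, so / 2 <= s <= so ->
  [/\ 0 < s, s <= sg ^+ 2, s <= eta / 2 & s <= rho / 2] /\
  [/\ s * r%:R <= rad / 2, s * r%:R <= t, s * r%:R <= d, 50 <= s * B%:R & s * B%:R <= 101] /\
  [/\ h <= t * (s * r%:R), sg <= t * (s * r%:R) * h & 8 / J%:R + 8 * h + s * r%:R <= eta / 2].
Proof.
have aux1 (x y : R) : 100 <= x -> x / 2 <= y -> 50 <= y by lra.
have aux2 (x y z w v : R) : x <= y -> y <= z -> z <= 1 -> w <= 100 + x -> v <= w -> v <= 101 by lra.
have aux3 (x y z w e et : R) : x <= et / 8 -> y <= z -> z <= w / 2 -> e <= w -> w <= et / 32 ->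
  0 <= et -> x + 8 * y + e <= et / 2 by lra.
move=> rad0 rad1 t0 t1 d0 eta0 rho0.
have [ep [ep0 ep1 ep2 ep3 ep4]] : exists ep : R,
    [/\ 0 < ep, ep <= rad / 2, ep <= d, ep <= t & ep <= eta / 32].
  exists (Num.min (rad / 2) (Num.min d (Num.min t (eta / 32)))).
  split; last 4 first; try by rewrite !ge_min lexx ?orbT.
  by rewrite lt_min divr_gt0//= lt_min d0/= lt_min t0/= divr_gt0.
have ep20 : 0 < ep / 2 by rewrite divr_gt0.
have [J J0 Jeta] := exists_nat_ge (64 / eta).
have J8 : 8 / J%:R <= eta / 8.
  rewrite ler_pdivrMr ?ltr0n// mulrAC ler_pdivlMr//.
  by move: Jeta; rewrite ler_pdivrMr// mulrC; lra.
have [hm [hm0 hm1 hmt]] : exists hm : R, [/\ 0 < hm, hm <= 1 & hm <= t * (ep / 2)].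
  exists (Num.min 1 (t * (ep / 2))); rewrite lt_min ltr01/= mulr_gt0//.
  by rewrite !ge_min !lexx orbT.
have [M M0 Mh] := exists_nat_ge (2 * pi / hm).
have Mp : 0 < M%:R :> R by rewrite ltr0n.
have [h [h0 hle Mhpi]] : exists h : R, [/\ 0 < h, h <= hm & M%:R * h = 2 * pi].
  exists (2 * pi / M%:R); split.
  - by rewrite divr_gt0// mulr_gt0// pi_gt0.
  - by rewrite ler_pdivrMr// [hm * _]mulrC -ler_pdivrMr.
  - by rewrite mulrC divfK// gt_eqF.
have hte := le_trans hle hmt.
have [sg [sg0 sg1 sgt]] : exists sg : R, [/\ 0 < sg, sg <= 1 & sg <= t * (ep / 2) * h].
  exists (Num.min 1 (t * (ep / 2) * h)).
  rewrite lt_min ltr01/= (mulr_gt0 (mulr_gt0 t0 ep20) h0).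
  by rewrite !ge_min !lexx orbT.
have [sm [sm0 sm1 sm2 sm3]] : exists sm : R,
    [/\ 0 < sm, sm <= sg ^+ 2, sm <= eta / 2 & sm <= rho / 2].
  exists (Num.min (sg ^+ 2) (Num.min (eta / 2) (rho / 2))).
  split; last 3 first; try by rewrite !ge_min lexx ?orbT.
  by rewrite !lt_min exprn_gt0// !divr_gt0.
have [r r0' rep] := exists_nat_ge (ep / sm).
have rp : 0 < r%:R :> R by rewrite ltr0n.
have [so [so0 sosm sor]] : exists so : R, [/\ 0 < so, so <= sm & so * r%:R = ep].
  exists (ep / r%:R); split; first by rewrite divr_gt0.
    by rewrite ler_pdivrMr// [sm * _]mulrC -ler_pdivrMr.
  by rewrite divfK// gt_eqF.
(* The box has half-width at least 100 for the step [so], so that at least 50 is left for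
   [so / 2]. *)
have [B Bso Bso'] : exists2 B : nat, 100 <= so * B%:R & so * B%:R <= 100 + so.
  have p100 : 0 <= 100 / so by rewrite divr_ge0 ?ltW.
  exists (Num.truncn (100 / so)).+1; have /andP[H1 H2] := truncn_itv p100.
    by rewrite mulrC -ler_pdivrMr// ltW.
  by rewrite -natr1 mulrDr mulr1 lerD2r mulrC -ler_pdivlMr.
exists h, sg, so, J, M, r, B; split=> //; split; first by split => //; exact: le_trans hle hm1.
move=> s /andP[s1 s2].
have sgle1 : sg ^+ 2 <= 1 by rewrite exprn_ile1// ltW.
have s0 : 0 < s by apply: lt_le_trans s1; rewrite divr_gt0.
have e1 : s * r%:R <= ep by rewrite -sor ler_pM2r.
have e2 : ep / 2 <= s * r%:R by rewrite -sor mulrAC ler_pM2r.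
have b1 := ler_wpM2r (ler0n _ B) s1; have b2 := ler_wpM2r (ler0n _ B) s2.
have te := ler_wpM2l (ltW t0) e2.
have teh := ler_wpM2r (ltW h0) te.
have tep : t * (ep / 2) <= ep / 2 by rewrite ler_piMl// ltW.
split; first by split=> //; apply: (le_trans s2); apply: (le_trans sosm).
split.
  split; try exact: le_trans e1 _.
  - by apply: aux1 Bso _; rewrite mulrAC in b1.
  - exact: aux2 sosm sm1 sgle1 Bso' b2.
split; first exact: le_trans hte te.
  exact: le_trans sgt teh.
exact: aux3 J8 hte tep e1 ep4 (ltW eta0).
Qed.

End Scales.

Section Planar.
Variables (R : realType) (I : finType).
Local Notation P := (R * R)%type.
Variables (a : P -> I -> I -> R) (f : P -> I -> R) (u : R -> P -> I -> R).
Variables (K : P -> Prop) (A0 L rad r0 : R).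
Hypotheses (L0 : 0 <= L) (rad0 : 0 < rad) (rad1 : rad <= 4^-1) (r00 : 0 < r0).
Hypothesis aA : forall x i j, `|a x i j| <= A0.
Hypothesis aL : forall x y i j, `|a x i j - a y i j| <= L * pnorm (x - y).
Hypothesis fL : forall x y i, `|f x i - f y i| <= L * pnorm (x - y).
Hypothesis ud : forall (th : R) (x : P) (t : R) i,
  is_derive t 1 (fun s => u th (x + s *: dir th) i)
    (mv (a (x + t *: dir th)) (u th (x + t *: dir th)) i + f (x + t *: dir th) i).
Hypothesis u0 : forall th (x : P) i, rad < pnorm x -> u th x i = 0.
Hypothesis f0 : forall (x : P) i, rad < pnorm x -> f x i = 0.
Hypothesis uper : forall th, u (th + 2 * pi) = u th.
Hypothesis small : 512 * (#|I|%:R * A0) ^+ 2 * rad ^+ 2 <= 1.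
Hypothesis Kconv : forall x y (t : R), K x -> K y -> 0 <= t <= 1 -> K (x + t *: (y - x)).
Hypothesis Kball : forall x, pnorm x <= r0 -> K x.
Hypothesis uK : forall th x, ~ K x -> forall i, u th x i = 0.
Hypothesis fK : forall x, ~ K x -> forall i, f x i = 0.
Hypothesis dd : forall e : R, 0 < e -> exists2 d, 0 < d & forall p q z,
  pnorm z <= d -> K p -> K (p + q) -> K (p + z) -> K (p + q + z) ->
  (forall i j, `|a (p + q + z) i j - a (p + z) i j - a (p + q) i j + a p i j| <= e * pnorm q) /\
  (forall i, `|f (p + q + z) i - f (p + z) i - f (p + q) i + f p i| <= e * pnorm q).

Variables (C t d eta : R) (J2 : nat).
Hypotheses (C0 : 0 <= C) (t0 : 0 < t) (t1 : t <= 1) (d0 : 0 < d) (J20 : (0 < J2)%N).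
Hypothesis J2t : J2%:R^-1 <= t.
Hypothesis uW : forall th th' (x z : P) (J : nat) (eta e0 : R),
  (0 < J)%N -> 0 <= e0 -> pnorm x <= 1 -> pnorm z <= 1 ->
  (forall p q i j, K p -> K (p + q) -> K (p + z) -> K (p + q + z) ->
     `|a (p + q + z) i j - a (p + z) i j - a (p + q) i j + a p i j| <= e0 * pnorm q) ->
  (forall p q i, K p -> K (p + q) -> K (p + z) -> K (p + q + z) ->
     `|f (p + q + z) i - f (p + z) i - f (p + q) i + f p i| <= e0 * pnorm q) ->
  8 / J%:R + 8 * pnorm (dir th' - dir th) + pnorm z <= eta ->
  nsq (fun i => (u th' (x + z) i - u th (x + z) i) - (u th' x i - u th x i)) <=
  C * (8 * pnorm (dir th' - dir th)) ^+ 2 *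
    ((e0 + pnorm z) ^+ 2 + 8 / J%:R * \sum_(j < J) collar_ind K eta
       (x + (j%:R * (8 / J%:R) - 8) *: dir th)).
Hypothesis ddt : forall p q z,
  pnorm z <= d -> K p -> K (p + q) -> K (p + z) -> K (p + q + z) ->
  (forall i j, `|a (p + q + z) i j - a (p + z) i j - a (p + q) i j + a p i j| <= t * pnorm q) /\
  (forall i, `|f (p + q + z) i - f (p + z) i - f (p + q) i + f p i| <= t * pnorm q).
Variables (s h : R) (J r B : nat).
Hypotheses (s0 : 0 < s) (r0' : (0 < r)%N) (J0 : (0 < J)%N) (h0 : 0 < h) (seta : s <= eta / 2).
Hypotheses (s_1 : s <= 1) (er : s * r%:R <= rad / 2) (et : s * r%:R <= t) (ed : s * r%:R <= d).
Hypotheses (sB : 50 <= s * B%:R) (budget : 8 / J%:R + 8 * h + s * r%:R <= eta / 2).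
Let Vol := lsum s B (fun=> 1 : R).
Hypothesis Scol : lsum s B (collar_ind K eta) <= Vol / J2%:R.

Section Step.
Variables (th th' : R).
Hypothesis dth : `|th' - th| <= h.
Let W x i := u th' x i - u th x i.
Let z (j : nat) : P := (j%:R * (8 / J%:R) - 8) *: dir th.
(** The cutoff to the unit box, where [W] lives, leaves room in the lattice box of half-width 50 for
    a translation by [z j], of norm at most 8. *)
Let Phi (j : nat) (x : P) : R := if pnorm x <= 1 then collar_ind K (eta / 2) (x + z j) else 0.

Lemma Phi_ge0 j x : 0 <= Phi j x.
Proof. by rewrite /Phi; case: ifP => // _; exact: collar_ind_ge0. Qed.

(** By Jensen it suffices to bound [W y - W x] for [y] in the block of [x]; this is a double
    difference, to which [uW] applies with [e0] equal to [t]. *)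
Lemma W_average_pointwise x : nsq (fun i => W x i - bavg s r (fun y => W y i) x) <=
      C * (8 * h) ^+ 2 * (4 * t + 8 / J%:R * \sum_(j < J) Phi j x).
Proof.
have dV : pnorm (dir th' - dir th) <= h by rewrite (le_trans (dir_lip _ _)).
have Ch0 : 0 <= C * (8 * h) ^+ 2 by rewrite mulr_ge0 ?sqr_ge0.
have RHS0 : 0 <= 4 * t + 8 / J%:R * \sum_(j < J) Phi j x.
  apply: addr_ge0; first by rewrite mulr_ge0 ?(ltW t0).
  by apply: mulr_ge0; [rewrite divr_ge0|apply: sumr_ge0 => j _; exact: Phi_ge0].
have rl := rad1; have rp := rad0; have erl := er.
have [x1|x1] := leP (pnorm x) 1; last first.
  rewrite (_ : (fun i => _) = fun=> 0); first by rewrite nsq_cst0; exact: mulr_ge0.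
  apply/funext => i; rewrite /W !u0 ?subrr ?sub0r; [|lra|lra].
  rewrite bavg_eq0 ?oppr0// => y yx.
  have H := pnorm_shift_ge x (y - x); rewrite [x + _]addrC subrK in H.
  by rewrite !u0 ?subrr//; lra.
set rhs := C * _ * _; rewrite -(bavg_cst s r0' rhs x).
apply: (@le_trans _ _ (bavg s r (fun y => nsq (fun i => W y i - W x i)) x)).
  rewrite /nsq bavg_sum; apply: ler_sum => i _.
  rewrite -sqrrN opprB.
  have -> : bavg s r (fun y => W y i) x - W x i = bavg s r (fun y => W y i - W x i) x.
    by rewrite bavgB bavg_cst.
  exact: sqr_bavg.
apply: bavg_le => // p q pr qr; set y := (s * p%:R, s * q%:R).
have ye : pnorm y <= s * r%:R by exact: pnorm_block.
have yd : pnorm y <= d by exact: le_trans ye ed.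
have y1 : pnorm y <= 1 by lra.
have da p' d' i j : K p' -> K (p' + d') -> K (p' + y) -> K (p' + d' + y) ->
    `|a (p' + d' + y) i j - a (p' + y) i j - a (p' + d') i j + a p' i j| <= t * pnorm d'.
  by move=> k1 k2 k3 k4; have [H _] := ddt yd k1 k2 k3 k4.
have df p' d' i : K p' -> K (p' + d') -> K (p' + y) -> K (p' + d' + y) ->
    `|f (p' + d' + y) i - f (p' + y) i - f (p' + d') i + f p' i| <= t * pnorm d'.
  by move=> k1 k2 k3 k4; have [_ H] := ddt yd k1 k2 k3 k4.
have bud : 8 / J%:R + 8 * pnorm (dir th' - dir th) + pnorm y <= eta / 2.
  by have := budget; lra.
apply: (le_trans (uW J0 (ltW t0) x1 y1 da df bud)).
have k1 : C * (8 * pnorm (dir th' - dir th)) ^+ 2 <= C * (8 * h) ^+ 2.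
  rewrite ler_wpM2l// ler_pXn2r// ?nnegrE ?mulr_ge0 ?pnorm_ge0 ?(ltW h0)//.
  by rewrite ler_pM2l.
have S0 : 0 <= \sum_(j < J) collar_ind K (eta / 2) (x + z j).
  by apply: sumr_ge0 => j _; exact: collar_ind_ge0.
have k2 : (t + pnorm y) ^+ 2 <= 4 * t.
  by have := pnorm_ge0 y; have := le_trans ye et; have := t0; have := t1; nra.
rewrite /rhs; apply: ler_pM => //.
- by rewrite mulr_ge0 ?sqr_ge0.
- by apply: addr_ge0; [exact: sqr_ge0|apply: mulr_ge0 S0; rewrite divr_ge0].
- rewrite lerD// le_eqVlt; apply/orP; left; apply/eqP; congr (_ * _).
  by apply: eq_bigr => j _; rewrite /Phi x1.
Qed.

(** Summed over the lattice, each [Phi j] is a translated collar count and contributes at most Vol /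
    J2 <= t Vol. The weight 8 / J over [J] nodes makes this 8 t Vol, in addition to 4 t Vol. *)
Lemma W_average : lsum s B (fun x => nsq (fun i => W x i - bavg s r (fun y => W y i) x)) <=
  C * (8 * h) ^+ 2 * (12 * t * Vol).
Proof.
apply: (le_trans (ler_lsum s B W_average_pointwise)); rewrite lsumZ.
have Ch0 : 0 <= C * (8 * h) ^+ 2 by rewrite mulr_ge0 ?sqr_ge0.
apply: ler_wpM2l => //.
have -> : lsum s B (fun x => 4 * t + 8 / J%:R * \sum_(j < J) Phi j x) =
    4 * t * Vol + 8 / J%:R * \sum_(j < J) lsum s B (Phi j).
  rewrite -lsum_sum -!lsumZ -lsumD; apply: eq_lsum => x.
  by rewrite mulr1.
have Sj (j : 'I_J) : lsum s B (Phi j) <= Vol / J2%:R.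
  have zb : pnorm (z j) <= 8.
    rewrite /z pnormZ -[leRHS]mulr1 ler_pM ?pnorm_ge0 ?dir_le1//.
    rewrite ler0_norm; last first.
      rewrite subr_le0 mulrCA ler_piMr// ler_pdivrMr ?ltr0n// mul1r ler_nat.
      by rewrite ltnW.
    by rewrite opprB lerBlDr lerDl mulr_ge0// divr_ge0.
  have room : 1 + 5 * pnorm (z j) + s <= s * B%:R by have := s_1; have := sB; lra.
  apply: le_trans Scol.
  apply: (@le_lsum_translate R s B (z j) (collar_ind K (eta / 2)) (collar_ind K eta) 1 s0 _ _ room).
    by move=> x y; exact: collar_ind_near.
  by move=> x; exact: collar_ind_ge0.
have V0 : 0 <= Vol by apply: lsum_ge0.
have A : \sum_(j < J) lsum s B (Phi j) <= J%:R * (Vol / J2%:R).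
  apply: (le_trans (ler_sum _ (fun j _ => Sj j))).
  by rewrite sumr_const card_ord -[_ *+ _]mulr_natl.
have J8' : 0 <= 8 / J%:R :> R by rewrite divr_ge0.
have := ler_wpM2l J8' A.
have -> : 8 / J%:R * (J%:R * (Vol / J2%:R)) = 8 * (Vol * J2%:R^-1).
  by field; rewrite !pnatr_eq0 -!lt0n ?J0 ?J20.
have := ler_wpM2l V0 J2t; lra.
Qed.

End Step.

End Planar.

Section PlanarUniqueness.
Variables (R : realType) (I : finType).
Local Notation P := (R * R)%type.

(** The ball of radius rho is a fixed fraction of the lattice box: it holds at least (rho / (2 s))^2
    of its (2 B)^2 points, and s B <= 101. *)
Lemma lsum_nsq_ge (f : P -> I -> R) (c rho s : R) (B : nat) : 0 <= c -> 0 < rho -> rho <= 1 ->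
  (forall x, pnorm x <= rho -> c <= nsq (f x)) -> 0 < s -> s <= rho / 2 ->
  50 <= s * B%:R -> s * B%:R <= 101 ->
  c * (rho ^+ 2 / (16 * 101 ^+ 2)) * lsum s B (fun=> 1) <= lsum s B (fun x => nsq (f x)).
Proof.
move=> c0 rho0 rho1 fc s0 srho sB sB'.
have rB : rho <= s * B%:R by lra.
have H := lsum_ball_ge s0 srho rB.
apply: (@le_trans _ _ (c * lsum s B (fun x => (pnorm x <= rho)%R%:R))); last first.
  rewrite -lsumZ; apply: ler_lsum => x.
  have [xr|xr] := boolP (pnorm x <= rho)%R; first by move: (fc x xr); rewrite mulr1.
  by rewrite mulr0 nsq_ge0.
rewrite -mulrA; apply: ler_wpM2l => //; apply: le_trans H.
have -> : (rho / (2 * s)) ^+ 2 = rho ^+ 2 * (4^-1 * s^-2) by field; rewrite gt_eqF.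
rewrite -mulrA; apply: ler_wpM2l; first exact: sqr_ge0.
rewrite lsum_cst mulr1 natrX -addnn natrD.
have s2 : 0 < s ^+ 2 by rewrite exprn_gt0.
have q : s ^+ 2 * B%:R ^+ 2 <= 101 ^+ 2.
  by rewrite -exprMn; apply: lerXn2r sB'; rewrite nnegrE ?mulr_ge0 ?(ltW s0).
rewrite -(ler_pM2r s2).
have -> : 4^-1 * s^-2 * s ^+ 2 = 4^-1 by rewrite mulfVK// gt_eqF.
have -> : (16 * 101 ^+ 2)^-1 * (B%:R + B%:R) ^+ 2 * s ^+ 2 = (4 * 101 ^+ 2)^-1 * (s ^+ 2 * B%:R ^+ 2) :> R.
  by field.
by rewrite ler_pdivrMl//; lra.
Qed.

Variables (a : P -> I -> I -> R) (f : P -> I -> R) (u : R -> P -> I -> R).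
Variables (K : P -> Prop) (A0 L rad r0 : R).
Hypotheses (L0 : 0 <= L) (rad0 : 0 < rad) (rad1 : rad <= 4^-1) (r00 : 0 < r0).
Hypothesis aA : forall x i j, `|a x i j| <= A0.
Hypothesis aL : forall x y i j, `|a x i j - a y i j| <= L * pnorm (x - y).
Hypothesis fL : forall x y i, `|f x i - f y i| <= L * pnorm (x - y).
Hypothesis ud : forall (th : R) (x : P) (t : R) i,
  is_derive t 1 (fun s => u th (x + s *: dir th) i)
    (mv (a (x + t *: dir th)) (u th (x + t *: dir th)) i + f (x + t *: dir th) i).
Hypothesis u0 : forall th (x : P) i, rad < pnorm x -> u th x i = 0.
Hypothesis f0 : forall (x : P) i, rad < pnorm x -> f x i = 0.
Hypothesis uper : forall th, u (th + 2 * pi) = u th.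
Hypothesis small : 512 * (#|I|%:R * A0) ^+ 2 * rad ^+ 2 <= 1.
Hypothesis Kconv : forall x y (t : R), K x -> K y -> 0 <= t <= 1 -> K (x + t *: (y - x)).
Hypothesis Kball : forall x, pnorm x <= r0 -> K x.
Hypothesis uK : forall th x, ~ K x -> forall i, u th x i = 0.
Hypothesis fK : forall x, ~ K x -> forall i, f x i = 0.
Hypothesis dd : forall e : R, 0 < e -> exists2 d, 0 < d & forall p q z,
  pnorm z <= d -> K p -> K (p + q) -> K (p + z) -> K (p + q + z) ->
  (forall i j, `|a (p + q + z) i j - a (p + z) i j - a (p + q) i j + a p i j| <= e * pnorm q) /\
  (forall i, `|f (p + q + z) i - f (p + z) i - f (p + q) i + f p i| <= e * pnorm q).

Lemma source_bounded x i : `|f x i| <= 3 * L.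
Proof.
have rl := rad1.
have [x1|x1] := leP (pnorm x) 1; last first.
  by rewrite f0 ?normr0 ?mulr_ge0//; lra.
have n2 : pnorm ((2, 0) : P) = 2 by rewrite pnorm_e1.
have := fL x (2, 0) i; rewrite (f0 (x := (2, 0))) ?n2 ?subr0; last by lra.
have := pnormD x (- (2, 0)); rewrite pnormN n2 => H1 H2.
by rewrite (le_trans H2)// mulrC ler_wpM2r//; lra.
Qed.

Lemma source_lower i0 : f 0 i0 != 0 -> exists c rho : R,
  [/\ 0 < c, 0 < rho, rho <= 1 & forall x, pnorm x <= rho -> c <= nsq (f x)].
Proof.
move=> fneq; pose c := `|f 0 i0|; have c0 : 0 < c by rewrite normr_gt0.
have L1 : 0 < 2 * (L + 1) by rewrite mulr_gt0// ltr_wpDl.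
exists (c ^+ 2 / 4), (Num.min 1 (c / (2 * (L + 1)))); split.
- by rewrite divr_gt0// exprn_gt0.
- by rewrite lt_min ltr01 divr_gt0.
- by rewrite ge_min lexx.
move=> x; rewrite le_min => /andP[_]; rewrite ler_pdivlMr// => xr.
have := fL x 0 i0; rewrite subr0 => fl.
have H : c / 2 <= `|f x i0|.
  have := lerB_dist (f 0 i0) (f x i0); rewrite distrC -/c.
  have := mulr_ge0 (pnorm_ge0 x) L0; have := pnorm_ge0 x; lra.
apply: le_trans (sqr_le_nsq (f x) i0).
rewrite -(real_normK (num_real (f x i0))).
by move: (`|_|) (c) c0 H => X Y *; nra.
Qed.

(** If [f] were nonzero at 0, its lattice energy would be at least a fixed multiple of the number of
    lattice points, against the bound [Q * t] times this number for arbitrarily small [t]. *)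
Theorem planar_uniqueness i0 : f 0 i0 = 0.
Proof.
have aux (Q t c : R) : 0 < t -> t * (Q + 1) <= c -> Q * t < c by lra.
apply: contrapT => /eqP fneq.
have rad_1 : rad <= 1 by apply: le_trans rad1 _; rewrite invf_le1// ler1n.
have Cf0 : 0 <= 3 * L by rewrite mulr_ge0.
have [C C0 [uC uL uW]] := transport_estimates L0 Cf0 rad_1 aA source_bounded aL fL ud u0 uK fK.
have [c [rho [c0 rho0 rho1 frho]]] := source_lower fneq.
pose c2 := c * (rho ^+ 2 / (16 * 101 ^+ 2)).
have c20 : 0 < c2 by apply: mulr_gt0 => //; apply: divr_gt0; [|apply: mulr_gt0]; rewrite ?exprn_gt0.
have [Q Q0 fin] := energy_bound_exists L0 C0 rad0 rad1 aA aL fL ud u0 uC uL uper small.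
have Q1 : 0 < Q + 1 by rewrite ltr_wpDl.
have [t [t0 t1 Qt]] : exists t : R, [/\ 0 < t, t <= 1 & Q * t < c2].
  exists (Num.min 1 (c2 / (Q + 1))); split.
  - by rewrite lt_min ltr01 divr_gt0.
  - by rewrite ge_min lexx.
  - have : Num.min 1 (c2 / (Q + 1)) <= c2 / (Q + 1) by rewrite ge_min lexx orbT.
    have tp : 0 < Num.min 1 (c2 / (Q + 1)) by rewrite lt_min ltr01 divr_gt0.
    by move: (Num.min _ _) tp => t tp; rewrite ler_pdivlMr//; exact: aux.
(* [J2] makes the proportion of collar points at most [t] and fixes the collar width r0 / (8 J2);
   the scales follow, and the lattice step comes last from the counting. *)
have [J2 J20 J2t] := exists_nat_ge t^-1.
have J2p : 0 < J2%:R :> R by rewrite ltr0n.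
have J2i : J2%:R^-1 <= t by rewrite -[t]invrK lef_pV2 ?posrE ?invr_gt0.
have eta0 : 0 < r0 / (8 * J2%:R) by rewrite divr_gt0// mulr_gt0.
have [d d0 ddt] := dd t0.
have [h [sg [so [J [M [r [B [[J0 M0 r1 so0] [[h0 h1 Mh sg0 sg1] sc]]]]]]]]] :=
  lattice_scales rad0 rad1 t0 t1 d0 eta0 rho0.
have [s ss Scol] := collar_count r00 Kconv Kball B J20 so0.
have [[s0 ssg seta srho] [[er et ed sB sB'] [het sgt budget]]] := sc s ss.
have s_1 : s <= 1 by rewrite (le_trans ssg)// exprn_ile1// ltW.
have VE : lsum s B (fun=> 1 : R) = (B.*2 ^ 2)%:R by rewrite lsum_cst mulr1.
rewrite -VE in Scol.
have fin' := fin s h sg t B r M s0 r1 M0 er sB h0 h1 Mh sg0 sg1 ssg t0 t1 et het sgt _.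
have low := lsum_nsq_ge (ltW c0) rho0 rho1 frho s0 srho sB sB'.
rewrite -/c2 in low.
have Vp : 0 < lsum s B (fun=> 1 : R).
  rewrite VE ltr0n expn_gt0 double_gt0 orbC /=.
  by case: (B) sB => //; rewrite mulr0 leNgt ltr0n.
have : c2 * lsum s B (fun=> 1) <= Q * t * lsum s B (fun=> 1).
  apply: (le_trans low); apply: fin' => k kM.
  apply: (W_average rad0 rad1 u0 C0 t0 t1 J20 J2i uW ddt (eta := r0 / (8 * J2%:R)) (r := r) (J := J)) => //.
  by rewrite -mulrBl -natrB// subSnn mul1r gtr0_norm.
by rewrite ler_pM2r// leNgt Qt.
Qed.

End PlanarUniqueness.

(** * Linear ordinary differential equations *)

Section Primitive.
Variable R : realType.

Lemma local_primitive (h : R -> R) (m : R) : 0 < m -> continuous h ->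
  exists G : R -> R, forall x, - m < x < m -> is_derive x 1 G (h x).
Proof.
move=> m0 hc; pose mu := @lebesgue_measure R.
exists (fun x => (\int[mu]_(t in `[- m, x]) h t)%R) => x /andP[mx xm].
have hi : mu.-integrable `[- m, m] (EFin \o h).
  apply: continuous_compact_integrable; first exact: segment_compact.
  by apply: continuous_subspaceT.
have [dG GE] := @continuous_FTC1_closed R h (- m) x m xm hi mx (hc x).
by rewrite -GE derive1E; exact: DeriveDef.
Qed.

Lemma eq_derive_itv (f g df : R -> R) (m x y : R) :
  (forall x, - m < x < m -> is_derive x 1 f (df x)) ->
  (forall x, - m < x < m -> is_derive x 1 g (df x)) ->
  - m < x < m -> - m < y < m -> f x - f y = g x - g y.
Proof.
move=> fd gd; wlog xy : x y / x <= y => [H xm ym|].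
  have [xy|/ltW xy] := leP x y; first exact: H.
  by have := H y x xy ym xm; lra.
move=> /andP[mx xm] /andP[my ym].
have key (F G : R -> R) : (forall x, - m < x < m -> is_derive x 1 F (df x)) ->
  (forall x, - m < x < m -> is_derive x 1 G (df x)) -> F y - G y <= F x - G x.
  move=> Fd Gd.
  have D z : z \in `[x, y] -> is_derive z 1 (fun t => F t - G t) 0.
    rewrite in_itv/= => /andP[xz zy].
    have zm : - m < z < m by rewrite (lt_le_trans mx)//= (le_lt_trans zy).
    by have := is_deriveB (Fd z zm) (Gd z zm); rewrite subrr.
  have D1 z : z \in `]x, y[ -> is_derive z 1 (fun t => F t - G t) 0.
    by move=> zx; apply: D; exact: subset_itv_oo_cc zx.
  have D2 := @is_derive_within R (fun t => F t - G t) (fun=> 0) x y D.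
  have D3 z : z \in `]x, y[ -> 0 <= 0 :> R by move=> _; exact: lexx.
  exact: (@derive_le0_le R (fun t => F t - G t) (fun=> 0) x y xy D1 D2 D3).
by have := key f g fd gd; have := key g f gd fd; lra.
Qed.

(** Primitives on the intervals ]-m, m[ agree where both exist once they are normalised at 0; the
    interval used at [x] reaches beyond |x| by 1. *)
Lemma primitive (h : R -> R) : continuous h ->
  exists2 p : R -> R, p 0 = 0 & forall x : R, is_derive x 1 p (h x).
Proof.
move=> hc.
have /choice[G Gd] (m : R) : exists G : R -> R, 0 < m -> forall x : R, - m < x < m -> is_derive x 1 G (h x).
  have [m0|] := ltP 0 m; last by exists h.
  by have [G GP] := local_primitive m0 hc; exists G.
exists (fun x => G (`|x| + 1) x - G (`|x| + 1) 0) => [|x]; first by rewrite subrr.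
have p0 (y : R) : 0 < `|y| + 1 by rewrite ltr_wpDl.
have p2 : 0 < `|x| + 2 by rewrite ltr_wpDl.
have i0 (m : R) : 0 < m -> - m < 0 < m by move=> m0; rewrite oppr_lt0 m0.
have H : is_derive x 1 (fun y => G (`|x| + 2) y - G (`|x| + 2) 0) (h x).
  have xm : - (`|x| + 2) < x < `|x| + 2 by rewrite -ltr_norml ltrDl.
  by have := is_deriveB (Gd _ p2 x xm) (is_derive_cst (G (`|x| + 2) 0) x 1); rewrite subr0.
apply: near_eq_is_derive H => //; near=> y.
have yx : `|y| <= `|x| + 1.
  have yx : `|x - y| < 1 by near: y; exact: (@cvgr_dist_lt _ R).
  by rewrite -lerBlDl; have := lerB_dist y x; rewrite distrC => /le_trans; apply; exact: ltW.
have im : - (`|y| + 1) < y < `|y| + 1 by rewrite -ltr_norml ltrDl.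
apply: (@eq_derive_itv _ _ h (`|y| + 1)) => //; last exact: i0; last exact: Gd.
move=> z; rewrite -ltr_norml => zy; apply: Gd => //; rewrite -ltr_norml.
by rewrite (lt_le_trans zy)//; lra.
Unshelve. all: by end_near. Qed.

(** The intervals of radius [e k] about [x k] are nested, as the radius halves at each step; the
    limit is the supremum of the left ends. *)
Lemma geometric_limit (x : nat -> R) (c : R) : 0 <= c ->
  (forall k, `|x k.+1 - x k| <= c * 2^-1 ^+ k) ->
  exists l, forall k, `|x k - l| <= 2 * c * 2^-1 ^+ k.
Proof.
move=> c0 xc; pose e k : R := 2 * c * 2^-1 ^+ k.
have eS k : e k.+1 = c * 2^-1 ^+ k by rewrite /e exprS; field.
have e2 k : e k = 2 * (c * 2^-1 ^+ k) by rewrite /e mulrA.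
have st k : x k - e k <= x k.+1 - e k.+1 /\ x k.+1 + e k.+1 <= x k + e k.
  by have := xc k; rewrite eS e2 ler_norml => /andP[]; split; lra.
have lo k m : x k - e k <= x (k + m)%N - e (k + m)%N.
  elim: m => [|m IH]; first by rewrite addn0.
  by rewrite addnS; apply: le_trans IH (st _).1.
have hi k m : x (k + m)%N + e (k + m)%N <= x k + e k.
  elim: m => [|m IH]; first by rewrite addn0.
  by rewrite addnS; apply: le_trans (st _).2 IH.
have e0 k : 0 <= e k by apply: mulr_ge0; [exact: mulr_ge0|apply: exprn_ge0; rewrite invr_ge0].
have cross k m : x k - e k <= x m + e m.
  have := lo k m; have := hi m k; rewrite [(m + k)%N]addnC.
  by have := e0 (k + m)%N; lra.
pose S := [set y | exists k, y = x k - e k].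
have Sub m : ubound S (x m + e m) by move=> _ [k ->].
have Ssup : has_sup S by split; [exists (x 0 - e 0), 0%N | exists (x 0 + e 0)].
exists (sup S) => k; rewrite ler_norml -/(e k).
have H1 : sup S <= x k + e k by apply: ge_sup (Sub k); case: Ssup.
have H2 : x k - e k <= sup S by apply: (sup_upper_bound Ssup); exists k.
by apply/andP; split; lra.
Qed.

Lemma is_derive_expRZ (k x : R) : is_derive x 1 (fun t => expR (k * t)) (k * expR (k * x)).
Proof.
have H : is_derive x 1 (fun t => k * t) k.
  by have := is_derive_affine k 0 x; under eq_fun do rewrite addr0.
have K := is_derive_expR (k * x).
by apply: is_derive_eq; rewrite mulrC.
Qed.

(** Integration gains the factor 1 / l on an exponential weight of rate [l], which is what makes the
    Picard map contract. *)
Lemma primitive_le_exp (h p : R -> R) (c l : R) : 0 <= c -> 0 < l -> p 0 = 0 ->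
  (forall x : R, is_derive x 1 p (h x)) ->
  (forall x, `|h x| <= c * expR (l * `|x|)) ->
  forall x, `|p x| <= c / l * expR (l * `|x|).
Proof.
move=> c0 l0.
have pos (h1 p1 : R -> R) : p1 0 = 0 -> (forall x : R, is_derive x 1 p1 (h1 x)) ->
  (forall x, `|h1 x| <= c * expR (l * `|x|)) -> forall x : R, 0 <= x -> p1 x <= c / l * expR (l * x).
  move=> p0 pd hb x x0.
  have D (z : R) : is_derive z 1 (fun t => p1 t - c / l * expR (l * t)) (h1 z - c * expR (l * z)).
    have E := is_deriveMr (is_derive_cst (c / l) z 1) (is_derive_expRZ l z).
    have := is_deriveB (pd z) E; rewrite mul0r add0r mulrA divfK ?gt_eqF//.
  have D1 z : z \in `]0, x[ -> is_derive z 1 (fun t => p1 t - c / l * expR (l * t)) (h1 z - c * expR (l * z)).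
    by [].
  have D2 := @is_derive_within R _ _ 0 x (fun z _ => D z).
  have D3 z : z \in `]0, x[ -> h1 z - c * expR (l * z) <= 0.
    rewrite in_itv/= => /andP[z0 _]; have := hb z; rewrite (gtr0_norm z0) subr_le0.
    by apply: le_trans; exact: ler_norm.
  have := @derive_le0_le R _ _ 0 x x0 D1 D2 D3.
  rewrite p0 mulr0 expR0 mulr1; have : 0 <= c / l by rewrite divr_ge0 ?(ltW l0).
  by lra.
have posN (h1 p1 : R -> R) : p1 0 = 0 -> (forall x : R, is_derive x 1 p1 (h1 x)) ->
  (forall x, `|h1 x| <= c * expR (l * `|x|)) -> forall x : R, 0 <= x -> `|p1 x| <= c / l * expR (l * x).
  move=> p0 pd hb x x0; rewrite ler_norml lerNl (pos h1 p1)// andbT.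
  apply: (pos (fun t => - h1 t) (fun t => - p1 t)) => //; first by rewrite p0 oppr0.
  by move=> t; rewrite normrN.
move=> p0 pd hb x; have [x0|x0] := leP 0 x.
  by have := posN h p p0 pd hb x x0; rewrite (ger0_norm x0).
have N (t : R) : is_derive t 1 (fun s : R => - s) (-1).
  by have := is_derive_affine (-1) 0 t; under eq_fun do rewrite addr0 mulN1r.
have D (t : R) : is_derive t 1 (fun s => p (- s)) (- h (- t)).
  by have := @is_derive1_comp R p (fun s => - s) t _ _ (pd (- t)) (N t); rewrite mulrN1.
have x0' : 0 <= - x by rewrite oppr_ge0 ltW.
have := posN (fun t => - h (- t)) (fun t => p (- t)) _ D _ (- x) x0'.
rewrite /= oppr0 opprK (ltr0_norm x0); apply => // t.
by rewrite normrN -[`|t|]normrN.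
Qed.

End Primitive.

(** * Global Picard iteration in an exponentially weighted norm *)

Section Picard.
Variables (R : realType) (I : finType) (M : R -> I -> I -> R) (g : R -> I -> R) (A G : R).
Hypotheses (A0 : 0 <= A) (G0 : 0 <= G).
Hypothesis Mc : forall i j, continuous (fun t => M t i j).
Hypothesis gc : forall i, continuous (fun t => g t i).
Hypothesis MA : forall t i j, `|M t i j| <= A.
Hypothesis gG : forall t i, `|g t i| <= G.

Let cnt (y : R -> I -> R) := forall i, continuous (fun t => y t i).
Let l : R := 2 * (#|I|%:R * A + 1).

Lemma mv_continuous y : cnt y -> forall i, continuous (fun t => mv (M t) (y t) i + g t i).
Proof.
move=> yc i t; apply: continuousD; last exact: gc.
rewrite /mv; apply: cvg_big => [|j _]; first exact: add_continuous.
apply: continuousM; first exact: Mc.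
exact: yc.
Qed.

Lemma mv_bound (v : I -> R) (c : R) t : (forall i, `|v i| <= c) ->
  forall i, `|mv (M t) v i| <= #|I|%:R * A * c.
Proof.
move=> vc i; apply: (le_trans (ler_norm_sum _ _ _)).
apply: (@le_trans _ _ (\sum_(j : I) A * c)).
  by apply: ler_sum => j _; rewrite normrM ler_pM.
by rewrite sumr_const -[_ *+ _]mulr_natl mulrA.
Qed.

Lemma picard_step (y0 : I -> R) (y : R -> I -> R) : cnt y -> exists z : R -> I -> R,
  z 0 = y0 /\ forall (t : R) i, is_derive t 1 (fun s => z s i) (mv (M t) (y t) i + g t i).
Proof.
move=> yc.
have /choice[p pP] i : exists p : R -> R, p 0 = 0 /\
    forall x : R, is_derive x 1 p (mv (M x) (y x) i + g x i).
  by have [p] := primitive (@mv_continuous y yc i); exists p.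
exists (fun t i => p i t + y0 i); split.
  by apply/funext => i; rewrite (pP i).1 add0r.
move=> t i; have := is_deriveD ((pP i).2 t) (is_derive_cst (y0 i) t 1).
by rewrite addr0.
Qed.

(* The weight [expR (l * `|t|)] makes the Picard map a contraction by 1/2 on the
   whole line. *)
Lemma picard_contract (y y' z z' : R -> I -> R) (c : R) : 0 <= c ->
  z 0 = z' 0 ->
  (forall (t : R) i, is_derive t 1 (fun s => z s i) (mv (M t) (y t) i + g t i)) ->
  (forall (t : R) i, is_derive t 1 (fun s => z' s i) (mv (M t) (y' t) i + g t i)) ->
  (forall t i, `|y t i - y' t i| <= c * expR (l * `|t|)) ->
  forall t i, `|z t i - z' t i| <= c / 2 * expR (l * `|t|).
Proof.
move=> c0 zz zd zd' yy t i.
have B0 : 0 <= #|I|%:R * A by rewrite mulr_ge0.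
have l0 : 0 < l by rewrite mulr_gt0// ltr_wpDl.
pose h (t : R) := mv (M t) (fun i => y t i - y' t i) i.
have D (x : R) : is_derive x 1 (fun s => z s i - z' s i) (h x).
  have := is_deriveB (zd x i) (zd' x i); rewrite /h mvB.
  by rewrite opprD addrACA subrr addr0.
have hb (x : R) : `|h x| <= c * l / 2 * expR (l * `|x|).
  have := mv_bound x (yy x) i; rewrite -/(h x) => /le_trans; apply.
  rewrite mulrA; apply: ler_wpM2r; first exact: expR_ge0.
  rewrite mulrC -mulrA; apply: ler_wpM2l => //.
  by rewrite /l; lra.
have cl : 0 <= c * l / 2 by rewrite divr_ge0// mulr_ge0// ltW.
have := @primitive_le_exp R h (fun s => z s i - z' s i) _ l cl l0 _ D hb t.
rewrite zz subrr => /(_ erefl); rewrite (_ : c * l / 2 / l = c / 2)//.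
by field; rewrite gt_eqF.
Qed.

Lemma picard (y0 : I -> R) : exists y : R -> I -> R,
  y 0 = y0 /\ forall (t : R) i, is_derive t 1 (fun s => y s i) (mv (M t) (y t) i + g t i).
Proof.
(* A total Picard map; for discontinuous curves it has an arbitrary value about which nothing is
   claimed. *)
have /choice[T TP] y : exists z : R -> I -> R, cnt y -> z 0 = y0 /\
    forall (t : R) i, is_derive t 1 (fun s => z s i) (mv (M t) (y t) i + g t i).
  have [yc|nyc] := pselect (cnt y); last by exists y.
  by have [z zP] := picard_step y0 yc; exists z.
pose Y k := iter k T (fun=> y0).
have Yc k : cnt (Y k).
  elim: k => [|k IH] i t; first exact: cst_continuous.
  exact: is_derive_cont ((TP _ IH).2 t i).
have Y0 k : Y k 0 = y0 by case: k => [//|k]; exact: (TP _ (Yc k)).1.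
pose c0 : R := #|I|%:R * A * (\sum_i `|y0 i|) + G.
have S0 : 0 <= \sum_i `|y0 i| by apply: sumr_ge0.
have B0 : 0 <= #|I|%:R * A by rewrite mulr_ge0.
have c00 : 0 <= c0 by rewrite addr_ge0// mulr_ge0.
have l1 : 1 <= l by rewrite /l; lra.
have l0 : 0 < l by apply: lt_le_trans l1.
have Yd k t i : `|Y k.+1 t i - Y k t i| <= (c0 * expR (l * `|t|)) * 2^-1 ^+ k.
  elim: k t i => [|k IH] t i.
    rewrite expr0 mulr1.
    have hb (x : R) : `|mv (M x) y0 i + g x i| <= c0 * expR (l * `|x|).
      apply: (@le_trans _ _ c0); last first.
        by rewrite ler_peMr// -expR0 ler_expR mulr_ge0// ltW.
      apply: (le_trans (ler_normD _ _)); apply: lerD (gG _ _).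
      apply: mv_bound => j; rewrite (bigD1 j)//= lerDl; exact: sumr_ge0.
    have D (x : R) : is_derive x 1 (fun s => Y 1%N s i - y0 i) (mv (M x) y0 i + g x i).
      have := is_deriveB ((TP _ (Yc 0%N)).2 x i) (is_derive_cst (y0 i) x 1).
      by rewrite subr0.
    have := @primitive_le_exp R _ _ c0 l c00 l0 _ D hb t.
    rewrite Y0 subrr => /(_ erefl) /le_trans; apply.
    by apply: ler_wpM2r; [exact: expR_ge0|rewrite ler_pdivrMr// ler_peMr].
  have cb : 0 <= c0 * 2^-1 ^+ k by rewrite mulr_ge0// exprn_ge0// invr_ge0.
  have IH' s j : `|Y k.+1 s j - Y k s j| <= c0 * 2^-1 ^+ k * expR (l * `|s|).
    by rewrite mulrAC; exact: IH.
  have YS : Y k.+2 0 = Y k.+1 0 by rewrite !Y0.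
  have := picard_contract cb YS (TP _ (Yc k.+1)).2 (TP _ (Yc k)).2 IH' t i.
  have -> // : c0 * 2^-1 ^+ k / 2 * expR (l * `|t|) = c0 * expR (l * `|t|) * 2^-1 ^+ k.+1.
  by rewrite exprS; field.
pose E (t : R) := c0 * expR (l * `|t|).
have E0 (t : R) : 0 <= E t by rewrite mulr_ge0// expR_ge0.
have /choice[y yP] (t : R) : exists yt : I -> R, forall i k, `|Y k t i - yt i| <= 2 * E t * 2^-1 ^+ k.
  have /choice[yt ytP] i := geometric_limit (E0 t) (fun k => Yd k t i).
  by exists yt.
have small (e c : R) : 0 < e -> 0 <= c -> exists k, c * 2^-1 ^+ k < e.
  move=> e0 c1; have c2 : 0 < c + 1 by rewrite ltr_wpDl.
  have : (fun k => (2^-1 : R) ^+ k) @ \oo --> 0.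
    by apply: cvg_expr; rewrite ger0_norm ?invr_ge0// invf_lt1 ?ltr1n.
  move=> /cvgrPdist_lt /(_ (e / (c + 1))) []; first by rewrite divr_gt0.
  move=> k _ /(_ k (leqnn k)); rewrite /= sub0r normrN => kP; exists k.
  have p0 : 0 <= (2^-1 : R) ^+ k by rewrite exprn_ge0// invr_ge0.
  by move: kP; rewrite ger0_norm// ltr_pdivlMr//; nra.
have yc : cnt y.
  move=> i t; apply/cvgrPdist_lt => e e0.
  pose b := c0 * expR (l * (`|t| + 1)).
  have [k kP] : exists k, 2 * b * 2^-1 ^+ k < e / 4.
    by apply: small; rewrite ?divr_gt0// mulr_ge0// mulr_ge0// expR_ge0.
  have Eb s : `|s| <= `|t| + 1 -> `|Y k s i - y s i| < e / 4.
    move=> st; apply: le_lt_trans (yP s i k) _; apply: le_lt_trans kP.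
    apply: ler_wpM2r; first by rewrite exprn_ge0// invr_ge0.
    apply: ler_wpM2l => //; apply: ler_wpM2l => //.
    by rewrite ler_expR ler_wpM2l// ltW.
  near=> s.
  have H1 : `|Y k t i - Y k s i| < e / 4.
    near: s; apply: (@cvgr_dist_lt R) => //; first exact: Yc.
    by rewrite divr_gt0.
  have st : `|t - s| < 1 by near: s; exact: (@cvgr_dist_lt _ R).
  have H2 := Eb t _; have H3 := Eb s _.
  have := ler_distD (Y k t i) (y t i) (y s i); have := ler_distD (Y k s i) (Y k t i) (y s i).
  rewrite (distrC (y t i) (Y k t i)).
  have tt : `|t| <= `|t| + 1 by rewrite lerDl.
  have ss : `|s| <= `|t| + 1.
    by rewrite -lerBlDl; have := lerB_dist s t; rewrite distrC => /le_trans; apply; exact: ltW.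
  by have := H2 tt; have := H3 ss; lra.
have [z0 zd] := TP y yc.
(* The limit is a fixed point, since [T y] and [y] are both within arbitrarily small distance of the
   iterates at each time. *)
suff E1 : T y = y by rewrite E1 in z0 zd; exists y.
apply/funext => t; apply/funext => i; apply/eqP; rewrite -subr_eq0 -normr_le0 distrC.
rewrite leNgt; apply/negP => e0.
have E3 : 0 <= 3 * E t by exact: mulr_ge0.
have [k kP] := small _ (3 * E t) e0 E3.
have cb : 0 <= 2 * c0 * 2^-1 ^+ k by rewrite mulr_ge0 ?mulr_ge0// exprn_ge0// invr_ge0.
have yy s j : `|Y k s j - y s j| <= 2 * c0 * 2^-1 ^+ k * expR (l * `|s|).
  by have := yP s j k; rewrite /E mulrA mulrAC.
have H1 := picard_contract cb (etrans (Y0 k.+1) (esym z0)) (TP _ (Yc k)).2 zd yy t i.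
have H2 := yP t i k.+1.
have := ler_distD (Y k.+1 t i) (y t i) (T y t i); rewrite (distrC (y t i) (Y k.+1 t i)).
have e1 : 2 * E t * 2^-1 ^+ k.+1 = E t * 2^-1 ^+ k by rewrite exprS; field.
have e2 : 2 * c0 * 2^-1 ^+ k / 2 * expR (l * `|t|) = E t * 2^-1 ^+ k by rewrite /E; field.
rewrite e1 in H2; rewrite e2 in H1.
have p1 : 0 <= E t * 2^-1 ^+ k by rewrite mulr_ge0// exprn_ge0// invr_ge0.
by move: kP; rewrite -mulrA; lra.
Unshelve. all: by end_near. Qed.

End Picard.

Theorem linear_ode (R : realType) (I : finType) (M : R -> I -> I -> R) (g : R -> I -> R)
    (A G t0 : R) (y0 : I -> R) : 0 <= A -> 0 <= G ->
  (forall i j, continuous (fun t => M t i j)) -> (forall i, continuous (fun t => g t i)) ->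
  (forall t i j, `|M t i j| <= A) -> (forall t i, `|g t i| <= G) ->
  exists y : R -> I -> R, y t0 = y0 /\
  forall (t : R) i, is_derive t 1 (fun s => y s i) (mv (M t) (y t) i + g t i).
Proof.
move=> A0 G0 Mc gc MA gG.
have sc (h : R -> R) : continuous h -> continuous (fun t => h (t + t0)).
  move=> hc t; apply: (@continuous_comp R R R (fun t => t + t0) h); last exact: hc.
  by apply: continuousD; [exact: cvg_id|exact: cvg_cst].
have [z [z0 zd]] := picard A0 G0 (fun i j => sc _ (Mc i j)) (fun i => sc _ (gc i))
  (fun t => MA (t + t0)) (fun t => gG (t + t0)) y0.
exists (fun t => z (t - t0)); rewrite subrr; split=> // t i.
have S : is_derive t 1 (fun s : R => s - t0) 1.
  by have := is_derive_affine 1 (- t0) t; under eq_fun do rewrite mul1r.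
have := @is_derive1_comp R (fun s => z s i) (fun s => s - t0) t _ _ (zd (t - t0) i) S.
by rewrite mulr1 subrK.
Qed.

Local Open Scope complex_scope.
Local Open Scope sesquilinear_scope.

(** * Schrodinger propagators *)

Section ComplexDerivative.
Variable R : realType.
Local Notation C := R[i].
Implicit Types (z w : R -> C) (t : R).

Lemma conjCE (x : C) : Num.conj x = conjc x. Proof. by []. Qed.

Lemma Re_mul (x y : C) : complex.Re (x * y) = complex.Re x * complex.Re y - complex.Im x * complex.Im y.
Proof. by case: x y => [a b] [c d]. Qed.

Lemma Im_mul (x y : C) : complex.Im (x * y) = complex.Re x * complex.Im y + complex.Im x * complex.Re y.
Proof. by case: x y => [a b] [c d]. Qed.

Lemma Re_conjc (x : C) : complex.Re (conjc x) = complex.Re x. Proof. by case: x. Qed.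
Lemma Im_conjc (x : C) : complex.Im (conjc x) = - complex.Im x. Proof. by case: x. Qed.
Lemma Re_add (x y : C) : complex.Re (x + y) = complex.Re x + complex.Re y.
Proof. by case: x y => [a b] [c d]. Qed.
Lemma Im_add (x y : C) : complex.Im (x + y) = complex.Im x + complex.Im y.
Proof. by case: x y => [a b] [c d]. Qed.

Lemma ReIm_eq (x y : C) : complex.Re x = complex.Re y -> complex.Im x = complex.Im y -> x = y.
Proof. by case: x y => [a b] [c d] /= -> ->. Qed.

Lemma Re_sum (I : finType) (F : I -> C) : complex.Re (\sum_i F i) = \sum_i complex.Re (F i).
Proof. by apply: (big_morph (@complex.Re R) Re_add). Qed.
Lemma Im_sum (I : finType) (F : I -> C) : complex.Im (\sum_i F i) = \sum_i complex.Im (F i).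
Proof. by apply: (big_morph (@complex.Im R) Im_add). Qed.

Definition cderiv z t (dz : C) :=
  is_derive t 1 (fun s => complex.Re (z s)) (complex.Re dz) /\
  is_derive t 1 (fun s => complex.Im (z s)) (complex.Im dz).

Lemma cderiv_cst (c : C) t : cderiv (fun=> c) t 0.
Proof. by split; exact: is_derive_cst. Qed.

Lemma cderivM z w t dz dw : cderiv z t dz -> cderiv w t dw ->
  cderiv (fun s => z s * w s) t (dz * w t + z t * dw).
Proof.
move=> [rz iz] [rw iw]; split.
  under eq_fun do rewrite Re_mul; rewrite Re_add !Re_mul.
  have := is_deriveB (is_deriveMr rz rw) (is_deriveMr iz iw).
  by move=> H; apply: (is_derive_eq H); ring.
under eq_fun do rewrite Im_mul; rewrite Im_add !Im_mul.
have := is_deriveD (is_deriveMr rz iw) (is_deriveMr iz rw).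
by move=> H; apply: (is_derive_eq H); ring.
Qed.

Lemma cderivD z w t dz dw : cderiv z t dz -> cderiv w t dw ->
  cderiv (fun s => z s + w s) t (dz + dw).
Proof.
move=> [rz iz] [rw iw]; split.
  by under eq_fun do rewrite Re_add; rewrite Re_add; exact: is_deriveD.
by under eq_fun do rewrite Im_add; rewrite Im_add; exact: is_deriveD.
Qed.

Lemma cderivN z t dz : cderiv z t dz -> cderiv (fun s => - z s) t (- dz).
Proof.
have rN (x : C) : complex.Re (- x) = - complex.Re x /\ complex.Im (- x) = - complex.Im x by case: x.
move=> [rz iz]; split.
  by under eq_fun do rewrite (rN _).1; rewrite (rN _).1; exact: is_deriveN.
by under eq_fun do rewrite (rN _).2; rewrite (rN _).2; exact: is_deriveN.
Qed.

Lemma cderivJ z t dz : cderiv z t dz -> cderiv (fun s => conjc (z s)) t (conjc dz).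
Proof.
move=> [rz iz]; split.
  by under eq_fun do rewrite Re_conjc; rewrite Re_conjc.
by under eq_fun do rewrite Im_conjc; rewrite Im_conjc; exact: is_deriveN.
Qed.

Lemma cderiv_sum (I : finType) (z : I -> R -> C) t (dz : I -> C) :
  (forall i, cderiv (z i) t (dz i)) ->
  cderiv (fun s => \sum_i z i s) t (\sum_i dz i).
Proof.
move=> H; split.
  under eq_fun do rewrite Re_sum; rewrite Re_sum.
  by apply: is_derive_bigsum => i; exact: (H i).1.
under eq_fun do rewrite Im_sum; rewrite Im_sum.
by apply: is_derive_bigsum => i; exact: (H i).2.
Qed.

Definition ccont (A : set R) z :=
  {within A, continuous (fun s => complex.Re (z s))} /\
  {within A, continuous (fun s => complex.Im (z s))}.

Lemma ccontM (A : set R) z w : ccont A z -> ccont A w -> ccont A (fun s => z s * w s).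
Proof.
move=> [rz iz] [rw iw]; split.
  under eq_fun do rewrite Re_mul.
  by move=> x; apply: cvgB; apply: cvgM; [exact: rz|exact: rw|exact: iz|exact: iw].
under eq_fun do rewrite Im_mul.
by move=> x; apply: cvgD; apply: cvgM; [exact: rz|exact: iw|exact: iz|exact: rw].
Qed.

Lemma ccontB (A : set R) z w : ccont A z -> ccont A w -> ccont A (fun s => z s - w s).
Proof.
have rB (x y : C) : complex.Re (x - y) = complex.Re x - complex.Re y /\
  complex.Im (x - y) = complex.Im x - complex.Im y by case: x y => [? ?] [? ?].
move=> [rz iz] [rw iw]; split.
  by under eq_fun do rewrite (rB _ _).1; move=> x; apply: cvgB; [exact: rz|exact: rw].
by under eq_fun do rewrite (rB _ _).2; move=> x; apply: cvgB; [exact: iz|exact: iw].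
Qed.

Lemma ccontJ (A : set R) z : ccont A z -> ccont A (fun s => conjc (z s)).
Proof.
move=> [rz iz]; split; first by under eq_fun do rewrite Re_conjc.
by under eq_fun do rewrite Im_conjc; move=> x; apply: cvgN; exact: iz.
Qed.

Lemma ccont_sum (I : finType) (A : set R) (z : I -> R -> C) :
  (forall i, ccont A (z i)) -> ccont A (fun s => \sum_i z i s).
Proof.
move=> H; split.
  under eq_fun do rewrite Re_sum.
  move=> x; apply: cvg_big => [|i _]; first exact: add_continuous.
  exact: ((H i).1 x).
under eq_fun do rewrite Im_sum.
move=> x; apply: cvg_big => [|i _]; first exact: add_continuous.
exact: ((H i).2 x).
Qed.

Lemma cderiv_ccont (A : set R) z dz : (forall t, cderiv z t (dz t)) -> ccont A z.
Proof.
move=> H; split; apply: continuous_subspaceT => t.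
  exact: is_derive_cont (H t).1.
exact: is_derive_cont (H t).2.
Qed.

Lemma derive0_cst (f : R -> R) (T : R) : 0 <= T ->
  (forall t, t \in `]0, T[ -> is_derive t 1 f 0) ->
  {within `[0, T], continuous f} -> f T = f 0.
Proof.
move=> T0 fd fc; apply/eqP; rewrite eq_le; apply/andP; split.
  by apply: (@derive_le0_le R f (fun=> 0) 0 T T0 fd fc) => *; exact: lexx.
have fd' t : t \in `]0, T[ -> is_derive t 1 (fun s => - f s) 0.
  by move=> /fd ft; have := is_deriveN ft; rewrite oppr0.
have fc' : {within `[0, T], continuous (fun s => - f s)}.
  by move=> x; apply: continuousN; exact: fc.
have := @derive_le0_le R (fun s => - f s) (fun=> 0) 0 T T0 fd' fc'.
by rewrite lerN2; apply => *; exact: lexx.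
Qed.

Lemma cderiv0_cst z (T : R) : 0 <= T -> (forall t, t \in `]0, T[ -> cderiv z t 0) ->
  ccont `[0, T] z -> z T = z 0.
Proof.
move=> T0 zd [rc ic].
apply: ReIm_eq.
  by apply: (@derive0_cst (fun s => complex.Re (z s)) T T0 _ rc) => t /zd [].
by apply: (@derive0_cst (fun s => complex.Im (z s)) T T0 _ ic) => t /zd [].
Qed.

Definition mderiv m n (M : R -> 'M[C]_(m, n)) t (dM : 'M[C]_(m, n)) :=
  forall i j, cderiv (fun s => M s i j) t (dM i j).
Definition mcont m n (A : set R) (M : R -> 'M[C]_(m, n)) :=
  forall i j, ccont A (fun s => M s i j).

Lemma mderivM m n p (A : R -> 'M[C]_(m, n)) (B : R -> 'M[C]_(n, p)) t dA dB :
  mderiv A t dA -> mderiv B t dB ->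
  mderiv (fun s => A s *m B s) t (dA *m B t + A t *m dB).
Proof.
move=> Ad Bd i k; under eq_fun do rewrite mxE.
rewrite !mxE -big_split; apply: cderiv_sum => j; exact: cderivM.
Qed.

Lemma mderivJ m n (A : R -> 'M[C]_(m, n)) t dA : mderiv A t dA ->
  mderiv (fun s => (A s)^t*) t (dA^t*).
Proof. by move=> Ad i j; under eq_fun do rewrite !mxE; rewrite !mxE; exact: cderivJ. Qed.

Lemma mcontM m n p D (A : R -> 'M[C]_(m, n)) (B : R -> 'M[C]_(n, p)) :
  mcont D A -> mcont D B -> mcont D (fun s => A s *m B s).
Proof.
move=> Ad Bd i k; under eq_fun do rewrite mxE.
by apply: ccont_sum => j; exact: ccontM.
Qed.

Lemma mcontJ m n D (A : R -> 'M[C]_(m, n)) : mcont D A -> mcont D (fun s => (A s)^t*).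
Proof. by move=> Ac i j; under eq_fun do rewrite !mxE; exact: ccontJ. Qed.

Lemma mderiv_mcont m n D (M : R -> 'M[C]_(m, n)) dM : (forall t, mderiv M t (dM t)) -> mcont D M.
Proof. by move=> H i j; apply: (@cderiv_ccont D _ (fun t => dM t i j)) => t; exact: H. Qed.

Lemma mderiv0_cst m n (M : R -> 'M[C]_(m, n)) (T : R) : 0 <= T ->
  (forall t, t \in `]0, T[ -> mderiv M t 0) -> mcont `[0, T] M -> M T = M 0.
Proof.
move=> T0 Md Mc; apply/matrixP => i j; apply: (@cderiv0_cst (fun s => M s i j) T T0 _ (Mc i j)) => t /Md /(_ i j).
by rewrite mxE.
Qed.

End ComplexDerivative.

Section Propagator.
Variables (R : realType) (N : nat).
Local Notation C := R[i].
Implicit Types (A : R -> 'M[C]_N) (t : R).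

Definition mi : C := - (0 +i* 1).

Lemma hermE (M : 'M[C]_N) : M \is hermsymmx -> M^t* = M.
Proof. by move=> /is_hermitianmxP; rewrite expr0 scale1r => {2}->. Qed.

Lemma miJ : conjc mi = - mi :> C.
Proof. by rewrite /mi rmorphN /=; congr (- _); apply/eqP; rewrite eq_complex /= oppr0 !eqxx. Qed.

Lemma JmulM m n p (A : 'M[C]_(m, n)) (B : 'M[C]_(n, p)) : (A *m B)^t* = B^t* *m A^t*.
Proof. by rewrite trmx_mul map_mxM. Qed.

Lemma JZ m n (c : C) (A : 'M[C]_(m, n)) : (c *: A)^t* = conjc c *: A^t*.
Proof. by apply/matrixP => i j; rewrite !mxE rmorphM. Qed.

(** The equation is posed on the whole line, the Hamiltonian being extended beyond the closed
    domain, so that no one-sided derivatives occur. *)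
Definition propagator A (U : R -> 'M[C]_N) :=
  [/\ U 0 = 1%:M, (forall t, mderiv U t (mi *: (A t *m U t))) &
      forall t, 0 <= t -> U t \is unitarymx].

(** The real form of a complex matrix; the boolean [true] marks imaginary parts. *)
Definition realify (I : finType) (B : I -> I -> C) (x y : I * bool) : R :=
  match x.2, y.2 with
  | false, false => complex.Re (B x.1 y.1)
  | false, true => - complex.Im (B x.1 y.1)
  | true, false => complex.Im (B x.1 y.1)
  | true, true => complex.Re (B x.1 y.1)
  end.
Definition rpart (I : finType) (z : I -> C) (x : I * bool) : R :=
  if x.2 then complex.Im (z x.1) else complex.Re (z x.1).
Definition cpart (I : finType) (y : I * bool -> R) (i : I) : C := y (i, false) +i* y (i, true).

Lemma rpartK (I : finType) (z : I -> C) : cpart (rpart z) = z.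
Proof. by apply/funext => i; rewrite /cpart /rpart /=; case: (z i). Qed.
Lemma cpartK (I : finType) (y : I * bool -> R) : rpart (cpart y) = y.
Proof. by apply/funext => -[i []]. Qed.

Lemma mv_realify (I : finType) (B : I -> I -> C) (z : I -> C) :
  mv (realify B) (rpart z) = rpart (fun i => \sum_j B i j * z j).
Proof.
apply/funext => -[i b]; rewrite /mv.
rewrite (eq_bigr (fun x : I * bool => realify B (i, b) (x.1, x.2) * rpart z (x.1, x.2))); last by case.
rewrite -(pair_bigA _ (fun j c => realify B (i, b) (j, c) * rpart z (j, c))) /=.
rewrite /rpart /=; case: b; rewrite ?Re_sum ?Im_sum; apply: eq_bigr => j _;
  rewrite big_bool /realify /rpart /= ?Re_mul ?Im_mul; ring.
Qed.

Lemma linear_ode_complex (I : finType) (B : R -> I -> I -> C) (b : R) (z0 : I -> C) :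
  (forall i j, ccont setT (fun t => B t i j)) ->
  (forall t i j, `|complex.Re (B t i j)| <= b /\ `|complex.Im (B t i j)| <= b) ->
  exists z : R -> I -> C, z 0 = z0 /\
    forall t i, cderiv (fun s => z s i) t (\sum_j B t i j * z t j).
Proof.
move=> Bc Bb.
have Mc x y : continuous (fun t => realify (B t) x y).
  have cT f : {within setT, continuous f} -> continuous (f : R -> R).
    by move=> fc; apply/continuous_subspace_setT.
  case: x y => i [] [j []] /=; rewrite /realify /=; have [rc ic] := Bc i j.
  - exact: cT.
  - exact: cT.
  - by move=> t; apply: cvgN; exact: (cT _ ic).
  - exact: cT.
have Mb t x y : `|realify (B t) x y| <= `|b|.
  have [bb1 bb2] := Bb t x.1 y.1; have := ler_norm b.
  by case: x y bb1 bb2 => i [] [j []] /= bb1 bb2; rewrite /realify /= ?normrN; apply: le_trans.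
have gc (i : I * bool) : continuous (fun t : R => 0 : R) by move=> t; exact: cst_continuous.
have g0 (t : R) (i : I * bool) : `|0 : R| <= 0 by rewrite normr0.
have [y [y0 yd]] := linear_ode 0 (rpart z0) (normr_ge0 b) (lexx 0) Mc gc Mb g0.
exists (fun t => cpart (y t)); split; first by rewrite y0 rpartK.
move=> t i.
have E : mv (realify (B t)) (y t) = rpart (fun i => \sum_j B t i j * cpart (y t) j).
  by rewrite -mv_realify cpartK.
split.
  by have := yd t (i, false); rewrite addr0 E.
by have := yd t (i, true); rewrite addr0 E.
Qed.

Lemma propagator_exists A (b : R) :
  (forall i j, ccont setT (fun t => A t i j)) ->
  (forall t i j, `|complex.Re (A t i j)| <= b /\ `|complex.Im (A t i j)| <= b) ->
  (forall t, A t \is hermsymmx) -> exists U, propagator A U.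
Proof.
move=> Ac Ab Ah.
have miE (x : C) : complex.Re (mi * x) = complex.Im x /\ complex.Im (mi * x) = - complex.Re x.
  by case: x => p q; rewrite /mi Re_mul Im_mul /=; split; ring.
have Bc i j : ccont setT (fun t => mi * A t i j).
  by apply: ccontM (Ac i j); split; move=> x; exact: cst_continuous.
have Bb t i j : `|complex.Re (mi * A t i j)| <= b /\ `|complex.Im (mi * A t i j)| <= b.
  by have [r1 i1] := Ab t i j; rewrite !(miE _).1 !(miE _).2 normrN.
have /choice[z zP] (k : 'I_N) := linear_ode_complex (fun i => (i == k)%:R) Bc Bb.
pose U t := \matrix_(i, k) z k t i.
have U0 : U 0 = 1%:M by apply/matrixP => i k; rewrite !mxE (zP k).1.
have Ud t : mderiv U t (mi *: (A t *m U t)).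
  move=> i k; under eq_fun do rewrite mxE.
  have -> : (mi *: (A t *m U t)) i k = \sum_j mi * A t i j * z k t j.
    by rewrite !mxE big_distrr; apply: eq_bigr => j _; rewrite /= mxE mulrA.
  exact: (zP k).2.
exists U; split=> // t t0.
suff UU : (U t)^t* *m U t = 1%:M by apply/unitarymxP; exact: mulmx1C UU.
have Dz (r : R) : mderiv (fun s => (U s)^t* *m U s) r 0.
  have := mderivM (mderivJ (Ud r)) (Ud r).
  rewrite JZ miJ JmulM (hermE (Ah r)) scaleNr mulNmx -scalemxAl -scalemxAr mulmxA.
  by rewrite addNr.
have I0 : (U 0)^t* *m U 0 = 1%:M by rewrite U0 trmx1 map_mx1 mulmx1.
rewrite -I0; apply: (@mderiv0_cst R _ _ (fun s => (U s)^t* *m U s) t t0) => //.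
exact: (@mderiv_mcont R _ _ _ (fun s => (U s)^t* *m U s) (fun=> 0)).
Qed.

End Propagator.

Section Evolution.
Variables (R : realType) (n N : nat).
Local Notation C := R[i].
Variables (H : 'rV[R]_n -> 'M[C]_N) (gamma : R -> 'rV[R]_n) (T : R).
Variables (A U : R -> 'M[C]_N).
Hypothesis T0 : 0 <= T.
Hypothesis AH : forall t, t \in `]0, T[ -> A t = H (gamma t).
Hypothesis Ah : forall t, A t \is hermsymmx.
Hypothesis UA : propagator A U.

Lemma mi_i : mi R * (0 +i* 1) = 1.
Proof. by apply: ReIm_eq; rewrite /mi ?Re_mul ?Im_mul /=; ring. Qed.

Lemma propagator_solution (Psi : R -> 'cV[C]_N) :
  schrodinger_solution H gamma T Psi -> Psi T = U T *m Psi 0.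
Proof.
case: UA => U0 Ud Uu [Pc [dPsi dP]].
have Pd t : t \in `]0, T[ -> mderiv Psi t (mi R *: (A t *m Psi t)).
  move=> tT; rewrite (AH tT); have [Pd <-] := dP t tT; rewrite scalerA mi_i scale1r => j k.
  by rewrite ord1; exact: Pd.
have Vd t : t \in `]0, T[ -> mderiv (fun s => (U s)^t* *m Psi s) t 0.
  move=> tT; have := mderivM (mderivJ (Ud t)) (Pd t tT).
  rewrite JZ miJ JmulM (hermE (Ah t)) scaleNr mulNmx -scalemxAl -scalemxAr mulmxA.
  by rewrite addNr.
have Vc : mcont `[0, T] (fun s => (U s)^t* *m Psi s).
  apply: mcontM; first by apply: mcontJ; exact: mderiv_mcont Ud.
  by move=> j k; rewrite ord1; split; [exact: (Pc j).1|exact: (Pc j).2].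
have := mderiv0_cst T0 Vd Vc; rewrite U0 trmx1 map_mx1 mul1mx => <-.
by rewrite mulmxA (unitarymxP (Uu T T0)) mul1mx.
Qed.

(** The columns of [U] are solutions that start from the standard basis, so they determine every
    matrix with the property defining [evolution]. *)
Lemma evolutionE : evolution H gamma T T 0 = U T.
Proof.
case: (UA) => U0 Ud Uu; apply: xget_unique.
  by split; [exact: Uu|exact: propagator_solution].
move=> W [_ WP]; apply/matrixP => j k.
have S : schrodinger_solution H gamma T (fun s => col k (U s)).
  split=> [i|].
    by split; apply: continuous_subspaceT => t; under eq_fun do rewrite mxE;
      apply: is_derive_cont; [exact: (Ud t i k).1|exact: (Ud t i k).2].
  exists (fun s => col k (mi R *: (A s *m U s))) => t tT; split=> [i|].
    rewrite mxE; split.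
      by under eq_fun do rewrite mxE; exact: (Ud t i k).1.
    by under eq_fun do rewrite mxE; exact: (Ud t i k).2.
  by rewrite -AH// !colE -scalemxAl scalerA [_ * mi R]mulrC mi_i scale1r mulmxA.
have := WP _ S; rewrite U0 !colE mul1mx -!colE => /matrixP /(_ j ord0).
by rewrite !mxE.
Qed.

End Evolution.

(** * Invariance under real scalar perturbations *)

Section Gauge.
Variables (R : realType) (N : nat).
Local Notation C := R[i].

Lemma phase_norm (z : R -> C) (phi : R -> R) (T : R) : 0 <= T ->
  (forall t, t \in `]0, T[ -> cderiv z t (mi R * (phi t)%:C * z t)) ->
  ccont `[0, T] z -> z T * conjc (z T) = z 0 * conjc (z 0).
Proof.
move=> T0 zd zc.
apply: (@cderiv0_cst R (fun s => z s * conjc (z s)) T T0) => [t tT|]; last first.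
  by apply: ccontM => //; exact: ccontJ.
have := cderivM (zd t tT) (cderivJ (zd t tT)).
have e : conjc (mi R * (phi t)%:C * z t) = - mi R * (phi t)%:C * conjc (z t).
  by rewrite rmorphM rmorphM; congr (_ * _ * _); [exact: miJ|exact: conjc_real].
rewrite e; set d := (X in cderiv _ _ X); suff -> : d = 0 by [].
by rewrite /d; ring.
Qed.

(** The function [phi] is arbitrary and is never integrated. With K = U^* U', the entries of [K] and
    the differences of its diagonal entries all solve z' = -i phi z, hence keep their modulus; those
    that vanish at time 0 still vanish at [T], and [K] is scalar. *)
Lemma gauge_propagator (A A' U U' : R -> 'M[C]_N) (phi : R -> R) (T : R) : (0 < N)%N -> 0 <= T ->
  propagator A U -> propagator A' U' -> (forall t, A t \is hermsymmx) ->
  (forall t, t \in `]0, T[ -> A' t = A t + ((phi t)%:C)%:M) ->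
  exists2 c : C, `|c| = 1 & U' T = c *: U T.
Proof.
move=> N0 T0 [U0 Ud Uu] [U'0 Ud' Uu'] Ah AA.
pose K s := (U s)^t* *m U' s.
have Kd (t : R) : t \in `]0, T[ -> mderiv K t ((mi R * (phi t)%:C) *: K t).
  move=> tT; have := mderivM (mderivJ (Ud t)) (Ud' t).
  rewrite JZ miJ JmulM (hermE (Ah t)) scaleNr mulNmx -scalemxAl -scalemxAr mulmxA.
  rewrite (AA _ tT) mulmxDr mulmxDl scalerDr addKr -mulmxA mul_scalar_mx.
  by rewrite -scalemxAr scalerA.
have Kc : mcont `[0, T] K.
  by apply: mcontM; [apply: mcontJ|]; [exact: mderiv_mcont Ud|exact: mderiv_mcont Ud'].
have K0 : K 0 = 1%:M by rewrite /K U0 U'0 trmx1 map_mx1 mulmx1.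
have KN i j : K T i j * conjc (K T i j) = K 0 i j * conjc (K 0 i j).
  apply: (@phase_norm (fun s => K s i j) phi T T0) => // t tT.
  by have := Kd t tT i j; rewrite mxE.
have zero (z : C) : z * conjc z = 0 -> z = 0.
  by move/eqP; rewrite mulf_eq0 conjc_eq0 orbb => /eqP.
pose i0 := Ordinal N0.
have Kdiff i : K T i i - K T i0 i0 = 0.
  apply: zero.
  rewrite (@phase_norm (fun s => K s i i - K s i0 i0) phi T T0) => [|t tT|].
  - by rewrite K0 !mxE !eqxx subrr mul0r.
  - have H1 := Kd t tT i i; have H2 := Kd t tT i0 i0.
    rewrite mxE in H1; rewrite mxE in H2; rewrite mulrBr.
    exact: cderivD H1 (cderivN H2).
  - exact: ccontB.
exists (K T i0 i0).
  apply/eqP; rewrite -(@eqrXn2 _ 2)// normCK conjCE KN K0 mxE eqxx conjc1 mulr1 expr1n//.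
have -> : U' T = U T *m K T by rewrite /K mulmxA (unitarymxP (Uu T T0)) mul1mx.
suff {1}-> : K T = (K T i0 i0)%:M by rewrite mul_mx_scalar.
apply/matrixP => i j; rewrite [RHS]mxE; have [->|ij] := eqVneq i j.
  by apply/eqP; rewrite mulr1n -subr_eq0 Kdiff.
by apply: zero; rewrite KN K0 mxE (negbTE ij) mul0r.
Qed.
End Gauge.

(** * Regularity of the Hamiltonians *)

Section VectorNorms.
Variables (R : realType) (n : nat).
Implicit Types (x y v : 'rV[R]_n).

Lemma coord_le_norm x i : `|x ord0 i| <= `|x|.
Proof. by rewrite [leRHS]/Num.Def.normr/= mx_normrE; apply/bigmax_geP; right; exists (ord0, i). Qed.

Lemma norm_le_coord x c : 0 <= c -> (forall i, `|x ord0 i| <= c) -> `|x| <= c.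
Proof.
by move=> c0 xc; rewrite [leLHS]/Num.Def.normr/= mx_normrE; apply: bigmax_le => // -[i j] _; rewrite ord1.
Qed.

Lemma enorm_ge0 v : 0 <= enorm v. Proof. exact: sqrtr_ge0. Qed.

Lemma norm_le_enorm v : `|v| <= enorm v.
Proof.
apply: norm_le_coord; first exact: enorm_ge0.
move=> i; rewrite -sqrtr_sqr ler_wsqrtr// (bigD1 i)//= lerDl.
by apply: sumr_ge0 => j _; exact: sqr_ge0.
Qed.

Lemma enorm_le_norm v : enorm v <= n%:R * `|v|.
Proof.
have n0 : 0 <= n%:R * `|v| :> R by rewrite mulr_ge0.
rewrite -[leRHS]ger0_norm// -sqrtr_sqr ler_wsqrtr//.
apply: (@le_trans _ _ (\sum_(i < n) `|v| ^+ 2)).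
  apply: ler_sum => i _; rewrite -[v _ _ ^+ 2]real_normK ?num_real//.
  by apply: lerXn2r; rewrite ?nnegrE// coord_le_norm.
rewrite sumr_const card_ord -[_ *+ _]mulr_natl exprMn; apply: ler_wpM2r; first exact: sqr_ge0.
by rewrite -natrX ler_nat -mulnn; case: (n) => // m; rewrite leq_pmull.

Qed.

Lemma enormZ c v : enorm (c *: v) = `|c| * enorm v.
Proof.
rewrite /enorm; under eq_bigr do rewrite mxE exprMn.
by rewrite -mulr_sumr sqrtrM ?sqr_ge0// sqrtr_sqr.
Qed.

Lemma enorm_gt0 v : v != 0 -> 0 < enorm v.
Proof. by move=> v0; apply: lt_le_trans (norm_le_enorm v); rewrite normr_gt0. Qed.

End VectorNorms.

Section Lines.
Variable R : realType.

Lemma line_derive (V : normedModType R) (f : V -> R) (w v : V) (s d : R) :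
  is_derive (w + s *: v) v f d -> is_derive s 1 (fun t => f (w + t *: v)) d.
Proof.
move=> [fd fE].
have E : (fun h : R => h^-1 *: (((fun t => f (w + t *: v)) \o shift s) (h *: (1 : R)) - f (w + s *: v))) =
         (fun h : R => h^-1 *: ((f \o shift (w + s *: v)) (h *: v) - f (w + s *: v))).
  apply/funext => h /=; congr (_ *: (f _ - _)).
  by rewrite [_%:A]mulr1 scalerDl addrCA.
split; first by rewrite /derivable E.
by rewrite -fE /derive E.
Qed.

Lemma is_derive_eps (f : R -> R) (s L : R) :
  (forall e, 0 < e -> exists2 d, 0 < d & forall h, `|h| < d -> `|f (s + h) - f s - h * L| <= e * `|h|) ->
  is_derive s 1 f L.
Proof.
move=> H.
have cv : (fun h : R => h^-1 *: ((f \o shift s) (h *: (1 : R)) - f s)) @ 0^' --> L.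
  apply/cvgrPdist_le => e e0; have [d d0 dH] := H e e0.
  near=> h.
  have h0 : h != 0 by near: h; exact: nbhs_dnbhs_neq.
  have hd : `|h| < d by near: h; apply: dnbhs0_lt.
  have := dH h hd; rewrite /= [h *: 1]mulr1 [h + s]addrC => Hh.
  have -> : L - h^-1 *: (f (s + h) - f s) = - (h^-1 * (f (s + h) - f s - h * L)).
    by rewrite /GRing.scale/=; field.
  by rewrite normrN normrM normfV ler_pdivrMl ?normr_gt0// [leRHS]mulrC.
by split; [apply/cvg_ex; exists L|exact: cvg_lim].
Unshelve. all: by end_near. Qed.

Lemma mvt01 (f df : R -> R) : (forall t : R, 0 <= t <= 1 -> is_derive t 1 f (df t)) ->
  exists2 t, 0 < t < 1 & f 1 - f 0 = df t.
Proof.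
move=> fd.
have fd' (t : R) : t \in `]0, 1[ -> is_derive t 1 f (df t).
  by rewrite in_itv/= => /andP[t0 t1]; apply: fd; rewrite !ltW.
have fc : {within `[0, 1], continuous f}.
  by apply: (@is_derive_within R f df) => t; rewrite in_itv/= => ?; exact: fd.
have [c] := MVT ltr01 fd' fc; rewrite in_itv/= subr0 mulr1 => c01 E.
by exists c.
Qed.

Lemma is_derive_lin (c t : R) : is_derive t 1 (fun s : R => s * c) c.
Proof.
by have := is_derive_affine c 0 t; under eq_fun do rewrite addr0 mulrC.
Qed.

End Lines.

Section Domain.
Variables (R : realType) (n : nat) (Omega : set 'rV[R]_n).
Hypothesis dom : bounded_convex_domain Omega.

Lemma domain_convex x y (t : R) : Omega x -> Omega y -> 0 <= t <= 1 -> Omega (x + t *: (y - x)).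
Proof.
case: dom => _ _ _ cvx Ox Oy /andP[t0 t1].
have := cvx y x (Itv01 t0 t1); rewrite !inE => /(_ Oy Ox).
suff -> : x + t *: (y - x) = t *: y + (1 - t) *: x by [].
by rewrite scalerBl scale1r scalerBr addrCA.
Qed.

Lemma domain_open x : Omega x -> exists2 r, 0 < r & forall y, `|y - x| < r -> Omega y.
Proof.
case: dom => _ op _ _ Ox.
have := open_nbhs_nbhs (conj op Ox); rewrite -nbhs_ballE => -[r /= r0 rO].
exists r => // y yx; apply: rO; rewrite -ball_normE/=; by rewrite distrC.
Qed.

Lemma domain_bounded : exists2 b, 0 < b & forall x, Omega x -> `|x| <= b.
Proof.
case: dom => _ _ [b [_ bP]] _; exists (`|b| + 1); first by rewrite ltr_wpDl.
by apply: bP; rewrite (le_lt_trans (ler_norm b))// ltrDl.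
Qed.

Lemma closure_normP (A : set 'rV[R]_n) x : closure A x <-> forall e, 0 < e -> exists2 y, A y & `|x - y| < e.
Proof.
split=> [clx e e0|H B /nbhs_ballP[e /= e0 eB]].
  have [y [Ay]] := clx _ (nbhsx_ballx x e e0).
  by rewrite -ball_normE /=; exists y.
have [y Ay xy] := H e e0; exists y; split => //; apply: eB.
by rewrite -ball_normE.
Qed.

Lemma boundaryE x : boundary Omega x <-> closure Omega x /\ ~ Omega x.
Proof.
by case: dom => _ /interior_id oE _ _; rewrite /boundary /setD /= oE.
Qed.

Lemma subset_closure_dom x : Omega x -> closure Omega x.
Proof. by move=> Ox; exact: subset_closure. Qed.

Lemma closure_convex x y (t : R) : closure Omega x -> closure Omega y -> 0 <= t <= 1 ->
  closure Omega (x + t *: (y - x)).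
Proof.
move=> /closure_normP cx /closure_normP cy /andP[t0 t1]; apply/closure_normP => e e0.
have [x' Ox' xx'] := cx e e0; have [y' Oy' yy'] := cy e e0.
exists (x' + t *: (y' - x')); first by apply: domain_convex => //; rewrite t0.
have -> : x + t *: (y - x) - (x' + t *: (y' - x')) = (1 - t) *: (x - x') + t *: (y - y').
  by apply/matrixP => i j; rewrite !mxE; ring.
apply: (le_lt_trans (ler_normD _ _)); rewrite !normrZ (ger0_norm t0) ger0_norm ?subr_ge0//.
have [m [m1 m2 me]] : exists m, [/\ `|x - x'| <= m, `|y - y'| <= m & m < e].
  by exists (Num.max `|x - x'| `|y - y'|); rewrite !le_max !lexx orbT gt_max xx' yy'.
have t1' : 0 <= 1 - t by rewrite subr_ge0.
by have := ler_wpM2l t1' m1; have := ler_wpM2l t0 m2; lra.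
Qed.

(* The last clause is what C^{1,beta} regularity leaves to use: second
   differences are o(1) * |q|, uniformly up to the boundary. *)
Definition nice (g : 'rV[R]_n -> R) := exists2 L, 0 <= L &
  [/\ forall x y, `|g x - g y| <= L * `|x - y|, forall x, `|g x| <= L &
    forall e, 0 < e -> exists2 d, 0 < d & forall p q z, `|z| <= d ->
      Omega p -> Omega (p + q) -> Omega (p + z) -> Omega (p + q + z) ->
      `|g (p + q + z) - g (p + z) - g (p + q) + g p| <= e * `|q|].

Lemma nice_cst c : nice (fun=> c).
Proof.
exists `|c|; first exact: normr_ge0; split=> [x y|//|e e0].
  by rewrite subrr normr0 mulr_ge0.
exists 1 => // p q z _ _ _ _ _; have -> : c - c - c + c = 0 by ring.
by rewrite normr0 mulr_ge0// ltW.
Qed.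

Lemma niceD g h : nice g -> nice h -> nice (fun x => g x + h x).
Proof.
move=> [L L0 [gL gB gd]] [M M0 [hM hB hd]]; exists (L + M); first exact: addr_ge0.
split=> [x y|x|e e0].
- have -> : g x + h x - (g y + h y) = (g x - g y) + (h x - h y) by ring.
  by rewrite (le_trans (ler_normD _ _))// mulrDl lerD.
- by rewrite (le_trans (ler_normD _ _))// lerD.
have e2 : 0 < e / 2 by rewrite divr_gt0.
have [d1 d10 D1] := gd _ e2; have [d2 d20 D2] := hd _ e2.
exists (Num.min d1 d2); first by rewrite lt_min d10.
move=> p q z; rewrite le_min => /andP[z1 z2] a b c d.
have -> : g (p + q + z) + h (p + q + z) - (g (p + z) + h (p + z)) - (g (p + q) + h (p + q)) + (g p + h p) =
  (g (p + q + z) - g (p + z) - g (p + q) + g p) + (h (p + q + z) - h (p + z) - h (p + q) + h p) by ring.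
rewrite (le_trans (ler_normD _ _))// [e]splitr mulrDl.
by rewrite lerD ?D1 ?D2.
Qed.

Lemma niceZ c g : nice g -> nice (fun x => c * g x).
Proof.
move=> [L L0 [gL gB gd]]; exists (`|c| * L); first exact: mulr_ge0.
split=> [x y|x|e e0].
- by rewrite -mulrBr normrM -mulrA ler_wpM2l.
- by rewrite normrM ler_wpM2l.
have c0 : 0 < `|c| + 1 by rewrite ltr_wpDl.
have [d d0 D] := gd _ (divr_gt0 e0 c0); exists d => // p q z zd Op Opq Opz Opqz.
rewrite -!mulrBr -mulrDr normrM.
have := ler_wpM2l (normr_ge0 c) (D p q z zd Op Opq Opz Opqz).
move=> /le_trans; apply; rewrite mulrA; apply: ler_wpM2r => //.
by rewrite mulrCA ger_pMr// ler_pdivrMr// mul1r lerDl.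
Qed.

Lemma niceN g : nice g -> nice (fun x => - g x).
Proof. by move=> /(niceZ (-1)); under eq_fun do rewrite mulN1r. Qed.

Lemma nice_sum (I : finType) (g : I -> 'rV[R]_n -> R) :
  (forall i, nice (g i)) -> nice (fun x => \sum_i g i x).
Proof.
move=> H; elim: (index_enum I) => [|i r IH].
  by under eq_fun do rewrite big_nil; exact: nice_cst.
by under eq_fun do rewrite big_cons; exact: niceD.
Qed.

(** The McShane extension, truncated to keep the bound [B] as well. *)
Lemma lipschitz_extension (S : set 'rV[R]_n) (f : 'rV[R]_n -> R) (L B : R) (y0 : 'rV[R]_n) :
  S y0 -> 0 <= L -> 0 <= B ->
  (forall x y, S x -> S y -> `|f x - f y| <= L * `|x - y|) -> (forall x, S x -> `|f x| <= B) ->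
  exists g : 'rV[R]_n -> R, [/\ forall x, S x -> g x = f x,
    forall x y, `|g x - g y| <= L * `|x - y| & forall x, `|g x| <= B].
Proof.
move=> Sy0 L0 B0 fL fB.
pose E x := [set f y - L * `|x - y| | y in S].
have Eub x : has_sup (E x).
  split; first by exists (f y0 - L * `|x - y0|), y0.
  exists (f y0 + L * `|x - y0|) => _ [y Sy <-].
  have := fL y y0 Sy Sy0; have := ler_wpM2l L0 (ler_distD x y y0).
  by rewrite ler_norml (distrC y x) mulrDr => H /andP[_]; lra.
pose g x := sup (E x).
have gS x : S x -> g x = f x.
  move=> Sx; apply/eqP; rewrite eq_le; apply/andP; split.
    apply: ge_sup; first by case: (Eub x).
    move=> _ [y Sy <-]; have := fL y x Sy Sx; rewrite distrC ler_norml (distrC x y).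
    by move=> /andP[]; lra.
  have H : E x (f x) by exists x => //; rewrite subrr normr0 mulr0 subr0.
  exact: (sup_upper_bound (Eub x)).
have gL1 x y : g x <= g y + L * `|x - y|.
  apply: ge_sup; first by case: (Eub x).
  move=> _ [z Sz <-].
  have H : f z - L * `|y - z| <= g y by apply: (sup_upper_bound (Eub y)); exists z.
  have := ler_wpM2l L0 (ler_distD x y z); rewrite mulrDr (distrC y x).
  by move: (g y) H => G; lra.
have gL x y : `|g x - g y| <= L * `|x - y|.
  have := gL1 x y; have := gL1 y x; rewrite (distrC y x) ler_norml.
  by move: (g x) (g y) => G G' *; apply/andP; split; lra.
(* Truncation to [-B, B] is 1-Lipschitz. *)
pose cl (t : R) := Num.max (- B) (Num.min B t).
have cl1 s t : cl s <= cl t + `|s - t|.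
  have d0 := normr_ge0 (s - t).
  have st : s <= t + `|s - t| by rewrite -lerBlDl ler_norm.
  move: `|s - t| d0 st => d d0 st; rewrite /cl ge_max; apply/andP; split.
    by apply: ler_wpDr => //; rewrite le_max lexx.
  apply: (@le_trans _ _ (Num.min B t + d)); last by rewrite lerD2r le_max lexx orbT.
  rewrite addr_minl le_min; apply/andP; split.
    by apply: ler_wpDr => //; rewrite ge_min lexx.
  by apply: le_trans st; rewrite ge_min lexx orbT.
have clL s t : `|cl s - cl t| <= `|s - t|.
  rewrite ler_norml; have := cl1 s t; have := cl1 t s; rewrite (distrC t s).
  by move: (cl s) (cl t) => *; apply/andP; split; lra.
exists (cl \o g); split=> [x Sx|x y|x].
- rewrite /= gS//; have := fB x Sx; rewrite ler_norml => /andP[b1 b2].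
  by rewrite /cl min_r// max_r.
- exact: le_trans (clL _ _) (gL x y).
- rewrite /= /cl ler_norml le_max lexx /= ge_max ge_min lexx /= andbT.
  by have := B0; lra.
Qed.

Lemma holder_modulus (beta : R) (A : set 'rV[R]_n) g : 0 < beta -> holder_on beta A g ->
  forall e, 0 < e -> exists2 d, 0 < d & forall x y, A x -> A y -> `|x - y| <= d -> `|g x - g y| <= e.
Proof.
move=> b0 [C gC] e e0.
pose c := `|C| + 1; have c0 : 0 < c by rewrite ltr_wpDl.
pose m : R := n%:R + 1; have m0 : 0 < m by rewrite ltr_wpDl.
have ec : 0 < e / c by rewrite divr_gt0.
exists ((e / c) `^ beta^-1 / m); first by rewrite divr_gt0// powR_gt0.
move=> x y Ax Ay; rewrite ler_pdivlMr// => xy.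
have H : enorm (x - y) <= (e / c) `^ beta^-1.
  apply: le_trans xy; apply: (le_trans (enorm_le_norm _)); rewrite mulrC.
  by apply: ler_wpM2l => //; rewrite lerDl.
have P : enorm (x - y) `^ beta <= e / c.
  have := @ge0_ler_powR R beta (ltW b0) _ _ (enorm_ge0 (x - y)) (powR_ge0 _ _) H.
  by rewrite -powRrM mulVf ?gt_eqF// powRr1// ltW.
apply: (le_trans (gC x y Ax Ay)); apply: (@le_trans _ _ (c * enorm (x - y) `^ beta)).
  by apply: ler_wpM2r; [exact: powR_ge0|rewrite (le_trans (ler_norm C))// lerDl].
by rewrite -ler_pdivlMl// mulrC.
Qed.

Lemma modulus_bounded (A : set 'rV[R]_n) (beta : R) g x0 : A x0 -> 0 < beta -> holder_on beta A g ->
  (exists b, forall x, A x -> `|x| <= b) -> exists2 B, 0 <= B & forall x, A x -> `|g x| <= B.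
Proof.
move=> Ax0 b0 [C gC] [b bA].
pose D := n%:R * (b + b) : R.
exists (`|C| * D `^ beta + `|g x0|); first by rewrite addr_ge0 ?mulr_ge0 ?powR_ge0.
move=> x Ax; have := gC x x0 Ax Ax0.
have H : enorm (x - x0) <= D.
  apply: (le_trans (enorm_le_norm _)); apply: ler_wpM2l => //.
  by rewrite (le_trans (ler_normB _ _))// lerD ?bA.
have P := ge0_ler_powR (ltW b0) (enorm_ge0 _) (le_trans (enorm_ge0 _) H) H.
have Q := ler_wpM2l (normr_ge0 C) P.
have S : C * enorm (x - x0) `^ beta <= `|C| * enorm (x - x0) `^ beta.
  by apply: ler_wpM2r; [exact: powR_ge0|exact: ler_norm].
have := lerB_dist (g x) (g x0).
by move: (`|C| * _) Q S => *; lra.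
Qed.

Section Smooth.
Variables (f : 'rV[R]_n -> R) (g : 'I_n -> 'rV[R]_n -> R).
Hypothesis fd : forall i x, Omega x -> is_derive x (delta_mx ord0 i) f (g i x).
Hypothesis gmod : forall i e, 0 < e -> exists2 d, 0 < d & forall x y, Omega x -> Omega y ->
  `|x - y| <= d -> `|g i x - g i y| <= e.

Lemma partial_mvt (w : 'rV[R]_n) i (c : R) :
  (forall t : R, 0 <= t <= 1 -> Omega (w + (t * c) *: delta_mx ord0 i)) ->
  exists2 t : R, 0 < t < 1 &
    f (w + c *: delta_mx ord0 i) - f w = g i (w + (t * c) *: delta_mx ord0 i) * c.
Proof.
move=> Ow.
have D (t : R) : 0 <= t <= 1 ->
    is_derive t 1 (fun s => f (w + (s * c) *: delta_mx ord0 i)) (g i (w + (t * c) *: delta_mx ord0 i) * c).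
  move=> t01; have L := line_derive (fd i (Ow t t01)).
  exact: (@is_derive1_comp R (fun s => f (w + s *: delta_mx ord0 i)) (fun s => s * c) t _ _ L (is_derive_lin c t)).
have [t t01] := mvt01 D; rewrite mul1r mul0r scale0r addr0 => E.
by exists t.
Qed.

(* A path from [x] to [y] changing one coordinate at a time. *)
Let stair (x y : 'rV[R]_n) (k : nat) : 'rV[R]_n :=
  \row_j (if (j < k)%N then y ord0 j else x ord0 j).

Lemma local_taylor (x y : 'rV[R]_n) (e : R) :
  (forall z, `|z - x| <= `|y - x| -> Omega z /\ forall i, `|g i z - g i x| <= e) ->
  `|f y - f x - \sum_i (y - x) ord0 i * g i x| <= e * (n%:R * `|y - x|).
Proof.
move=> H.
have S0 : stair x y 0 = x by apply/rowP => j; rewrite mxE.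
have Sn : stair x y n = y by apply/rowP => j; rewrite mxE ltn_ord.
have SS (i : 'I_n) : stair x y i.+1 = stair x y i + (y - x) ord0 i *: delta_mx ord0 i.
  apply/rowP => j; rewrite !mxE eqxx /= ltnS leq_eqVlt -val_eqE /=.
  have [/val_inj->|ji] := eqVneq (val j) (val i); last by rewrite mulr0 addr0.
  by rewrite ltnn mulr1 addrC subrK.
have E : f y - f x = \sum_(i < n) (f (stair x y i.+1) - f (stair x y i)).
  rewrite -(big_mkord xpredT (fun i => f (stair x y i.+1) - f (stair x y i))).
  by rewrite telescope_sumr// Sn S0.
rewrite E -sumrB; apply: (le_trans (ler_norm_sum _ _ _)).
apply: (@le_trans _ _ (\sum_(i < n) e * `|y - x|)); last first.
  by rewrite sumr_const card_ord -[_ *+ _]mulr_natl mulrCA.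
apply: ler_sum => i _.
have near (t : R) : 0 <= t <= 1 ->
    `|stair x y i + (t * (y - x) ord0 i) *: delta_mx ord0 i - x| <= `|y - x|.
  move=> /andP[t0 t1]; apply: norm_le_coord => // j; rewrite !mxE eqxx /=.
  have := coord_le_norm (y - x) j; rewrite !mxE.
  have [->|ji] := eqVneq j i.
    rewrite ltnn mulr1 addrAC subrr add0r normrM ger0_norm// => /(ler_wpM2l t0).
    by move=> /le_trans; apply; rewrite ler_piMl.
  rewrite mulr0 addr0; case: ifP => // _ _; by rewrite subrr normr0.
rewrite SS; have [t /andP[t0 t1] ->] := partial_mvt (fun t t01 => (H _ (near t t01)).1).
have t01 : 0 <= t <= 1 by rewrite !ltW.
rewrite mulrC -mulrBr normrM mulrC; apply: ler_pM => //; last exact: coord_le_norm.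
exact: (H _ (near t t01)).2.
Qed.

Lemma mod_all e : 0 < e -> exists2 d, 0 < d & forall i x y, Omega x -> Omega y ->
  `|x - y| <= d -> `|g i x - g i y| <= e.
Proof.
move=> e0; have /choice[d dP] (i : 'I_n) : exists d, 0 < d /\ forall x y, Omega x -> Omega y ->
    `|x - y| <= d -> `|g i x - g i y| <= e by have [d] := gmod i e0; exists d.
exists (\big[Num.min/1]_i d i).
  by apply: lt_bigmin => // i _; exact: (dP i).1.
move=> i x y Ox Oy xy; apply: (dP i).2 => //; apply: le_trans xy _.
by apply: bigmin_le_cond.
Qed.

(** Only partial derivatives are given; their uniform continuity on [Omega] yields the derivative
    along arbitrary lines. *)
Lemma directional (p v : 'rV[R]_n) (s : R) : Omega (p + s *: v) ->
  is_derive s 1 (fun t => f (p + t *: v)) (\sum_i v ord0 i * g i (p + s *: v)).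
Proof.
move=> Ox; apply: is_derive_eps => e e0; set x := p + s *: v in Ox *.
have c0 : 0 < n%:R * `|v| + 1 :> R by rewrite ltr_wpDl// mulr_ge0.
have [d1 d10 D1] := mod_all (divr_gt0 e0 c0).
have [r r0 rO] := domain_open Ox.
have v0 : 0 < `|v| + 1 by rewrite ltr_wpDl.
exists (Num.min d1 r / (`|v| + 1)); first by rewrite divr_gt0// lt_min d10.
move=> h; rewrite ltr_pdivlMr// => hd.
have xy : p + (s + h) *: v - x = h *: v by apply/matrixP => i j; rewrite !mxE; ring.
have hv : `|h *: v| < Num.min d1 r.
  by rewrite normrZ; apply: le_lt_trans hd; apply: ler_wpM2l => //; rewrite lerDl.
have T := @local_taylor x (p + (s + h) *: v) (e / (n%:R * `|v| + 1)).
rewrite xy in T; have {T} := T _; have -> : \sum_i (h *: v) ord0 i * g i x = h * \sum_i v ord0 i * g i x.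
  by rewrite mulr_sumr; apply: eq_bigr => i _; rewrite mxE mulrA.
move=> /(fun F H => le_trans (F H)); apply=> [z zh|].
  have := le_lt_trans zh hv; rewrite lt_min => /andP[zd zr].
  by split=> [|i]; [exact: rO|apply: D1 => //; [exact: rO|exact: ltW]].
have -> : e / (n%:R * `|v| + 1) * (n%:R * `|h *: v|) = e * `|h| * (n%:R * `|v| / (n%:R * `|v| + 1)).
  by rewrite normrZ; field; rewrite gt_eqF.
rewrite ler_piMr ?mulr_ge0 ?(ltW e0)// ler_pdivrMr// mul1r lerDl//.
Qed.

Variables (B : R) (x0 : 'rV[R]_n).
Hypotheses (B0 : 0 <= B) (gB : forall i x, Omega x -> `|g i x| <= B) (Ox0 : Omega x0).
Hypothesis fc : forall x, closure Omega x -> forall e, 0 < e -> exists2 d, 0 < d &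
  forall y, Omega y -> `|x - y| < d -> `|f x - f y| <= e.

Lemma segment_mvt p q : Omega p -> Omega q -> exists2 t : R, 0 < t < 1 &
  f q - f p = \sum_i (q - p) ord0 i * g i (p + t *: (q - p)).
Proof.
move=> Op Oq.
have D (t : R) : 0 <= t <= 1 ->
    is_derive t 1 (fun s => f (p + s *: (q - p))) (\sum_i (q - p) ord0 i * g i (p + t *: (q - p))).
  by move=> t01; apply: directional; exact: domain_convex.
have [t t01 E] := mvt01 D; exists t => //.
by rewrite -E scale1r scale0r addr0 addrCA subrr addr0.
Qed.

Lemma sum_coord_le (v : 'rV[R]_n) (a : 'I_n -> R) c : 0 <= c -> (forall i, `|a i| <= c) ->
  `|\sum_i v ord0 i * a i| <= n%:R * c * `|v|.
Proof.
move=> c0 ac; apply: (le_trans (ler_norm_sum _ _ _)).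
apply: (@le_trans _ _ (\sum_(i < n) c * `|v|)).
  apply: ler_sum => i _; rewrite normrM mulrC; apply: ler_pM => //; exact: coord_le_norm.
by rewrite sumr_const card_ord -[_ *+ _]mulr_natl mulrA.
Qed.

Lemma closure_lipschitz x y : closure Omega x -> closure Omega y ->
  `|f x - f y| <= n%:R * B * `|x - y|.
Proof.
move=> cx cy; rewrite leNgt; apply/negP => lt.
set M := n%:R * B in lt *.
have M0 : 0 <= M by rewrite mulr_ge0.
(* Replacing [x] and [y] by nearby points of [Omega] costs at most e (2 + 2 M), less than the
   assumed excess. *)
pose e := (`|f x - f y| - M * `|x - y|) / (3 + 3 * M).
have M3 : 0 < 3 + 3 * M by rewrite ltr_wpDr// mulr_ge0.
have e0 : 0 < e by rewrite divr_gt0// subr_gt0.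
have eE : e * (3 + 3 * M) = `|f x - f y| - M * `|x - y| by rewrite /e divfK// gt_eqF.
have [d1 d10 D1] := fc cx e0; have [d2 d20 D2] := fc cy e0.
have [p Op xp] := (closure_normP _ _).1 cx (Num.min d1 e) (ltac:(rewrite lt_min d10 e0//)).
have [q Oq yq] := (closure_normP _ _).1 cy (Num.min d2 e) (ltac:(rewrite lt_min d20 e0//)).
move: xp yq; rewrite !lt_min => /andP[xp xpe] /andP[yq yqe].
have [t t01 E] := segment_mvt Oq Op.
have t01' : 0 <= t <= 1 by case/andP: t01 => a b; rewrite !ltW.
have H : `|f p - f q| <= M * `|p - q|.
  by rewrite E; apply: sum_coord_le => // i; apply: gB; exact: domain_convex.
have H1 := D1 p Op xp; have H2 := D2 q Oq yq.
have T1 := ler_distD (f p) (f x) (f y); have T2 := ler_distD (f q) (f p) (f y).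
have S1 := ler_distD x p q; have S2 := ler_distD y x q.
have S : `|p - q| <= `|x - y| + 2 * e by rewrite (distrC p x) in S1; lra.
have := ler_wpM2l M0 S; rewrite (distrC (f q)) in T2.
have := mulr_ge0 M0 (ltW e0).
by rewrite mulrDr; move: eE; rewrite mulrDr; nra.
Qed.

(** For second differences the mean value theorem is applied to f(p + z + s q) - f(p + s q) as a
    function of [s]: its derivative is [q] against the difference of two gradients at points [z]
    apart, and both segments stay in [Omega] by convexity. *)
Lemma smooth_nice : exists2 h, nice h & forall x, closure Omega x -> h x = f x.
Proof.
have M0 : 0 <= n%:R * B by rewrite mulr_ge0.
have [b b0 bO] := domain_bounded.
pose L := n%:R * B; pose C := L * (b + b + 1) + `|f x0|.
have cO : closure Omega x0 by exact: subset_closure_dom.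
have fC x : closure Omega x -> `|f x| <= C.
  move=> cx; have := closure_lipschitz cx cO.
  have [y Oy xy] := (closure_normP _ _).1 cx 1 ltr01.
  have xx : `|x - x0| <= b + b + 1.
    have := ler_distD y x x0; have := ler_normB y x0; have := bO _ Oy; have := bO _ Ox0.
    by move: xy; lra.
  have := ler_wpM2l M0 xx; have := lerB_dist (f x) (f x0).
  by rewrite /C /L; lra.
have C0 : 0 <= C by apply: le_trans (fC _ cO).
have [h [hf hL hC]] := lipschitz_extension cO M0 C0 closure_lipschitz fC.
exists h => //; exists (L + C); first exact: addr_ge0.
split=> [x y|x|e e0].
- by apply: le_trans (hL x y) _; apply: ler_wpM2r => //; rewrite lerDl.
- by apply: le_trans (hC x) _; rewrite lerDr.
have n0 : 0 < n%:R + 1 :> R by rewrite ltr_wpDl.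
have [d d0 D] := mod_all (divr_gt0 e0 n0); exists d => // p q z zd Op Opq Opz Opqz.
rewrite !hf; try exact: subset_closure_dom.
have O1 (t : R) : 0 <= t <= 1 -> Omega (p + t *: q).
  by move=> t01; have := domain_convex Op Opq t01; rewrite addrAC subrr add0r.
have O2 (t : R) : 0 <= t <= 1 -> Omega (p + z + t *: q).
  move=> t01; have := domain_convex Opz Opqz t01.
  by have -> : p + q + z - (p + z) = q by apply/matrixP => i j; rewrite !mxE; ring.
have Dd (t : R) : 0 <= t <= 1 -> is_derive t 1 (fun s => f (p + z + s *: q) - f (p + s *: q))
    (\sum_i q ord0 i * (g i (p + z + t *: q) - g i (p + t *: q))).
  move=> t01; have := is_deriveB (directional (O2 t t01)) (directional (O1 t t01)).
  by rewrite -sumrB; under eq_bigr do rewrite -mulrBr.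
have [t /andP[t0 t1]] := mvt01 Dd; rewrite !scale1r !scale0r !addr0 => E.
have -> : f (p + q + z) - f (p + z) - f (p + q) + f p = f (p + z + q) - f (p + q) - (f (p + z) - f p).
  by rewrite [p + q + z]addrAC; ring.
rewrite E; have t01 : 0 <= t <= 1 by rewrite !ltW.
apply: (@le_trans _ _ (n%:R * (e / (n%:R + 1)) * `|q|)).
  apply: sum_coord_le => [|i]; first by rewrite divr_ge0 ?(ltW e0) ?(ltW n0).
  apply: D; [exact: O2|exact: O1|].
  by rewrite opprD addrACA subrr addr0 addrAC subrr add0r.
apply: ler_wpM2r => //; rewrite mulrCA ler_piMr ?(ltW e0)//.
by rewrite ler_pdivrMr// mul1r lerDl.
Qed.

End Smooth.

Lemma C1holder_nice beta f : 0 < beta -> C1holder beta Omega f ->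
  exists2 h, nice h & forall x, closure Omega x -> h x = f x.
Proof.
move=> b0 [fc /choice[g gP]].
have [x0 Ox0] : Omega !=set0 by case: dom.
have [b bpos bO] := domain_bounded.
have gm i e : 0 < e -> exists2 d, 0 < d & forall x y, Omega x -> Omega y ->
    `|x - y| <= d -> `|g i x - g i y| <= e.
  move=> e0; have [d d0 D] := holder_modulus b0 (gP i).2 e0; exists d => // x y Ox Oy.
  by apply: D; exact: subset_closure_dom.
have /choice[B BP] (i : 'I_n) : exists B, 0 <= B /\ forall x, Omega x -> `|g i x| <= B.
  have [C gC] := (gP i).2.
  have H : holder_on beta Omega (g i).
    by exists C => x y Ox Oy; apply: gC; exact: subset_closure_dom.
  have [B B0 gB] := modulus_bounded Ox0 b0 H (ex_intro _ b bO).
  by exists B.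
apply: (@smooth_nice f g (fun i x => (gP i).1 x) gm (\sum_i B i) x0) => //.
- by apply: sumr_ge0 => i _; exact: (BP i).1.
- move=> i x Ox; apply: le_trans ((BP i).2 x Ox) _.
  by rewrite (bigD1 i)//= lerDl; apply: sumr_ge0 => j _; exact: (BP j).1.
move=> x cx e e0.
have /subspace_continuousP/(_ x cx)/cvgrPdist_le/(_ e e0) := fc.
rewrite /within/= => /nbhs_ballP[d /= d0 dP]; exists d => // y Oy xy.
by apply: dP; [rewrite -ball_normE|exact: subset_closure_dom].
Qed.

End Domain.

(** * Boundary points *)

Section Boundary.
Variables (R : realType) (n : nat) (Omega : set 'rV[R]_n).
Hypothesis dom : bounded_convex_domain Omega.
Implicit Types (x y p v : 'rV[R]_n).

Lemma exit_point p v (s : R) : Omega p -> 0 <= s -> ~ Omega (p + s *: v) ->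
  exists s2, [/\ 0 < s2, s2 <= s, boundary Omega (p + s2 *: v) &
    forall t, 0 <= t -> t < s2 -> Omega (p + t *: v)].
Proof.
move=> Op s0 Os; pose E := [set t : R | 0 <= t /\ ~ Omega (p + t *: v)].
have Einf : has_inf E by split; [exists s | exists 0 => t []].
have v0 : 0 < `|v| + 1 by rewrite ltr_wpDl.
pose s2 := inf E.
have s20 : 0 <= s2 by apply: lb_le_inf; [exists s|move=> t []].
have in_ t : 0 <= t -> t < s2 -> Omega (p + t *: v).
  move=> t0 ts; apply: contrapT => nO; move: ts; rewrite ltNge => /negP; apply.
  by apply: inf_lbound; [case: Einf|].
have dist (a b : R) : p + a *: v - (p + b *: v) = (a - b) *: v.
  by apply/matrixP => i j; rewrite !mxE; ring.
have out : ~ Omega (p + s2 *: v).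
  move=> /(domain_open dom)[r r0 rO].
  have e0 : 0 < r / (`|v| + 1) by rewrite divr_gt0.
  have [t [t0 nO] ts] := inf_adherent e0 Einf.
  have st : s2 <= t by apply: inf_lbound; [case: Einf|].
  apply: nO; apply: rO; rewrite dist normrZ ger0_norm ?subr_ge0//.
  have H : t - s2 < r / (`|v| + 1) by rewrite ltrBlDl.
  rewrite ltr_pdivlMr// in H; apply: le_lt_trans H.
  by apply: ler_wpM2l; rewrite ?subr_ge0// lerDl.
have s2p : 0 < s2.
  by rewrite lt_neqAle s20 andbT; apply/eqP => s2E; apply: out; rewrite -s2E scale0r addr0.
exists s2; split => //; first by apply: inf_lbound; [case: Einf|].
apply/(boundaryE dom); split => //; apply/closure_normP => e e0.
pose d := Num.min s2 (e / (`|v| + 1)) / 2.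
have m0 : 0 < Num.min s2 (e / (`|v| + 1)) by rewrite lt_min s2p divr_gt0.
have d0 : 0 < d by rewrite divr_gt0.
have m1 : Num.min s2 (e / (`|v| + 1)) <= s2 by rewrite ge_min lexx.
have m2 : Num.min s2 (e / (`|v| + 1)) <= e / (`|v| + 1) by rewrite ge_min lexx orbT.
exists (p + (s2 - d) *: v).
  by apply: in_; rewrite /d; move: (Num.min _ _) m0 m1 => *; lra.
rewrite dist opprB addrCA subrr addr0 normrZ gtr0_norm//.
have H : d < e / (`|v| + 1) by rewrite /d; move: (Num.min _ _) m0 m2 => *; lra.
rewrite ltr_pdivlMr// in H; apply: le_lt_trans H.
by apply: ler_wpM2l; rewrite ?(ltW d0)// lerDl.
Qed.

(** For [z] in [Omega] near [x], its reflection [w] in [x] is outside by convexity. Moving [z]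
    slightly along a coordinate transversal to z - x makes the segment to [w] miss [x], so it leaves
    [Omega] at another boundary point nearby. *)
Lemma boundary_near x e : (2 <= n)%N -> boundary Omega x -> 0 < e ->
  exists y, [/\ boundary Omega y, y != x & `|y - x| < e].
Proof.
have aux (s d h : R) : 1 - 2 * s = 0 -> 0 = (1 - s) * (d + h * 1) + s * - d -> h = 0.
  move=> s2; have -> : s = 2^-1 by lra.
  by lra.
move=> n2 /(boundaryE dom)[/closure_normP cx nO] e0.
have e4 : 0 < e / 4 by rewrite divr_gt0.
have [z Oz xz] := cx _ e4.
pose w := x + (x - z).
have nw : ~ Omega w.
  move=> Ow; apply: nO; have h : 0 <= (2^-1 : R) <= 1 by rewrite invr_ge0 ler0n invf_le1// ler1n.
  have := domain_convex dom Oz Ow h.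
  suff -> : z + 2^-1 *: (w - z) = x by [].
  by apply/matrixP => i j; rewrite !mxE; field.
have [i0 di0] : exists i0, (z - x) ord0 i0 != 0.
  apply: contrapT => H; apply: nO; suff -> : x = z by [].
  apply/rowP => j; apply/eqP; rewrite eq_sym -subr_eq0; apply/negPn/negP => jj.
  by apply: H; exists j; rewrite !mxE.
have [i ii0] : exists i : 'I_n, i != i0.
  have [E|E] := eqVneq i0 (Ordinal (ltnW n2)).
    by exists (Ordinal n2); rewrite E.
  by exists (Ordinal (ltnW n2)); rewrite eq_sym.
have [r r0 rO] := domain_open dom Oz.
pose h := Num.min r (e / 4) / 2.
have m0 : 0 < Num.min r (e / 4) by rewrite lt_min r0.
have h0 : 0 < h by rewrite divr_gt0.
have hr : h < r.
  have : Num.min r (e / 4) <= r by rewrite ge_min lexx.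
  by rewrite /h; move: (Num.min _ _) m0 => *; lra.
have he : h < e / 4.
  have : Num.min r (e / 4) <= e / 4 by rewrite ge_min lexx orbT.
  by rewrite /h; move: (Num.min _ _) m0 => *; lra.
pose z2 := z + h *: delta_mx ord0 i.
have dn : `|h *: (delta_mx ord0 i : 'rV[R]_n)| <= h.
  apply: norm_le_coord => [|j]; first exact: ltW.
  by rewrite !mxE eqxx /=; case: eqP; rewrite ?mulr1 ?mulr0 ?normr0 ?gtr0_norm ?(ltW h0).
have Oz2 : Omega z2 by apply: rO; rewrite /z2 addrAC subrr add0r; exact: le_lt_trans hr.
have nw2 : ~ Omega (z2 + 1 *: (w - z2)) by rewrite scale1r addrCA subrr addr0.
have [s [s0 s1 by_ _]] := exit_point Oz2 ler01 nw2.
have yx : z2 + s *: (w - z2) - x = (1 - s) *: (z - x + h *: delta_mx ord0 i) + s *: (x - z).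
  by apply/matrixP => a b; rewrite !mxE; ring.
exists (z2 + s *: (w - z2)); split => //.
  apply/eqP => E; move: yx; rewrite E subrr => /rowP Z.
  have Zi := Z i; have Z0 := Z i0; rewrite !mxE !eqxx /= in Zi.
  rewrite !mxE eqxx /= eq_sym (negbTE ii0) in Z0; rewrite mxE in di0; rewrite mxE in di0.
  have H : (1 - 2 * s) * (z ord0 i0 - x ord0 i0) = 0 by rewrite mulr0 addr0 in Z0; rewrite [RHS]Z0; ring.
  have [s2|] := eqVneq (1 - 2 * s) 0; last first.
    by move=> s2; move/eqP: H; rewrite mulf_eq0 (negbTE s2) (negbTE di0).
  have hh : h = 0 by apply: (aux s (z ord0 i - x ord0 i)) => //; rewrite opprB.
  by rewrite hh ltxx in h0.
rewrite yx; apply: (le_lt_trans (ler_normD _ _)); rewrite !normrZ.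
rewrite (ger0_norm (ltW s0)) ger0_norm ?subr_ge0//.
have A : `|z - x + h *: (delta_mx ord0 i : 'rV[R]_n)| <= e / 4 + e / 4.
  by rewrite (le_trans (ler_normD _ _))// lerD// ?(le_trans dn) ?(ltW he)// distrC ltW.
have s1' : 0 <= 1 - s by rewrite subr_ge0.
have := ler_wpM2l s1' A; have := ler_wpM2l (ltW s0) (ltW xz).
have := mulr_ge0 (ltW s0) (ltW e0); lra.
Qed.

Lemma boundary_chord x v (T : R) : 0 < T -> enorm v = 1 -> boundary Omega x ->
  boundary Omega (x + T *: v) -> boundary_segment Omega x v T.
Proof.
move=> T0 v1 bx bT; split; [exact: T0|exact: v1| |by rewrite /segment_path scale0r addr0|exact: bT].
move=> t; rewrite /segment_path in_itv/= => /andP[t0 tT].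
have t01 : 0 <= t / T <= 1 by rewrite divr_ge0 ?(ltW T0)//= ler_pdivrMr// mul1r.
have := closure_convex dom ((boundaryE dom x).1 bx).1 ((boundaryE dom _).1 bT).1 t01.
by rewrite addrAC subrr add0r scalerA divfK// gt_eqF.
Qed.

Lemma lipschitz_zero_closure (g : 'rV[R]_n -> R) L : 0 <= L ->
  (forall x y, `|g x - g y| <= L * `|x - y|) -> (forall x, Omega x -> g x = 0) ->
  forall x, closure Omega x -> g x = 0.
Proof.
move=> L0 gL g0 x /closure_normP cx; apply/eqP; rewrite -normr_le0 leNgt; apply/negP => gx.
have L1 : 0 < L + 1 by rewrite ltr_wpDl.
have [y Oy xy] := cx _ (divr_gt0 gx L1).
have := gL x y; rewrite (g0 y Oy) subr0; apply/negP; rewrite -ltNge.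
rewrite ltr_pdivlMr// in xy; apply: le_lt_trans xy.
by rewrite mulrC; apply: ler_wpM2l => //; rewrite lerDl.
Qed.

Definition cnice (z : 'rV[R]_n -> R[i]) :=
  nice Omega (fun x => complex.Re (z x)) /\ nice Omega (fun x => complex.Im (z x)).

Lemma cniceD z w : cnice z -> cnice w -> cnice (fun x => z x + w x).
Proof.
move=> [zr zi] [wr wi]; split.
  by under eq_fun do rewrite Re_add; exact: niceD.
by under eq_fun do rewrite Im_add; exact: niceD.
Qed.

Lemma cniceZ c z : cnice z -> cnice (fun x => c * z x).
Proof.
move=> [zr zi]; split.
  under eq_fun do rewrite Re_mul; apply: niceD; first exact: niceZ.
  by apply: niceN; exact: niceZ.
by under eq_fun do rewrite Im_mul; apply: niceD; exact: niceZ.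
Qed.

Lemma cniceJ z : cnice z -> cnice (fun x => conjc (z x)).
Proof.
move=> [zr zi]; split; first by under eq_fun do rewrite Re_conjc.
by under eq_fun do rewrite Im_conjc; exact: niceN.
Qed.

Lemma cnice_sum (I : finType) (z : I -> 'rV[R]_n -> R[i]) :
  (forall i, cnice (z i)) -> cnice (fun x => \sum_i z i x).
Proof.
move=> H; split.
  by under eq_fun do rewrite Re_sum; apply: nice_sum => i; exact: (H i).1.
by under eq_fun do rewrite Im_sum; apply: nice_sum => i; exact: (H i).2.
Qed.

(** The entries are extended separately and then symmetrised, so that the extension is hermitian on
    the whole space and propagators along full lines are unitary. *)
Lemma hermitian_extension N beta (H : 'rV[R]_n -> 'M[R[i]]_N) : 0 < beta ->
  C1holder_mx beta Omega H -> (forall x, closure Omega x -> H x \is hermsymmx) ->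
  exists Hx : 'rV[R]_n -> 'M[R[i]]_N,
  [/\ forall x, closure Omega x -> Hx x = H x, forall x, Hx x \is hermsymmx &
      forall j k, cnice (fun x => Hx x j k)].
Proof.
move=> b0 HC Hh.
have /choice[g gP] (jk : 'I_N * 'I_N) : exists g : 'rV[R]_n -> R[i], cnice g /\
    forall x, closure Omega x -> g x = H x jk.1 jk.2.
  have [HR HI] := HC jk.1 jk.2.
  have [r rn rE] := C1holder_nice dom b0 HR; have [s sn sE] := C1holder_nice dom b0 HI.
  exists (fun x => r x +i* s x); split => // x cx.
  by apply: ReIm_eq; rewrite /= ?rE ?sE.
pose h : R[i] := (2^-1)%:C.
exists (fun x => \matrix_(j, k) (h * (g (j, k) x + conjc (g (k, j) x)))).
have hJ : conjc h = h by exact: conjc_real.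
have hh : h * 2 = 1 by apply: ReIm_eq; rewrite ?Re_mul ?Im_mul /=; field.
split=> [x cx|x|j k].
- apply/matrixP => j k; rewrite mxE !(gP _).2//=.
  have := hermE (Hh x cx) => /matrixP /(_ j k); rewrite !mxE conjCE => ->.
  by rewrite -mulr2n -[_ *+ 2]mulr_natl mulrA hh mul1r.
- apply/is_hermitianmxP; rewrite expr0 scale1r; apply/matrixP => j k.
  rewrite !mxE conjCE; have -> (a b : R[i]) : conjc (h * (a + conjc b)) = h * (conjc a + b).
    by rewrite rmorphM rmorphD /= conjcK; congr (_ * _).
  by rewrite addrC.
under eq_fun do rewrite mxE.
by apply: cniceZ; apply: cniceD; [exact: (gP _).1|apply: cniceJ; exact: (gP _).1].
Qed.

End Boundary.

(** * The tensor square of the relative propagator *)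

Section Adjoint.
Variables (R : realType) (N : nat).
Local Notation C := R[i].
Definition quad : finType := ('I_N * 'I_N * 'I_N * 'I_N)%type.

Definition tens (K : 'M[C]_N) (j : quad) : C :=
  let: (a, c, b, d) := j in K a c * conjc (K b d).

(* If K' = -i (A K - K A') then (tens K)' = coef A A' (tens K). *)
Definition coef (A A' : 'M[C]_N) (j k : quad) : C :=
  let: (a, c, b, d) := j in let: (a', c', b', d') := k in
  mi R * (A a a' * (k == (a', c, b, d))%:R - A' c' c * (k == (a, c', b, d))%:R)
  + conjc (mi R) * (conjc (A b b') * (k == (a, c, b', d))%:R - conjc (A' d' d) * (k == (a, c, b, d'))%:R).

Definition tens_source (A A' : 'M[C]_N) (j : quad) : C := \sum_k coef A A' j k * tens 1%:M k.

Lemma sum_graph (J : finType) (h : 'I_N -> J) (p : J -> 'I_N) (G : J -> C) : cancel h p ->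
  \sum_k (k == h (p k))%:R * G k = \sum_x G (h x).
Proof.
move=> hp; under eq_bigr do rewrite mulr_natl mulrb.
rewrite -big_mkcond (reindex_onto h p) => [|k /eqP <-//].
by apply: eq_bigl => x; rewrite hp !eqxx.
Qed.

(** The right side is the product rule for [tens K] when K' = -i (A K - K A'); each of the four
    Kronecker terms of [coef] leaves a sum over one index. *)
Lemma coef_tens A A' K (a c b d : 'I_N) :
  \sum_k coef A A' (a, c, b, d) k * tens K k =
  (mi R *: (A *m K - K *m A')) a c * conjc (K b d) +
  K a c * conjc ((mi R *: (A *m K - K *m A')) b d).
Proof.
have alg (m n x y z w d1 d2 d3 d4 t : C) :
    (m * (x * d1 - y * d2) + n * (z * d3 - w * d4)) * t =
    d1 * (m * x * t) - d2 * (m * y * t) + (d3 * (n * z * t) - d4 * (n * w * t)) by ring.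
pose p1 (k : quad) := k.1.1.1; pose p2 (k : quad) := k.1.1.2.
pose p3 (k : quad) := k.1.2; pose p4 (k : quad) := k.2.
have h1 : cancel (fun x => (x, c, b, d) : quad) p1 by [].
have h2 : cancel (fun x => (a, x, b, d) : quad) p2 by [].
have h3 : cancel (fun x => (a, c, x, d) : quad) p3 by [].
have h4 : cancel (fun x => (a, c, b, x) : quad) p4 by [].
have -> : \sum_k coef A A' (a, c, b, d) k * tens K k =
  (\sum_k (k == (p1 k, c, b, d))%:R * (mi R * A a (p1 k) * tens K k) -
   \sum_k (k == (a, p2 k, b, d))%:R * (mi R * A' (p2 k) c * tens K k)) +
  (\sum_k (k == (a, c, p3 k, d))%:R * (conjc (mi R) * conjc (A b (p3 k)) * tens K k) -
   \sum_k (k == (a, c, b, p4 k))%:R * (conjc (mi R) * conjc (A' (p4 k) d) * tens K k)).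
  rewrite -!sumrB -big_split; apply: eq_bigr => -[[[a' c'] b'] d'] _ /=.
  exact: alg.
rewrite (sum_graph _ h1) (sum_graph _ h2) (sum_graph _ h3) (sum_graph _ h4) /p1 /p2 /p3 /p4 /=.
have X (M M' : 'M[C]_N) x y : (mi R *: (M *m K - K *m M')) x y =
   mi R * (\sum_z M x z * K z y) - mi R * (\sum_z K x z * M' z y) by rewrite !mxE mulrBr.
rewrite !X rmorphB !rmorphM !rmorph_sum /= mulrBl mulrBr.
congr (_ - _ + (_ - _)).
- by rewrite big_distrr big_distrl; apply: eq_bigr => x _ /=; ring.
- by rewrite big_distrr big_distrl; apply: eq_bigr => x _ /=; ring.
- by rewrite !big_distrr; apply: eq_bigr => x _ /=; rewrite rmorphM /=; ring.
- by rewrite !big_distrr; apply: eq_bigr => x _ /=; rewrite rmorphM /=; ring.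
Qed.

(** The entry (a, c, b, b) of the source vanishes exactly when the (a, c) entry of A - A' is
    delta_ac times the conjugate of its (b, b) entry. Hence A - A' is diagonal with one constant
    entry, which is real by taking a = c = b. *)
Lemma tens_source0_scalar A A' (i0 : 'I_N) : (forall j, tens_source A A' j = 0) ->
  A' = A + ((complex.Re ((A' - A) i0 i0))%:C)%:M.
Proof.
move=> s0.
have E (a c b : 'I_N) : (A - A') a c = (a == c)%:R * conjc ((A - A') b b).
  have := s0 (a, c, b, b); rewrite /tens_source coef_tens mulmx1 mul1mx.
  have ZE (M : 'M[C]_N) x y : (mi R *: M) x y = mi R * M x y by rewrite mxE.
  have cm (w : C) : conjc (mi R * w) = - (mi R * conjc w).
    by rewrite rmorphM [X in X * _]miJ mulNr.
  rewrite !ZE cm; have [-> ->] : (1%:M : 'M[C]_N) b b = 1 /\ (1%:M : 'M[C]_N) a c = (a == c)%:R.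
    by rewrite !mxE eqxx.
  move: ((A - A') a c) ((A - A') b b) => z w; rewrite conjc1 mulr1 mulrN mulrCA -mulrBr.
  move/eqP; rewrite mulf_eq0 => /orP[/eqP m0|]; last by rewrite subr_eq0 => /eqP.
  by have := mi_i R; rewrite m0 mul0r => /eqP; rewrite eq_sym oner_eq0.
pose w := (A - A') i0 i0.
have wJ : conjc w = w by have := E i0 i0 i0; rewrite eqxx mul1r => <-.
have wR : (complex.Re ((A' - A) i0 i0))%:C = - w.
  have -> : (A' - A) i0 i0 = - w by rewrite /w !mxE opprB.
  by move: wJ; case: (w) => p q [] qE; apply: ReIm_eq => //=; lra.
apply/matrixP => i j; rewrite mxE wR [X in _ = _ + X]mxE.
have := E i j i0; rewrite -/w wJ => F.
have -> : A' i j = A i j - (A - A') i j by rewrite !mxE opprB addrCA subrr addr0.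
by rewrite F mulr_natl mulNrn.
Qed.

Lemma cnice_coef n (Omega : set 'rV[R]_n) (Hx Hx' : 'rV[R]_n -> 'M[C]_N) j k :
  (forall j k, cnice Omega (fun x => Hx x j k)) -> (forall j k, cnice Omega (fun x => Hx' x j k)) ->
  cnice Omega (fun x => coef (Hx x) (Hx' x) j k).
Proof.
move=> Hn Hn'; move: j k => [[[a c] b] d] [[[a' c'] b'] d'] /=.
have S z (e : bool) : cnice Omega z -> cnice Omega (fun x => z x * e%:R).
  by move=> zn; under eq_fun do rewrite mulrC; exact: cniceZ.
have B z w : cnice Omega z -> cnice Omega w -> cnice Omega (fun x => z x - w x).
  by move=> zn wn; under eq_fun do rewrite -mulN1r; apply: cniceD => //; exact: cniceZ.
apply: cniceD; apply: cniceZ; apply: B; apply: S; try exact: Hn; try exact: Hn'.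
  by apply: cniceJ; exact: Hn.
by apply: cniceJ; exact: Hn'.
Qed.

Lemma tens_unit (c : C) : `|c| = 1 -> tens (c *: 1%:M) = tens 1%:M.
Proof.
move=> c1; apply/funext => -[[[a c'] b] d]; rewrite /tens !mxE.
have cc : c * conjc c = 1 by rewrite -conjCE -normCK c1 expr1n.
by rewrite rmorphM /= mulrACA cc mul1r.
Qed.

Definition ramat A A' := realify (coef A A').
Definition rsource A A' := rpart (tens_source A A').

Lemma adjoint_system (A A' U U' : R -> 'M[C]_N) : propagator A U -> propagator A' U' ->
  (forall t, A' t \is hermsymmx) ->
  exists y : R -> quad * bool -> R,
  [/\ y 0 = (fun=> 0),
      forall T (c : C), 0 <= T -> `|c| = 1 -> U T = c *: U' T -> y T = (fun=> 0) &
      forall (t : R) i, is_derive t 1 (fun s => y s i)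
        (mv (ramat (A t) (A' t)) (y t) i + rsource (A t) (A' t) i)].
Proof.
move=> [U0 Ud Uu] [U'0 Ud' Uu'] Ah'.
pose K t := U t *m (U' t)^t*.
have Kd (t : R) : mderiv K t (mi R *: (A t *m K t - K t *m A' t)).
  have := mderivM (Ud t) (mderivJ (Ud' t)).
  rewrite JZ miJ JmulM (hermE (Ah' t)) (scaleNr (mi R)).
  rewrite mulmxN -scalemxAl -scalemxAr.
  by rewrite -scalerBr !mulmxA.
have K0 : K 0 = 1%:M by rewrite /K U0 U'0 trmx1 map_mx1 mulmx1.
exists (fun t => rpart (fun j => tens (K t) j - tens 1%:M j)); split.
- by rewrite K0; apply/funext => -[j b]; rewrite /rpart subrr /=; case: b.
- move=> T c T0 c1 UU; suff KT : K T = c *: 1%:M.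
    by rewrite KT tens_unit//; apply/funext => -[j b]; rewrite /rpart subrr /=; case: b.
  by rewrite /K UU -scalemxAl (unitarymxP (Uu' T T0)).
move=> t i.
have E : mv (ramat (A t) (A' t)) (rpart (fun j => tens (K t) j - tens 1%:M j)) i + rsource (A t) (A' t) i =
  rpart (fun j => \sum_k coef (A t) (A' t) j k * tens (K t) k) i.
  rewrite /ramat mv_realify /rsource.
  have Z (j : quad) : \sum_k coef (A t) (A' t) j k * tens (K t) k =
    \sum_k coef (A t) (A' t) j k * (tens (K t) k - tens 1%:M k) + tens_source (A t) (A' t) j.
    by rewrite /tens_source -big_split; apply: eq_bigr => k _ /=; rewrite mulrBr subrK.
  by case: i => j b; rewrite /rpart /= Z; case: b; rewrite ?Re_add ?Im_add.
rewrite E.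
have D (j : quad) : cderiv (fun s => tens (K s) j - tens 1%:M j) t (\sum_k coef (A t) (A' t) j k * tens (K t) k).
  move: j => [[[a c] b] d]; rewrite coef_tens.
  have := cderivD (cderivM (Kd t a c) (cderivJ (Kd t b d))) (cderiv_cst (- tens 1%:M (a, c, b, d)) t).
  by rewrite addr0.
by case: i {E} => j [] ; rewrite /rpart /=; [exact: (D j).2|exact: (D j).1].
Qed.

End Adjoint.

(** * Data on chords *)

Section Lipschitz.
Variables (R : realType) (n : nat) (Omega : set 'rV[R]_n).

Lemma nice_uniform (J : finType) (g : J -> 'rV[R]_n -> R) : (forall j, nice Omega (g j)) ->
  exists2 L, 0 <= L & [/\ forall j x y, `|g j x - g j y| <= L * `|x - y|, forall j x, `|g j x| <= L &
    forall e, 0 < e -> exists2 d, 0 < d & forall j p q z, `|z| <= d ->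
      Omega p -> Omega (p + q) -> Omega (p + z) -> Omega (p + q + z) ->
      `|g j (p + q + z) - g j (p + z) - g j (p + q) + g j p| <= e * `|q|].
Proof.
move=> H; have /choice[L LP] j : exists L, 0 <= L /\
    [/\ forall x y, `|g j x - g j y| <= L * `|x - y|, forall x, `|g j x| <= L &
    forall e, 0 < e -> exists2 d, 0 < d & forall p q z, `|z| <= d ->
      Omega p -> Omega (p + q) -> Omega (p + z) -> Omega (p + q + z) ->
      `|g j (p + q + z) - g j (p + z) - g j (p + q) + g j p| <= e * `|q|].
  by have [L L0 LL] := H j; exists L.
have Lj j : L j <= \sum_i L i.
  by rewrite (bigD1 j)//= lerDl; apply: sumr_ge0 => i _; exact: (LP i).1.
exists (\sum_i L i); first by apply: sumr_ge0 => i _; exact: (LP i).1.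
split=> [j x y|j x|e e0].
- by have [_ [gL _ _]] := LP j; apply: le_trans (gL x y) _; apply: ler_wpM2r.
- by have [_ [_ gB _]] := LP j; apply: le_trans (gB x) _.
have /choice[d dP] j : exists d, 0 < d /\ forall p q z, `|z| <= d ->
      Omega p -> Omega (p + q) -> Omega (p + z) -> Omega (p + q + z) ->
      `|g j (p + q + z) - g j (p + z) - g j (p + q) + g j p| <= e * `|q|.
  by have [_ [_ _ gd]] := LP j; have [d d0 D] := gd e e0; exists d.
exists (\big[Num.min/1]_j d j).
  by apply: lt_bigmin => // i _; exact: (dP i).1.
move=> j p q z zd; apply: (dP j).2; apply: le_trans zd _.
by apply: bigmin_le_cond.
Qed.

Lemma lipschitz_line (g : 'rV[R]_n -> R) L x v : 0 <= L ->
  (forall x y, `|g x - g y| <= L * `|x - y|) -> continuous (fun t : R => g (x + t *: v)).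
Proof.
move=> L0 gL t; apply/cvgrPdist_lt => e e0.
have c0 : 0 < L * `|v| + 1 by rewrite ltr_wpDl// mulr_ge0.
near=> s.
have ts : `|t - s| < e / (L * `|v| + 1).
  by near: s; apply: (@cvgr_dist_lt _ R) => //; rewrite divr_gt0.
apply: (le_lt_trans (gL _ _)).
have -> : x + t *: v - (x + s *: v) = (t - s) *: v by apply/matrixP => i j; rewrite !mxE; ring.
rewrite normrZ; rewrite ltr_pdivlMr// in ts; apply: le_lt_trans ts.
by rewrite mulrCA; apply: ler_wpM2l => //; rewrite lerDl.
Unshelve. all: by end_near. Qed.

(** A segment from inside to outside meets the boundary, where [g] vanishes, no farther from its
    start than its end is. *)
Lemma zero_extension_lipschitz (dom : bounded_convex_domain Omega) (g : 'rV[R]_n -> R) L : 0 <= L ->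
  (forall x y, `|g x - g y| <= L * `|x - y|) -> (forall x, boundary Omega x -> g x = 0) ->
  let h x := if pselect (Omega x) then g x else 0 in
  forall x y, `|h x - h y| <= L * `|x - y|.
Proof.
move=> L0 gL gb h x y.
have mixed p q : Omega p -> ~ Omega q -> `|g p| <= L * `|p - q|.
  move=> Op nq; have nq' : ~ Omega (p + 1 *: (q - p)) by rewrite scale1r addrCA subrr addr0.
  have [s [s0 s1 bd _]] := exit_point dom Op ler01 nq'.
  have := gL p (p + s *: (q - p)); rewrite (gb _ bd) subr0 => /le_trans; apply.
  apply: ler_wpM2l => //; rewrite opprD addrA subrr add0r normrN normrZ distrC gtr0_norm//.
  by rewrite ler_piMl.
rewrite /h; case: pselect => Ox; case: pselect => Oy.
- exact: gL.
- by rewrite subr0; exact: mixed.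
- by rewrite sub0r normrN distrC; exact: mixed.
- by rewrite subrr normr0 mulr_ge0.
Qed.

End Lipschitz.

Section Rays.
Variables (R : realType) (n N : nat) (Omega : set 'rV[R]_n).
Local Notation C := R[i].
Variables (I F : set 'cV[C]_N) (H H' Hx Hx' : 'rV[R]_n -> 'M[C]_N).
Hypotheses (dom : bounded_convex_domain Omega) (n2 : (2 <= n)%N).
Hypotheses (HE : forall x, closure Omega x -> Hx x = H x) (HE' : forall x, closure Omega x -> Hx' x = H' x).
Hypotheses (Hh : forall x, Hx x \is hermsymmx) (Hh' : forall x, Hx' x \is hermsymmx).
Hypotheses (Hn : forall j k, cnice Omega (fun x => Hx x j k)) (Hn' : forall j k, cnice Omega (fun x => Hx' x j k)).

Lemma line_propagator (G : 'rV[R]_n -> 'M[C]_N) x v : (forall j k, cnice Omega (fun x => G x j k)) ->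
  (forall x, G x \is hermsymmx) -> exists U, propagator (fun t : R => G (x + t *: v)) U.
Proof.
move=> Gn Gh.
have gn (k : 'I_N * 'I_N * bool) : nice Omega (fun x =>
    if k.2 then complex.Re (G x k.1.1 k.1.2) else complex.Im (G x k.1.1 k.1.2)).
  by case: k => -[i j] [] /=; [exact: (Gn i j).1|exact: (Gn i j).2].
have [L L0 [gL gB _]] := nice_uniform gn.
apply: (@propagator_exists R N _ L) => [i j|t i j|t]; last exact: Gh.
  split; apply: continuous_subspaceT.
    exact: (@lipschitz_line R n (fun y => complex.Re (G y i j)) L x v L0 (gL (i, j, true))).
  exact: (@lipschitz_line R n (fun y => complex.Im (G y i j)) L x v L0 (gL (i, j, false))).
by split; [exact: (gB (i, j, true))|exact: (gB (i, j, false))].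
Qed.

Lemma segment_evolution (G Gx : 'rV[R]_n -> 'M[C]_N) x v T U :
  (forall x, closure Omega x -> Gx x = G x) -> (forall x, Gx x \is hermsymmx) ->
  boundary_segment Omega x v T -> propagator (fun t : R => Gx (x + t *: v)) U ->
  evolution G (segment_path x v) T T 0 = U T.
Proof.
move=> GE Gh [T0 _ cl _ _] UP.
apply: (evolutionE (ltW T0) _ _ UP) => [t tT|t]; last exact: Gh.
by apply: GE; apply: cl; exact: subset_itv_oo_cc tT.
Qed.

(** A chord may run in the boundary, where nothing is known of [phi]. The relation of the matrices
    passes to the closure through the Lipschitz entries, with the scalar read off from one diagonal
    entry. *)
Lemma gauge_same_data (N0 : (0 < N)%N) :
  (exists phi : 'rV[R]_n -> R, forall x, Omega x -> H' x = H x + ((phi x)%:C)%:M) ->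
  same_data Omega I F H H'.
Proof.
move=> [phi phiE] Psi Phi x v T _ _ seg.
have phic : exists psi : 'rV[R]_n -> R, forall x, closure Omega x -> Hx' x = Hx x + ((psi x)%:C)%:M.
  pose i0 := Ordinal N0.
  exists (fun x => complex.Re (Hx' x i0 i0 - Hx x i0 i0)) => y cy.
  have cz (z : 'rV[R]_n -> C) : cnice Omega z -> (forall x, Omega x -> z x = 0) -> z y = 0.
    move=> [[L L0 [zL _ _]] [M M0 [wM _ _]]] z0; apply: ReIm_eq => /=.
      by apply: (lipschitz_zero_closure L0 zL _ cy) => u Ou; rewrite z0.
    by apply: (lipschitz_zero_closure M0 wM _ cy) => u Ou; rewrite z0.
  have cB z w : cnice Omega z -> cnice Omega w -> cnice Omega (fun x => z x - w x).
    by move=> zn wn; under eq_fun do rewrite -mulN1r; apply: cniceD => //; exact: cniceZ.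
  have D x0 : Omega x0 -> Hx' x0 = Hx x0 + ((phi x0)%:C)%:M.
    by move=> Ox; rewrite HE ?HE' ?phiE//; exact: subset_closure.
  have off i j : i != j -> Hx' y i j - Hx y i j = 0.
    move=> ij; apply: (cz (fun x => Hx' x i j - Hx x i j)); first exact: cB.
    by move=> u /D ->; rewrite !mxE (negbTE ij) mulr0n addr0 subrr.
  have di i : (Hx' y i i - Hx y i i) - (Hx' y i0 i0 - Hx y i0 i0) = 0.
    apply: (cz (fun x => (Hx' x i i - Hx x i i) - (Hx' x i0 i0 - Hx x i0 i0))).
      by apply: (cB); apply: (cB).
    by move=> u /D ->; rewrite !mxE !eqxx !mulr1n; ring.
  have im : Hx' y i0 i0 - Hx y i0 i0 = (complex.Re (Hx' y i0 i0 - Hx y i0 i0))%:C.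
    apply: ReIm_eq => //=.
    have [_ [L L0 [gL _ _]]] := cB _ _ (Hn' i0 i0) (Hn i0 i0).
    apply: (lipschitz_zero_closure L0 gL _ cy) => u /D ->.
    rewrite !mxE eqxx mulr1n; case: (Hx u i0 i0) => a b /=; ring.
  apply/matrixP => i j; rewrite mxE [X in _ = _ + X]mxE -im.
  have [->|ij] := eqVneq i j; last by rewrite addr0; apply/eqP; rewrite -subr_eq0 off.
  by rewrite mulr1n; have /eqP := di j; rewrite subr_eq0 => /eqP <-; rewrite addrCA subrr addr0.
have [psi psiE] := phic.
have [U UP] := line_propagator x v Hn Hh; have [U' UP'] := line_propagator x v Hn' Hh'.
rewrite (segment_evolution HE Hh seg UP) (segment_evolution HE' Hh' seg UP').
case: seg => T0 _ cl _ _.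
have [|c c1 ->] := gauge_propagator (phi := fun t => psi (x + t *: v)) N0 (ltW T0) UP UP' (fun t => Hh _).
  by move=> t tT; apply: psiE; apply: cl; exact: subset_itv_oo_cc tT.
by rewrite /amplitude -scalemxAr -scalemxAl [X in _ = `|X|]mxE normrM c1 mul1r.
Qed.

Hypotheses (data : same_data Omega I F H H') (ideal : ideal_data I F).
Local Notation J := (quad N * bool)%type.
Definition ra x := ramat (Hx x) (Hx' x).
Definition rf x := rsource (Hx x) (Hx' x).

Lemma chord_system x v T : boundary_segment Omega x v T ->
  exists y : R -> J -> R, [/\ y 0 = (fun=> 0), y T = (fun=> 0) &
    forall (t : R) i, is_derive t 1 (fun s => y s i) (mv (ra (x + t *: v)) (y t) i + rf (x + t *: v) i)].
Proof.
move=> seg.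
have [U UP] := line_propagator x v Hn Hh; have [U' UP'] := line_propagator x v Hn' Hh'.
have [y [y0 yT yd]] := adjoint_system UP UP' (fun t => Hh' _).
exists y; split => //.
have T0 : 0 <= T by case: seg => /ltW.
have uU : U T \is unitarymx by case: UP => _ _; apply.
have uU' : U' T \is unitarymx by case: UP' => _ _; apply.
have [a b Fa Ib|phi UU] := ideal uU uU'.
  have := data Ib Fa seg.
  by rewrite (segment_evolution HE Hh seg UP) (segment_evolution HE' Hh' seg UP').
apply: (yT T _ T0 _ UU).
apply/eqP; rewrite -(@eqrXn2 _ 2)// normCK expr1n conjCE; apply/eqP.
by apply: ReIm_eq; rewrite ?Re_mul ?Im_mul /= ?mulrN ?opprK -?expr2 ?cos2Dsin2//; ring.
Qed.

Lemma ra_nice i j : nice Omega (fun x => ra x i j).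
Proof.
have Q p q := cnice_coef p q Hn Hn'.
case: i j => p [] [q []] /=; rewrite /ra /ramat /realify /=.
- exact: (Q p q).1.
- exact: (Q p q).2.
- by apply: niceN; exact: (Q p q).2.
- exact: (Q p q).1.
Qed.

Lemma rf_nice i : nice Omega (fun x => rf x i).
Proof.
have Q p : cnice Omega (fun x => tens_source (Hx x) (Hx' x) p).
  apply: cnice_sum => k; under eq_fun do rewrite mulrC.
  by apply: cniceZ; exact: cnice_coef.
by case: i => p [] /=; rewrite /rf /rsource /rpart /=; [exact: (Q p).2|exact: (Q p).1].
Qed.

(** On a chord from [x] of small length [T], each component of [u] vanishes at both ends, so by the
    mean value theorem [rf = - ra u] holds for that component at some point. There |u|^2 = O(T) by
    Gronwall, hence the square of [rf x i] is at most c T, with T below this square divided by c. *)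
Lemma rf_boundary x i : boundary Omega x -> rf x i = 0.
Proof.
move=> bx; apply: contrapT => /eqP fx.
have [L L0 [aL aB _]] := nice_uniform (fun k : J * J => ra_nice k.1 k.2).
have [M M0 [fL fB _]] := nice_uniform rf_nice.
pose q : R := #|{: J}|%:R * L.
pose rho := #|{: J}|%:R * M ^+ 2.
have rho0 : 0 <= rho by rewrite mulr_ge0// sqr_ge0.
pose c := 2 * M ^+ 2 + 2 * (q ^+ 2 * (expR (q ^+ 2 + 2) * rho)) + 1.
have c0 : 0 < c.
  by rewrite ltr_wpDl// addr_ge0// mulr_ge0 ?sqr_ge0// mulr_ge0 ?sqr_ge0// mulr_ge0 ?expR_ge0.
have f2 : 0 < rf x i ^+ 2 by rewrite exprn_even_gt0.
have n0 : 0 < n%:R :> R by rewrite ltr0n (ltn_trans _ n2).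
pose e := Num.min 1 (rf x i ^+ 2 / c) / n%:R.
have e0 : 0 < e by rewrite divr_gt0// lt_min ltr01 divr_gt0.
have [y [by_ yx ye]] := boundary_near dom n2 bx e0.
pose T := enorm (y - x).
have T0 : 0 < T by apply: enorm_gt0; rewrite subr_eq0.
have Te : T < Num.min 1 (rf x i ^+ 2 / c).
  apply: (le_lt_trans (enorm_le_norm _)); rewrite mulrC -ltr_pdivlMr//.
move: Te; rewrite lt_min => /andP[T1 Tc].
pose v := T^-1 *: (y - x).
have v1 : enorm v = 1 by rewrite /v enormZ gtr0_norm ?invr_gt0// mulVf// gt_eqF.
have xTv : x + T *: v = y by rewrite /v scalerA mulfV ?gt_eqF// scale1r addrCA subrr addr0.
have seg : boundary_segment Omega x v T by apply: boundary_chord => //; rewrite xTv.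
have [u [u0 uT ud]] := chord_system seg.
have [t tT E] := @MVT R (fun s => u s i) (fun t => mv (ra (x + t *: v)) (u t) i + rf (x + t *: v) i) 0 T T0
  (fun t _ => ud t i) (is_derive_within (fun t _ => ud t i)).
move: E; rewrite uT u0 subrr subr0 => /eqP; rewrite eq_sym mulf_eq0 (gt_eqF T0) orbF => /eqP E.
move: tT; rewrite in_itv/= => /andP[t0 tT].
have Nu : nsq (u t) <= expR (q ^+ 2 + 2) * (rho * T).
  have G := @gronwall_vec R _ L rho 0 t u (fun s => rf (x + s *: v)) (fun s => ra (x + s *: v)) (ltW t0) rho0
   (fun s i j => aB (i, j) _) (fun s i _ => ud s i)
   (fun i => is_derive_within (fun s _ => ud s i)) (fun s _ => le_nsq (fun i => fB i _)).
  apply: (le_trans G); rewrite u0 nsq_cst0 add0r subr0; apply: ler_pM.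
  - exact: expR_ge0.
  - by rewrite mulr_ge0// ltW.
  - by rewrite ler_expR ler_piMr// ?addr_ge0 ?sqr_ge0// ltW// (lt_trans tT).
  - by apply: ler_wpM2l => //; exact: ltW.
have M1 : `|rf x i - rf (x + t *: v) i| <= M * T.
  apply: le_trans (fL _ _ _) _; apply: ler_wpM2l => //.
  rewrite opprD addrA subrr add0r normrN normrZ gtr0_norm//.
  have := norm_le_enorm v; rewrite v1 => /(ler_wpM2l (ltW t0)); rewrite mulr1 => /le_trans; apply.
  exact: ltW.
have M2 : mv (ra (x + t *: v)) (u t) i ^+ 2 <= q ^+ 2 * (expR (q ^+ 2 + 2) * (rho * T)).
  apply: (le_trans (sqr_le_nsq (mv (ra (x + t *: v)) (u t)) i)).
  apply: (le_trans (nsq_mv (u t) (fun i j => aB (i, j) _))).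
  by apply: ler_wpM2l => //; exact: sqr_ge0.
have M1' : (rf x i - rf (x + t *: v) i) ^+ 2 <= M ^+ 2 * T.
  rewrite -real_normK ?num_real//.
  apply: (@le_trans _ _ ((M * T) ^+ 2)).
    by apply: lerXn2r; rewrite ?nnegrE ?mulr_ge0 ?(ltW T0).
  by rewrite exprMn; apply: ler_wpM2l; rewrite ?sqr_ge0// expr2 ler_piMr// ltW.
have fE : rf (x + t *: v) i = - mv (ra (x + t *: v)) (u t) i by apply/eqP; rewrite -addr_eq0 addrC E.
have fin : rf x i ^+ 2 <= 2 * (M ^+ 2 * T) + 2 * (q ^+ 2 * (expR (q ^+ 2 + 2) * (rho * T))).
  move: M1' M2; rewrite fE opprK; move: (mv _ _ _) (rf x i) (M ^+ 2 * T) (q ^+ 2 * _) => a b k l H1 H2.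
  have -> : b = (b + a) - a by ring.
  by have := sqr_ge0 (b + a + a); nra.
move: Tc; rewrite ltr_pdivlMr// => Tc; move: fin; rewrite leNgt => /negP; apply.
apply: le_lt_trans Tc; rewrite /c.
have -> : T * (2 * M ^+ 2 + 2 * (q ^+ 2 * (expR (q ^+ 2 + 2) * rho)) + 1) =
  2 * (M ^+ 2 * T) + 2 * (q ^+ 2 * (expR (q ^+ 2 + 2) * (rho * T))) + T by ring.
by rewrite lerDl ltW.
Qed.

End Rays.

(** * Planar slices *)

Section Uniqueness.
Variables (R : realType) (J : finType).
Implicit Types (m : R -> J -> J -> R) (e r : R -> J -> R).

Lemma ode_zero m e r A0 a b : a <= b -> (forall t i j, `|m t i j| <= A0) ->
  (forall (t : R) i, is_derive t 1 (fun s => e s i) (mv (m t) (e t) i + r t i)) ->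
  (forall t, a < t < b -> forall i, r t i = 0) -> e a = (fun=> 0) -> e b = (fun=> 0).
Proof.
move=> ab mA ed r0 ea.
have rr (t : R) : t \in `]a, b[ -> nsq (r t) <= 0.
  rewrite in_itv/= => tab; rewrite (_ : r t = fun=> 0) ?nsq_cst0//.
  by apply/funext => i; exact: r0.
have := gronwall_vec ab (lexx 0) mA (fun t i _ => ed t i) (fun i => is_derive_within (fun t _ => ed t i)) rr.
rewrite ea nsq_cst0 mul0r addr0 mulr0 => H.
have E : nsq (e b) = 0 by apply/eqP; rewrite eq_le H nsq_ge0.
by apply/funext => i; exact: nsq_eq0.
Qed.

Lemma ode_zero_backward m e r A0 a b : a <= b -> (forall t i j, `|m t i j| <= A0) ->
  (forall (t : R) i, is_derive t 1 (fun s => e s i) (mv (m t) (e t) i + r t i)) ->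
  (forall t, a < t < b -> forall i, r t i = 0) -> e b = (fun=> 0) -> e a = (fun=> 0).
Proof.
move=> ab mA ed r0 eb.
have N (t : R) : is_derive t 1 (fun s : R => - s) (-1).
  by have := is_derive_affine (-1) 0 t; under eq_fun do rewrite addr0 mulN1r.
have D (t : R) i : is_derive t 1 (fun s => e (- s) i)
    (mv (fun i j => - m (- t) i j) (e (- t)) i + - r (- t) i).
  have := @is_derive1_comp R (fun s => e s i) (fun s => - s) t _ _ (ed (- t) i) (N t).
  rewrite mulrN1 opprD; congr is_derive; congr (_ - _).
  by rewrite /mv -sumrN; apply: eq_bigr => j _; rewrite mulNr.
have := @ode_zero (fun t i j => - m (- t) i j) (fun t => e (- t)) (fun t i => - r (- t) i) A0 (- b) (- a).
rewrite !opprK lerN2; apply => // [t i j|t /andP[bt ta] i].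
  by rewrite normrN.
by rewrite r0 ?oppr0// ltrNr ta ltrNl bt.
Qed.

End Uniqueness.

Lemma ler_norm_affine (R : realFieldType) (A B s' t s r : R) : s' <= t -> t <= s ->
  `|A + s * B| <= r -> `|A + s' * B| <= r -> `|A + t * B| <= r.
Proof.
rewrite !ler_norml => st ts /andP[h1 h2] /andP[h3 h4].
have [B0|/ltW B0] := leP 0 B.
  by have := ler_wpM2r B0 ts; have := ler_wpM2r B0 st; move=> *; apply/andP; split; lra.
by have := ler_wnM2r B0 ts; have := ler_wnM2r B0 st; move=> *; apply/andP; split; lra.
Qed.

Section Frame.
Variable R : realType.

(** The first vector is (-q, p, 0) / k, the second the cross product of the unit vector (p, q, r) /
    l with it. The case p = q = 0, which includes the zero vector, takes the horizontal plane. *)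
Lemma frame (p q r : R) : exists a1 b1 c1 a2 b2 c2 : R,
  [/\ a1 ^+ 2 + b1 ^+ 2 + c1 ^+ 2 = 1, a2 ^+ 2 + b2 ^+ 2 + c2 ^+ 2 = 1,
      a1 * a2 + b1 * b2 + c1 * c2 = 0, p * a1 + q * b1 + r * c1 = 0 & p * a2 + q * b2 + r * c2 = 0].
Proof.
have [pq0|pq0] := eqVneq (p ^+ 2 + q ^+ 2) 0.
  move/eqP: pq0; rewrite paddr_eq0 ?sqr_ge0// !sqrf_eq0 => /andP[/eqP-> /eqP->].
  by exists 1, 0, 0, 0, 1, 0; split; ring.
have P : 0 < p ^+ 2 + q ^+ 2 by rewrite lt_neqAle eq_sym pq0 addr_ge0 ?sqr_ge0.
have Q : 0 < p ^+ 2 + q ^+ 2 + r ^+ 2 by rewrite ltr_wpDr ?sqr_ge0.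
pose k := Num.sqrt (p ^+ 2 + q ^+ 2); pose l := Num.sqrt (p ^+ 2 + q ^+ 2 + r ^+ 2).
have k2 : k ^+ 2 = p ^+ 2 + q ^+ 2 by rewrite sqr_sqrtr// ltW.
have l2 : l ^+ 2 = p ^+ 2 + q ^+ 2 + r ^+ 2 by rewrite sqr_sqrtr// ltW.
have k0 : k != 0 by rewrite gt_eqF// sqrtr_gt0.
have l0 : l != 0 by rewrite gt_eqF// sqrtr_gt0.
exists (- q / k), (p / k), 0, (- r * p / (k * l)), (- r * q / (k * l)), ((p ^+ 2 + q ^+ 2) / (k * l)).
split; last 3 first.
- by field; rewrite ?k0 ?l0.
- by field.
- by field; rewrite ?k0 ?l0.
- have -> : (- q / k) ^+ 2 + (p / k) ^+ 2 + 0 ^+ 2 = (p ^+ 2 + q ^+ 2) / k ^+ 2 by field.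
  by rewrite k2 divff.
have -> : (- r * p / (k * l)) ^+ 2 + (- r * q / (k * l)) ^+ 2 + ((p ^+ 2 + q ^+ 2) / (k * l)) ^+ 2 =
  (p ^+ 2 + q ^+ 2) * (p ^+ 2 + q ^+ 2 + r ^+ 2) / (k ^+ 2 * l ^+ 2) by field; rewrite ?k0 ?l0.
by rewrite k2 l2 divff// mulf_neq0// gt_eqF.
Qed.

Variables (n : nat) (ia ib ic : 'I_n).
Hypotheses (ab : ia != ib) (ac : ia != ic) (bc : ib != ic).

Definition vec3 (a b c : R) : 'rV[R]_n :=
  \row_i (if i == ia then a else if i == ib then b else if i == ic then c else 0).

Lemma vec3_a a b c : vec3 a b c ord0 ia = a. Proof. by rewrite mxE eqxx. Qed.
Lemma vec3_b a b c : vec3 a b c ord0 ib = b.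
Proof. by rewrite mxE eq_sym (negbTE ab) eqxx. Qed.
Lemma vec3_c a b c : vec3 a b c ord0 ic = c.
Proof. by rewrite mxE eq_sym (negbTE ac) [ic == _]eq_sym (negbTE bc) eqxx. Qed.

Lemma enorm_vec3 a b c : enorm (vec3 a b c) = Num.sqrt (a ^+ 2 + b ^+ 2 + c ^+ 2).
Proof.
rewrite /enorm; congr Num.sqrt.
rewrite (bigD1 ia)//= (bigD1 ib) ?[ib == _]eq_sym//= (bigD1 ic) /=; last first.
  by rewrite eq_sym ac eq_sym bc.
rewrite vec3_a vec3_b vec3_c big1 ?addr0 ?addrA// => i /andP[/andP[i1 i2] i3].
by rewrite mxE (negbTE i1) (negbTE i2) (negbTE i3) expr0n.
Qed.

Lemma vec3D (k l a b c a' b' c' : R) :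
  k *: vec3 a b c + l *: vec3 a' b' c' = vec3 (k * a + l * a') (k * b + l * b') (k * c + l * c').
Proof. by apply/rowP => i; rewrite !mxE; do 3?case: ifP => // _; rewrite !mulr0 addr0. Qed.

End Frame.

Section Slice.
Variables (R : realType) (n : nat) (J : finType) (Omega : set 'rV[R]_n).
Hypotheses (dom : bounded_convex_domain Omega) (n3 : (3 <= n)%N).
Variables (a : 'rV[R]_n -> J -> J -> R) (f : 'rV[R]_n -> J -> R) (L : R).
Hypotheses (L0 : 0 <= L).
Hypothesis aL : forall i j x y, `|a x i j - a y i j| <= L * `|x - y|.
Hypothesis aB : forall x i j, `|a x i j| <= L.
Hypothesis fL : forall i x y, `|f x i - f y i| <= L * `|x - y|.
Hypothesis fB : forall x i, `|f x i| <= L.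
Hypothesis add : forall e, 0 < e -> exists2 d, 0 < d & forall i j p q z, `|z| <= d ->
      Omega p -> Omega (p + q) -> Omega (p + z) -> Omega (p + q + z) ->
      `|a (p + q + z) i j - a (p + z) i j - a (p + q) i j + a p i j| <= e * `|q|.
Hypothesis fdd : forall e, 0 < e -> exists2 d, 0 < d & forall i p q z, `|z| <= d ->
      Omega p -> Omega (p + q) -> Omega (p + z) -> Omega (p + q + z) ->
      `|f (p + q + z) i - f (p + z) i - f (p + q) i + f p i| <= e * `|q|.
Hypothesis fbd : forall x i, boundary Omega x -> f x i = 0.
Hypothesis chords : forall x v T, boundary_segment Omega x v T ->
  exists y : R -> J -> R, [/\ y 0 = (fun=> 0), y T = (fun=> 0) &
    forall (t : R) i, is_derive t 1 (fun s => y s i) (mv (a (x + t *: v)) (y t) i + f (x + t *: v) i)].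

Definition fh x i : R := if pselect (Omega x) then f x i else 0.

Lemma fh_in x i : Omega x -> fh x i = f x i.
Proof. by rewrite /fh; case: pselect. Qed.
Lemma fh_out x i : ~ Omega x -> fh x i = 0.
Proof. by rewrite /fh; case: pselect. Qed.
Lemma fhL i x y : `|fh x i - fh y i| <= L * `|x - y|.
Proof. exact: (zero_extension_lipschitz dom L0 (fL i) (fun x => @fbd x i)). Qed.
Lemma fhB x i : `|fh x i| <= L.
Proof. by rewrite /fh; case: pselect => Ox; rewrite /= ?normr0. Qed.

Lemma line_convex q w (s t s' : R) : Omega (q + s *: w) -> Omega (q + s' *: w) ->
  s <= t <= s' -> Omega (q + t *: w).
Proof.
move=> Os Os' /andP[st ts]; have [ss|ss] := eqVneq s s'.
  by have -> : t = s by apply/eqP; rewrite eq_le st ss ts.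
have lt : 0 < s' - s by rewrite subr_gt0 lt_neqAle ss (le_trans st).
have t01 : 0 <= (t - s) / (s' - s) <= 1.
  by rewrite divr_ge0 ?subr_ge0 ?(le_trans st)//= ler_pdivrMr// mul1r lerB.
have := domain_convex dom Os Os' t01.
suff -> : q + s *: w + ((t - s) / (s' - s)) *: (q + s' *: w - (q + s *: w)) = q + t *: w by [].
by apply/matrixP => i j; rewrite !mxE; field; rewrite gt_eqF.
Qed.

Section Line.
Variables (q w : 'rV[R]_n) (y : R -> J -> R).
Hypothesis w1 : enorm w = 1.
Hypothesis ym1 : y (-1) = (fun=> 0).
Hypothesis yd : forall (t : R) i, is_derive t 1 (fun s => y s i)
  (mv (a (q + t *: w)) (y t) i + fh (q + t *: w) i).
Hypothesis early : forall t, t <= -1 -> forall i, fh (q + t *: w) i = 0.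

(** Uniqueness from the time -1, forwards or backwards according to the position of [t]; in the
    latter case the source vanishes by [early]. *)
Lemma line_zero_before t : (forall s, s <= t -> forall i, fh (q + s *: w) i = 0) -> y t = (fun=> 0).
Proof.
move=> H; have [t1|t1] := leP (-1) t.
  apply: (ode_zero t1 (fun t i j => aB _ i j) yd _ ym1) => s /andP[_ st] i.
  by apply: H; exact: ltW.
apply: (ode_zero_backward (ltW t1) (fun t i j => aB _ i j) yd _ ym1) => s /andP[_ s1] i.
by apply: early; exact: ltW.
Qed.

Lemma leaves (s sg : R) : `|sg| = 1 -> exists2 s', 0 <= s' & ~ Omega (q + s *: w + s' *: (sg *: w)).
Proof.
move=> sg1; have [b b0 bO] := domain_bounded dom.
have n0 : 0 < n%:R :> R by rewrite ltr0n (leq_trans _ n3).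
pose s' : R := n%:R * (b + `|q + s *: w| + 1).
have s'0 : 0 <= s' by rewrite mulr_ge0// addr_ge0// addr_ge0// ltW.
exists s' => // /bO H.
have W : 1 <= n%:R * `|w| by have := enorm_le_norm w; rewrite w1.
have : `|s' *: (sg *: w)| <= b + `|q + s *: w|.
  have := ler_normB (q + s *: w + s' *: (sg *: w)) (q + s *: w).
  by rewrite addrAC subrr add0r => /le_trans; apply; rewrite lerD2r.
have nE (k : R) : 0 <= k -> `|k *: (sg *: w)| = k * `|w|.
  by move=> k1; rewrite normrZ normrZ sg1 mul1r ger0_norm.
rewrite (nE _ s'0) /s' mulrAC.
have c0 : 0 <= b + `|q + s *: w| by rewrite addr_ge0// ltW.
by move: (b + `|_|) c0 => c c0; nra.
Qed.

(* Between the two boundary points of the line [y] agrees with the solution given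
   by [chords], hence vanishes again at the exit point. *)
Lemma line_zero_outside t : ~ Omega (q + t *: w) -> y t = (fun=> 0).
Proof.
have before s : ~ Omega (q + s *: w) -> (forall s', s' < s -> ~ Omega (q + s' *: w)) -> y s = (fun=> 0).
  move=> Os H; apply: line_zero_before => s'; rewrite le_eqVlt => /orP[/eqP->|/H nO] i; exact: fh_out.
move=> nO; have [[s [st Os]]|none] := pselect (exists s, s < t /\ Omega (q + s *: w)); last first.
  by apply: before => // s st Os; apply: none; exists s.
have shift (u : R) : q + s *: w + u *: w = q + (s + u) *: w by rewrite scalerDl addrA.
have shiftN (u : R) : q + s *: w + u *: (-1 *: w) = q + (s - u) *: w.
  by rewrite scalerA mulrN1 scaleNr scalerBl addrA.
have ts0 : 0 <= t - s by rewrite subr_ge0 ltW.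
have nO' : ~ Omega (q + s *: w + (t - s) *: w) by rewrite shift addrCA subrr addr0.
have [s2 [s20 s2t bd2 in2]] := exit_point dom Os ts0 nO'.
have [s' s'0 nOs'] := @leaves s (-1) (etrans (normrN1 _) erefl).
have [s1 [s10 _ bd1 in1]] := exit_point dom Os s'0 nOs'.
rewrite shiftN in bd1; rewrite shift in bd2.
pose T := s1 + s2.
have T0 : 0 < T by rewrite addr_gt0.
have qT u : q + (s - s1) *: w + u *: w = q + (s - s1 + u) *: w by rewrite [in RHS]scalerDl addrA.
have nO1 := ((boundaryE dom _).1 bd1).2; have nO2 := ((boundaryE dom _).1 bd2).2.
have seg : boundary_segment Omega (q + (s - s1) *: w) w T.
  have e : s - s1 + T = s + s2 by rewrite /T; ring.
  by apply: (boundary_chord dom T0 w1 bd1); rewrite qT e.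
have [yc [yc0 ycT ycd]] := chords seg.
have y1 : y (s - s1) = (fun=> 0).
  apply: before => // r rs Or; apply: nO1; apply: (line_convex Or Os).
  by rewrite (ltW rs) lerBlDr lerDl ltW.
have y2 : y (s + s2) = (fun=> 0).
  pose e u i := y (s - s1 + u) i - yc u i.
  have S (u : R) : is_derive u 1 (fun r : R => s - s1 + r) 1.
    by have := is_derive_affine 1 (s - s1) u; under eq_fun do rewrite mul1r addrC.
  have ed (u : R) i : is_derive u 1 (fun r => e r i) (mv (a (q + (s - s1 + u) *: w)) (e u) i +
      (fh (q + (s - s1 + u) *: w) i - f (q + (s - s1 + u) *: w) i)).
    have Y := @is_derive1_comp R (fun r => y r i) (fun r => s - s1 + r) u _ _ (yd (s - s1 + u) i) (S u).
    have := is_deriveB Y (ycd u i); rewrite mulr1 qT => D.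
    by apply: (is_derive_eq D); rewrite /e mvB; ring.
  have E : e T = (fun=> 0).
    apply: (@ode_zero R J (fun u => a (q + (s - s1 + u) *: w)) e
      (fun u i => fh (q + (s - s1 + u) *: w) i - f (q + (s - s1 + u) *: w) i) L 0 T (ltW T0)) => //.
    - move=> u /andP[u0 uT] i; rewrite fh_in ?subrr//.
      have [us|us] := leP u s1.
        have := in1 (s1 - u); rewrite shiftN opprB addrA [s + u - s1]addrAC => H.
        by apply: H; rewrite ?subr_ge0// ltrBlDr ltrDl.
      have := in2 (u - s1); rewrite shift addrA [s + u - s1]addrAC => H.
      by apply: H; rewrite ?subr_ge0 ?(ltW us)// ltrBlDl.
    - by apply/funext => i; rewrite /e addr0 y1 yc0 subrr.
  apply/funext => i; have := congr1 (fun F => F i) E; rewrite /e ycT subr0.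
  by have -> : s - s1 + T = s + s2 by rewrite /T; ring.
have s2t' : s + s2 <= t by rewrite -lerBrDl.
apply: (ode_zero s2t' (fun t i j => aB _ i j) yd _ y2) => u /andP[u2 ut] i.
apply: fh_out => Ou; apply: nO2; apply: (line_convex Os Ou).
by rewrite lerDl (ltW s20) ltW.
Qed.

(** Backward uniqueness from a point of the line beyond [t] and outside [Omega], where
    [line_zero_outside] applies. *)
Lemma line_zero_after t : (forall s, t <= s -> forall i, fh (q + s *: w) i = 0) -> y t = (fun=> 0).
Proof.
move=> H; have [s s0 nO] := @leaves t 1 (normr1 _).
rewrite scale1r -addrA -scalerDl in nO.
have ts : t <= t + s by rewrite lerDl.
apply: (ode_zero_backward ts (fun t i j => aB _ i j) yd _ (line_zero_outside nO)) => u /andP[tu _] i.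
by apply: H; exact: ltW.
Qed.

End Line.

(* The function [Fx] grows by [z.1 ^+ 2 + z.2 ^+ 2] on the plane spanned by the
   frame at [x0], so almost maximality of [Fx x0] confines the support of [f] in
   this plane to a small disc. *)
Lemma slice_uniqueness x i : Omega x -> f x i = 0.
Proof.
move=> Ox; apply: contrapT => /eqP fx.
pose ia : 'I_n := Ordinal (ltnW (ltnW n3)).
pose ib : 'I_n := Ordinal (ltnW n3).
pose ic : 'I_n := Ordinal n3.
have ab : ia != ib by [].
have ac : ia != ic by [].
have bc : ib != ic by [].
pose q : R := #|J|%:R * L.
have q0 : 0 <= q by rewrite mulr_ge0.
(* The factor 32 gives 32 q rad <= 1, hence 512 q^2 rad^2 <= 1/2. The choice involves only [L] and
   the number of components, not the slice. *)
pose rad : R := Num.min 4^-1 (32 * (q + 1))^-1.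
have k0 : 0 < 32 * (q + 1) by rewrite mulr_gt0// ltr_wpDl.
have rad0 : 0 < rad by rewrite lt_min !invr_gt0 k0 ltr0n.
have rad1 : rad <= 4^-1 by rewrite ge_min lexx.
have small : 512 * (#|J|%:R * L) ^+ 2 * rad ^+ 2 <= 1.
  have h1 : rad * (32 * (q + 1)) <= 1.
    by rewrite -ler_pdivlMr// mul1r ge_min lexx orbT.
  have h2 : 32 * (q * rad) <= 1 by move: h1 rad0; clearbody rad q; nra.
  have h3 : 0 <= q * rad by rewrite mulr_ge0// ltW.
  rewrite -mulrA -exprMn -/q; clearbody rad q.
  by move: (q * rad) h2 h3 => z h2 h3; nra.
pose Fx (x : 'rV[R]_n) := x ord0 ia ^+ 2 + x ord0 ib ^+ 2 + x ord0 ic ^+ 2.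
pose S := [set r | exists x, [/\ Omega x, (exists i, f x i != 0) & r = Fx x]].
have [b b0 bO] := domain_bounded dom.
have Ssup : has_sup S.
  split; first by exists (Fx x), x; split => //; exists i.
  exists (b ^+ 2 + b ^+ 2 + b ^+ 2) => _ [z [Oz _ ->]].
  have c (k : 'I_n) : z ord0 k ^+ 2 <= b ^+ 2.
    rewrite -real_normK ?num_real//; apply: lerXn2r; rewrite ?nnegrE ?(ltW b0)//.
    by apply: le_trans (coord_le_norm z k) _; exact: bO.
  by rewrite /Fx !lerD.
have rad20 : 0 < rad ^+ 2 by rewrite exprn_gt0.
(* Almost maximal up to the square of the admissible radius. *)
have [_ [x0 [Ox0 [i0 fx0] ->]] Fx0] := sup_adherent rad20 Ssup.
have Fle z : Omega z -> (exists i, f z i != 0) -> Fx z < Fx x0 + rad ^+ 2.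
  move=> Oz fz; rewrite -ltrBlDr; apply: le_lt_trans Fx0; rewrite lerD2r.
  by apply: (sup_upper_bound Ssup); exists z.
have [a1 [b1 [c1 [a2 [b2 [c2 [n1 n2 o12 o1 o2]]]]]]] :=
  frame (x0 ord0 ia) (x0 ord0 ib) (x0 ord0 ic).
pose iota (z : R * R) : 'rV[R]_n := z.1 *: vec3 ia ib ic a1 b1 c1 + z.2 *: vec3 ia ib ic a2 b2 c2.
have iotaE z : iota z = vec3 ia ib ic (z.1 * a1 + z.2 * a2) (z.1 * b1 + z.2 * b2) (z.1 * c1 + z.2 * c2).
  exact: vec3D.
have iotaD z z' : iota (z + z') = iota z + iota z'.
  by rewrite /iota /= !scalerDl addrACA.
have iotaZ k z : iota (k *: z) = k *: iota z.
  by rewrite /iota /= scalerDr !scalerA.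
have iotaN z z' : iota (z - z') = iota z - iota z'.
  by rewrite iotaD -scaleN1r iotaZ scaleN1r.
have iota_sq z : enorm (iota z) ^+ 2 = z.1 ^+ 2 + z.2 ^+ 2.
  rewrite iotaE enorm_vec3// sqr_sqrtr; last by rewrite !addr_ge0 ?sqr_ge0.
  have -> : (z.1 * a1 + z.2 * a2) ^+ 2 + (z.1 * b1 + z.2 * b2) ^+ 2 + (z.1 * c1 + z.2 * c2) ^+ 2 =
    z.1 ^+ 2 * (a1 ^+ 2 + b1 ^+ 2 + c1 ^+ 2) + z.2 ^+ 2 * (a2 ^+ 2 + b2 ^+ 2 + c2 ^+ 2) +
    2 * z.1 * z.2 * (a1 * a2 + b1 * b2 + c1 * c2) by ring.
  by rewrite n1 n2 o12 !mulr1 mulr0 addr0.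
have iota_norm z : `|iota z| <= 2 * pnorm z.
  apply: le_trans (norm_le_enorm _) _.
  have p0 := pnorm_ge0 z.
  rewrite -(@ler_pXn2r _ 2)// ?nnegrE ?enorm_ge0 ?mulr_ge0// iota_sq.
  have [z1 z2] : `|z.1| <= pnorm z /\ `|z.2| <= pnorm z.
    by apply/andP; rewrite -pnorm_le.
  rewrite -(real_normK (num_real z.1)) -(real_normK (num_real z.2)).
  by move: (`|z.1|) (`|z.2|) (normr_ge0 z.1) (normr_ge0 z.2) (pnorm z) p0 z1 z2 => s t s0 t0 p p0 sp tp; nra.
have Fx_iota z : Fx (x0 + iota z) = Fx x0 + (z.1 ^+ 2 + z.2 ^+ 2).
  rewrite -iota_sq iotaE enorm_vec3// sqr_sqrtr; last by rewrite !addr_ge0 ?sqr_ge0.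
  have m (u v : 'rV[R]_n) k : (u + v) ord0 k = u ord0 k + v ord0 k by rewrite mxE.
  rewrite /Fx !m vec3_a vec3_b// vec3_c//.
  have -> : (x0 ord0 ia + (z.1 * a1 + z.2 * a2)) ^+ 2 + (x0 ord0 ib + (z.1 * b1 + z.2 * b2)) ^+ 2 +
     (x0 ord0 ic + (z.1 * c1 + z.2 * c2)) ^+ 2 =
     x0 ord0 ia ^+ 2 + x0 ord0 ib ^+ 2 + x0 ord0 ic ^+ 2 +
     ((z.1 * a1 + z.2 * a2) ^+ 2 + (z.1 * b1 + z.2 * b2) ^+ 2 + (z.1 * c1 + z.2 * c2) ^+ 2) +
     2 * z.1 * (x0 ord0 ia * a1 + x0 ord0 ib * b1 + x0 ord0 ic * c1) +
     2 * z.2 * (x0 ord0 ia * a2 + x0 ord0 ib * b2 + x0 ord0 ic * c2) by ring.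
  by rewrite o1 o2 !mulr0 !addr0.
pose ap z := a (x0 + iota z); pose fp z := fh (x0 + iota z).
pose K z := Omega (x0 + iota z).
have far z k : rad < pnorm z -> fp z k = 0.
  move=> rz; apply: contrapT => /eqP fz.
  have Kz : Omega (x0 + iota z).
    by apply: contrapT => nO; move/eqP: fz; apply; exact: fh_out.
  have := Fle _ Kz (ex_intro _ k _); rewrite /fp fh_in// in fz; move=> /(_ fz).
  rewrite Fx_iota ltrD2l; apply/negP; rewrite -leNgt.
  have rz2 : rad ^+ 2 <= pnorm z ^+ 2 by apply: lerXn2r; rewrite ?nnegrE ?pnorm_ge0 ?ltW.
  apply: (le_trans rz2); rewrite /pnorm.
  have [_|_] := leP `|z.1| `|z.2|; rewrite real_normK ?num_real// ?lerDl ?lerDr ?sqr_ge0//.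
have dirN th : cos th ^+ 2 + sin th ^+ 2 = 1 :> R by rewrite cos2Dsin2.
pose perp (V : R * R) : R * R := (- V.2, V.1).
pose dot (z V : R * R) : R := z.1 * V.1 + z.2 * V.2.
(* One solution for each direction vector and offset of a line. As the choice depends on the vector
   and not on the angle, [u] is 2 pi periodic, and all points of an oriented line share the same
   solution. *)
have /choice[Y YP] (Vb : (R * R) * R) : exists y : R -> J -> R, y (-1) = (fun=> 0) /\
    forall (t : R) k, is_derive t 1 (fun s => y s k)
      (mv (a (x0 + iota (Vb.2 *: perp Vb.1) + t *: iota Vb.1)) (y t) k +
       fh (x0 + iota (Vb.2 *: perp Vb.1) + t *: iota Vb.1) k).
  apply: (linear_ode (-1) (fun=> 0) L0 L0).
  - by move=> k l; apply: (@lipschitz_line R n (fun z => a z k l) L) => //; exact: aL.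
  - by move=> k; apply: (@lipschitz_line R n (fun z => fh z k) L) => //; exact: fhL.
  - by move=> t k l; exact: aB.
  - by move=> t k; exact: fhB.
pose u th z := Y (dir th, dot z (perp (dir th))) (dot z (dir th)).
have line V b' t : x0 + iota (b' *: perp V) + t *: iota V = x0 + iota (b' *: perp V + t *: V).
  by rewrite iotaD -addrA [iota (t *: V)]iotaZ.
have zE (k : R) (z : R * R) : k *: z = (k * z.1, k * z.2) by [].
have addE (z z' : R * R) : z + z' = (z.1 + z'.1, z.2 + z'.2) by [].
have decomp th (z : R * R) : z = dot z (perp (dir th)) *: perp (dir th) + dot z (dir th) *: dir th.
  have e := dirN th; rewrite addE !zE; case: z => z1 z2; rewrite /dot /perp /dir /=; congr pair.
    by rewrite -{1}[z1]mulr1 -e; ring.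
  by rewrite -{1}[z2]mulr1 -e; ring.
have w1 th : enorm (iota (dir th)) = 1.
  by apply/eqP; rewrite -(@eqrXn2 _ 2)// ?enorm_ge0// iota_sq dirN expr1n.
(* For t <= -1 the Euclidean norm is at least 1, whereas points of the box of radius rad <= 1/4 have
   square norm at most 1/8. *)
have early th b' t : t <= -1 -> forall k, fh (x0 + iota (b' *: perp (dir th)) + t *: iota (dir th)) k = 0.
  move=> t1 k; rewrite line; apply: far; rewrite ltNge; apply/negP.
  rewrite pnorm_le addE !zE /= => /andP[A B].
  have sq (s : R) : `|s| <= rad -> s ^+ 2 <= 16^-1.
    move=> sr; have sr4 := le_trans sr rad1; rewrite -real_normK ?num_real//.
    have := normr_ge0 s; have := @lerXn2r R 2 `|s| 4^-1; rewrite !nnegrE invr_ge0 ler0n.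
    by move=> H s0; have := H s0 isT sr4; lra.
  have A2 := sq _ A; have B2 := sq _ B; have e := dirN th.
  have E : (b' * - sin th + t * cos th) ^+ 2 + (b' * cos th + t * sin th) ^+ 2 = b' ^+ 2 + t ^+ 2.
    by rewrite -[RHS]mulr1 -e; ring.
  have b2' := sqr_ge0 b'; have t1' : 1 <= - t by rewrite lerNr.
  have t2 : 1 <= t ^+ 2.
    by rewrite -sqrrN expr2; apply: (le_trans t1'); rewrite ler_peMl// (le_trans ler01 t1').
  by have := lerD A2 B2; rewrite E; lra.
have uout th z : ~ K z -> forall k, u th z k = 0.
  move=> nK k; rewrite /u.
  have [y1 yd] := YP (dir th, dot z (perp (dir th))).
  by rewrite (line_zero_outside (w1 th) y1 yd (early th _))// line -decomp.
have ufar th z k : rad < pnorm z -> u th z k = 0.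
  move=> rz; rewrite /u.
  have [y1 yd] := YP (dir th, dot z (perp (dir th))).
  set t := dot z (dir th); set bb := dot z (perp (dir th)).
  (* The box meets the line in an interval. As [z] is outside the box, it comes before or after the
     whole support of the source on its line. *)
  have [H|nH] := pselect (forall s, s <= t -> forall k, fh (x0 + iota (bb *: perp (dir th)) + s *: iota (dir th)) k = 0).
    by rewrite (line_zero_before y1 yd (early th _) H).
  rewrite (line_zero_after (w1 th) y1 yd (early th _))// => s ts l.
  rewrite line; apply: contrapT => fs; apply: nH => s' st l'.
  rewrite line; apply: contrapT => fs'.
  have p1 : pnorm (bb *: perp (dir th) + s *: dir th) <= rad.
    by rewrite leNgt; apply/negP => rz'; apply: fs; exact: far.
  have p2 : pnorm (bb *: perp (dir th) + s' *: dir th) <= rad.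
    by rewrite leNgt; apply/negP => rz'; apply: fs'; exact: far.
  move: rz; rewrite (decomp th z) -/t -/bb ltNge => /negP; apply.
  have cv (A B : R) : `|A + s * B| <= rad -> `|A + s' * B| <= rad -> `|A + t * B| <= rad.
    exact: ler_norm_affine st ts.
  move: p1 p2; rewrite !pnorm_le !addE !zE /= => /andP[h1 h2] /andP[h3 h4].
  by rewrite !cv.
have L2 : 0 <= 2 * L by rewrite mulr_ge0.
have lipp (g : 'rV[R]_n -> R) z z' : (forall x y, `|g x - g y| <= L * `|x - y|) ->
    `|g (x0 + iota z) - g (x0 + iota z')| <= 2 * L * pnorm (z - z').
  move=> gL; apply: le_trans (gL _ _) _; rewrite opprD addrACA subrr add0r -iotaN.
  by rewrite [2 * L]mulrC -mulrA ler_wpM2l.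
have [r r0 rO] := domain_open dom Ox0.
have := @planar_uniqueness R J ap fp u K L (2 * L) rad (r / 4) L2 rad0 rad1 (divr_gt0 r0 _)
  (fun z k l => aB _ k l) (fun z z' k l => lipp (fun x => a x k l) z z' (aL k l))
  (fun z z' k => lipp (fun x => fh x k) z z' (@fhL k)) _ (fun th z k => @ufar th z k) far _ small _ _ uout.
move=> PU; move/eqP: fx0; apply.
have f00 : fp 0 i0 = f x0 i0.
  have e0 : iota 0 = 0 by rewrite /iota !scale0r addr0.
  by rewrite /fp e0 addr0 fh_in.
rewrite -f00; apply: PU => //.
- move=> th z t k; have e := dirN th.
  have uE (s : R) : u th (z + s *: dir th) = Y (dir th, dot z (perp (dir th))) (dot z (dir th) + s).
    rewrite /u; congr (Y (_, _) _); rewrite /dot addE !zE /=; first by ring.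
    by rewrite -[X in _ = _ + X]mulr1 -e; ring.
  have [_ yd] := YP (dir th, dot z (perp (dir th))).
  have Sd : is_derive t 1 (fun s : R => dot z (dir th) + s) 1.
    by have := is_derive_affine 1 (dot z (dir th)) t; under eq_fun do rewrite mul1r addrC.
  have D := @is_derive1_comp R (fun s => Y (dir th, dot z (perp (dir th))) s k)
    (fun s => dot z (dir th) + s) t _ _ (yd (dot z (dir th) + t) k) Sd.
  under eq_fun do rewrite uE; rewrite uE /ap /fp.
  have zt : x0 + iota (z + t *: dir th) =
      x0 + iota (dot z (perp (dir th)) *: perp (dir th)) + (dot z (dir th) + t) *: iota (dir th).
    by rewrite line {1}(decomp th z) -addrA -scalerDl.
  by rewrite zt; move: D; rewrite mulr1.
- by move=> th; rewrite /u /dir mulr_natl cosD2pi sinD2pi.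
- move=> z z' t Kz Kz' t01; have := domain_convex dom Kz Kz' t01.
  have E : x0 + iota (z + t *: (z' - z)) = x0 + iota z + t *: (x0 + iota z' - (x0 + iota z)).
    by rewrite iotaD iotaZ iotaN [in RHS]opprD [in RHS]addrACA subrr add0r addrA.
  by rewrite /K E.
- move=> z zr; apply: rO; rewrite addrAC subrr add0r; apply: le_lt_trans (iota_norm z) _.
  by move: zr r0; lra.
- by move=> z nK k; rewrite /fp fh_out.
move=> e e0; have e2 : 0 < e / 2 by rewrite divr_gt0.
have [d1 d10 D1] := add e2; have [d2 d20 D2] := fdd e2.
exists (Num.min d1 d2 / 2); first by rewrite divr_gt0// lt_min d10.
move=> p v z zd Kp Kpq Kpz Kpqz.
have zn : `|iota z| <= Num.min d1 d2.
  by apply: le_trans (iota_norm z) _; rewrite mulrC -ler_pdivlMr.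
move: zn; rewrite le_min => /andP[z1 z2].
have E1 : x0 + iota (p + v) = (x0 + iota p) + iota v by rewrite iotaD addrA.
have E2 : x0 + iota (p + z) = (x0 + iota p) + iota z by rewrite iotaD addrA.
have E3 : x0 + iota (p + v + z) = (x0 + iota p) + iota v + iota z by rewrite !iotaD !addrA.
have vn : e / 2 * `|iota v| <= e * pnorm v.
  have := ler_wpM2l (ltW e2) (iota_norm v); have -> // : e / 2 * (2 * pnorm v) = e * pnorm v by field.
have K1 : Omega (x0 + iota p + iota v) by rewrite -E1.
have K2 : Omega (x0 + iota p + iota z) by rewrite -E2.
have K3 : Omega (x0 + iota p + iota v + iota z) by rewrite -E3.
split=> [k l|k].
  by rewrite /ap E1 E2 E3; apply: le_trans vn; exact: D1 z1 Kp K1 K2 K3.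
by rewrite /fp !fh_in// E1 E2 E3; apply: le_trans vn; exact: D2 z2 Kp K1 K2 K3.
Qed.

End Slice.

Theorem theorem2p3 (R : realType) (n N : nat) (beta : R)
    (Omega : set 'rV[R]_n) (I F : set 'cV[R[i]]_N)
    (H H' : 'rV[R]_n -> 'M[R[i]]_N)
    (n_ge3 : (3 <= n)%N) (N_ge2 : (2 <= N)%N) (beta_gt0 : 0 < beta)
    (Omega_domain : bounded_convex_domain Omega)
    (H_C1 : C1holder_mx beta Omega H) (H'_C1 : C1holder_mx beta Omega H')
    (H_herm : forall x, closure Omega x -> H x \is hermsymmx)
    (H'_herm : forall x, closure Omega x -> H' x \is hermsymmx)
    (IF_ideal : ideal_data I F) :
  same_data Omega I F H H' <->
  exists phi : 'rV[R]_n -> R,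
    forall x, Omega x -> H' x = H x + ((phi x)%:C)%:M.
Proof.
have N0 : (0 < N)%N by apply: leq_trans N_ge2.
have n2 : (2 <= n)%N by apply: leq_trans n_ge3.
have [Hx [HE Hh Hn]] := hermitian_extension Omega_domain beta_gt0 H_C1 H_herm.
have [Hx' [HE' Hh' Hn']] := hermitian_extension Omega_domain beta_gt0 H'_C1 H'_herm.
split=> [data|]; last first.
  exact: (@gauge_same_data R n N Omega I F H H' Hx Hx' HE HE' Hh Hh' Hn Hn' N0).
have [L L0 [aL aB ad]] := nice_uniform (fun k : (quad N * bool) * (quad N * bool) =>
  ra_nice Hn Hn' k.1 k.2).
have [M M0 [fL fB fd]] := nice_uniform (rf_nice Hn Hn').
have LM : L <= L + M by rewrite lerDl.
have ML : M <= L + M by rewrite lerDr.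
exists (fun x => complex.Re ((Hx' x - Hx x) (Ordinal N0) (Ordinal N0))) => x Ox.
have cO : closure Omega x by exact: subset_closure.
rewrite -HE// -HE'//; apply: tens_source0_scalar => j.
have fz : forall i, rf Hx Hx' x i = 0.
  move=> i; apply: (@slice_uniqueness R n _ Omega Omega_domain n_ge3 (ra Hx Hx') (rf Hx Hx') (L + M)) => //.
  - exact: addr_ge0.
  - by move=> k l y z; apply: le_trans (aL (k, l) y z) _; apply: ler_wpM2r.
  - by move=> y k l; apply: le_trans (aB (k, l) y) _.
  - by move=> k y z; apply: le_trans (fL k y z) _; apply: ler_wpM2r.
  - by move=> y k; apply: le_trans (fB k y) _.
  - by move=> e e0; have [d d0 D] := ad e e0; exists d => // k l; exact: (D (k, l)).
  - by move=> y k by_; apply: (rf_boundary Omega_domain n2 HE HE' Hh Hh' Hn Hn' data IF_ideal).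
  - by move=> y v T seg; exact: (chord_system HE HE' Hh Hh' Hn Hn' data IF_ideal seg).
by apply: ReIm_eq; [exact: (fz (j, false))|exact: (fz (j, true))].
Qed.
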